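(* Let $d\geq 2$ and let $G$ be a graph on $n\geq d+2$ vertices that is globally rigid in $\mathbb{R}^d$. Then $G$ is fully reconstructible in $\mathbb{C}^d$.
   Context: Graphs are finite and simple. For a graph $G=(V,E)$ and $p:V\to\mathbb{C}^d$, the complex framework $(G,p)$ assigns to each edge $uv$ the complex squared length $m_{uv}(p)=\sum_{k=1}^d(p(u)_k-p(v)_k)^2$ (no conjugation). $(G,p)$ is generic if the coordinates of $p$ are algebraically independent over $\mathbb{Q}$. A real framework $(G,p)$, $p:V\to\mathbb{R}^d$, is globally rigid if every $q:V\to\mathbb{R}^d$ with $\|q(u)-q(v)\|=\|p(u)-p(v)\|$ for all edges $uv$ satisfies the same equality for all pairs $u,v\in V$; $G$ is globally rigid in $\mathbb{R}^d$ if every generic real $d$-dimensional framework of $G$ is globally rigid. Two complex frameworks $(G,p),(H,q)$ are length-equivalent under a bijection $\psi:E(G)\to E(H)$ if $m_e(p)=m_{\psi(e)}(q)$ for every $e\in E(G)$. Let $G$ have no isolated vertices. A generic framework $(G,p)$ in $\mathbb{C}^d$ is fully reconstructible if for every graph $H$ without isolated vertices (with any number of vertices) and every generic framework $(H,q)$ in $\mathbb{C}^d$ length-equivalent to $(G,p)$ under some bijection $\psi$, there is a graph isomorphism $\varphi:V(G)\to V(H)$ with $\psi(uv)=\varphi(u)\varphi(v)$ for all $uv\in E(G)$. $G$ is fully reconstructible in $\mathbb{C}^d$ if every generic realization of $G$ in $\mathbb{C}^d$ is fully reconstructible. *)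

(* Defs.v *)
From HB Require Import structures.
From mathcomp Require Import all_boot all_order all_algebra.
From mathcomp Require Import Rstruct.
From mathcomp Require Import complex.
From mathcomp Require Import mpoly.
From Stdlib Require Rdefinitions.

Set Implicit Arguments.
Unset Strict Implicit.
Unset Printing Implicit Defensive.

Import Order.TTheory GRing.Theory Num.Theory.
Local Open Scope ring_scope.

Definition RR : rcfType := Rdefinitions.R.
Definition CC : fieldType := complex RR.

Definition simple_graph (V : finType) (e : rel V) : Prop :=
  ssrbool.symmetric e /\ ssrbool.irreflexive e.

Definition no_isolated (V : finType) (e : rel V) : Prop :=
  forall u : V, exists v : V, e u v.

Definition edges (V : finType) (e : rel V) : {set {set V}} :=
  [set [set x.1; x.2] | x in [set x : V * V | e x.1 x.2]].

(** Algebraic independence over Q of a finite family [x : I -> F]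
    (F of characteristic 0): no nonzero rational polynomial in #|I| variables
    vanishes at the family. *)
Definition alg_indep_Q (F : fieldType) (I : finType) (x : I -> F) : Prop :=
  forall P : mpoly.mpoly #|I| rat, P != 0 ->
    mpoly.mmap (fun c : rat => ratr c) (fun i : 'I_#|I| => x (enum_val i)) P != 0.

Definition generic (F : fieldType) (V : finType) (d : nat) (p : V -> 'I_d -> F)
  : Prop := alg_indep_Q (fun vk : V * 'I_d => p vk.1 vk.2).

(** Complex squared length (no conjugation) / real squared distance. *)
Definition sqlen (F : fieldType) (V : finType) (d : nat) (p : V -> 'I_d -> F)
  (u v : V) : F := \sum_(k < d) (p u k - p v k) ^+ 2.

Definition dist (V : finType) (d : nat) (p : V -> 'I_d -> RR) (u v : V) : RR :=
  Num.sqrt (sqlen p u v).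

Definition globally_rigid_framework (V : finType) (e : rel V) (d : nat)
  (p : V -> 'I_d -> RR) : Prop :=
  forall q : V -> 'I_d -> RR,
    (forall u v, e u v -> dist q u v = dist p u v) ->
    forall u v, dist q u v = dist p u v.

Definition globally_rigid (V : finType) (e : rel V) (d : nat) : Prop :=
  forall p : V -> 'I_d -> RR, generic p -> globally_rigid_framework e p.

(** (G,p) and (H,q) are length-equivalent under psi : E(G) -> E(H) bijective
    (psi given on 2-sets, only its restriction to E(G) matters). *)
Definition length_equivalent (V W : finType) (eG : rel V) (eH : rel W) (d : nat)
  (p : V -> 'I_d -> CC) (q : W -> 'I_d -> CC) (psi : {set V} -> {set W}) : Prop :=
  [/\ {in edges eG &, injective psi},
      psi @: edges eG = edges eH &
      forall u v, eG u v ->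
        exists x y, psi [set u; v] = [set x; y] /\ sqlen q x y = sqlen p u v].

Definition fully_reconstructible_framework (V : finType) (eG : rel V) (d : nat)
  (p : V -> 'I_d -> CC) : Prop :=
  forall (W : finType) (eH : rel W), simple_graph eH -> no_isolated eH ->
  forall q : W -> 'I_d -> CC, generic q ->
  forall psi : {set V} -> {set W}, length_equivalent eG eH p q psi ->
  exists phi : V -> W,
    [/\ bijective phi,
        (forall u v, eG u v = eH (phi u) (phi v)) &
        forall u v, eG u v -> psi [set u; v] = [set phi u; phi v]].

Definition fully_reconstructible (V : finType) (eG : rel V) (d : nat) : Prop :=
  forall p : V -> 'I_d -> CC, generic p -> fully_reconstructible_framework eG p.

(* Main.v *)
(** Genericity is used through derivations: the coordinates of [p] are algebraically
    independent over Q exactly when there are derivations of the field with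
    arbitrarily prescribed values on them.

    Let [K(p)] be the space of functions on the vertices that are balanced by every
    stress of [p].  For a generic real [p], global rigidity gives infinitesimal
    rigidity (by averaging [p + c xi] and [p - c xi]) and [K(p)] = affine functions
    of [p].  For the latter, suppose [K(p)] is larger; then the measurement map
    restricted to configurations with coordinates in [K(p)] has an image smaller
    than its linear span, and where a segment first enters that image the map
    folds.  Near such a fold, chosen generic, there are two non-congruent
    configurations with equal lengths, and the first one is generic because its
    stresses are those of [p].  Both properties are statements about ranks of
    matrices affine in [p], so they pass from one real generic configuration to all
    complex generic ones.

    If [(G, p)] and [(H, q)] are generic, complex and length-equivalent, they have
    the same stresses, so a derivation acting on [q] by an affine map acts on [p] by
    an affine map.  Differentiating the length equations along scalings of a
    coordinate and along arbitrary motions of a coordinate of [q] shows that the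
    edge vectors of [q] are, up to one sign per edge, the images of those of [p]
    under an orthogonal map.  Differentiating once more, the cut spaces of [G] and
    [H] agree up to these signs.  Since [G] minus two vertices is connected (else one
    side could be reflected), vertex stars correspond to vertex stars, as in
    Whitney's theorem. *)

Require Import Defs.
From HB Require Import structures.
From mathcomp Require Import all_boot all_order all_algebra.
From mathcomp Require mpoly.
From mathcomp Require Import boolp classical_sets cardinality reals ereal.
From mathcomp Require Import normedtype derive lebesgue_measure.
From mathcomp Require Import Rstruct complex.
From mathcomp Require Import ring lra zify.
From Stdlib Require Rdefinitions.

Set Implicit Arguments.
Unset Strict Implicit.
Unset Printing Implicit Defensive.

Import Order.TTheory GRing.Theory Num.Theory numFieldNormedType.Exports.
Import -(notations) mpoly.
Local Open Scope ring_scope.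

(** * Derivations and algebraic independence *)

Section Derivations.
Variable F : numFieldType.

(** Dimension counts for semialgebraic images and Zariski open sets are replaced by linear algebra
    over derivations. Openness of a rank condition becomes [mxrank_spec]: a derivation that kills
    [M0] and fixes [M1] shows that the rank does not drop from [M0] to [M0 + M1]. Choosing a generic
    point becomes choosing elements transcendental over finitely many given ones, possible because
    the field is uncountable; derivatives that will be needed later are put among the given
    elements.

    The obstacle is the fold: it comes from compactness, so nothing algebraic is known about its
    coordinates. But the end of the segment is generic, and deriving the polynomial equations of the
    fold point along that end shows that the derivatives of the fold point reach every direction up
    to rotations and one kernel direction. A generic rotation and a generic displacement along the
    kernel restore these. That the rank drops by exactly one at the fold also excludes degenerate
    configurations there: spanning fewer than [d] dimensions would cost at least two. *)

Record deriv (D : F -> F) : Prop := Deriv {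
  derD : forall x y, D (x + y) = D x + D y;
  derM : forall x y, D (x * y) = D x * y + x * D y }.

Lemma der0 D : deriv D -> D 0 = 0.
Proof. by move=> dD; apply: (@addrI _ (D 0)); rewrite -derD// !addr0. Qed.

Lemma der1 D : deriv D -> D 1 = 0.
Proof.
move=> dD; apply: (@addrI _ (D 1)); rewrite addr0.
by rewrite -[in RHS](mulr1 1) derM// mulr1 mul1r.
Qed.

Lemma derN D x : deriv D -> D (- x) = - D x.
Proof.
by move=> dD; apply: (@addrI _ (D x)); rewrite -derD// !subrr der0.
Qed.

Lemma derB D x y : deriv D -> D (x - y) = D x - D y.
Proof. by move=> dD; rewrite derD// derN. Qed.

Lemma der_sum D (I : Type) (r : seq I) (P : pred I) (f : I -> F) : deriv D ->
  D (\sum_(i <- r | P i) f i) = \sum_(i <- r | P i) D (f i).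
Proof. by move=> dD; apply: big_morph; [exact: derD|exact: der0]. Qed.

Lemma der_nat D n : deriv D -> D n%:R = 0.
Proof.
move=> dD; elim: n => [|n IH]; first exact: der0.
by rewrite -natr1 derD// IH der1// addr0.
Qed.

Lemma der_int D (n : int) : deriv D -> D n%:~R = 0.
Proof.
by move=> dD; case: n => n; rewrite ?NegzE ?rmorphN/= ?derN// der_nat// oppr0.
Qed.

Lemma derX D x n : deriv D -> D (x ^+ n.+1) = n.+1%:R * x ^+ n * D x.
Proof.
move=> dD; elim: n => [|n IH]; first by rewrite !expr1 expr0 !mul1r.
rewrite exprS derM// IH exprS -[in RHS]natr1; ring.
Qed.

Lemma der_sqr D x : deriv D -> D (x ^+ 2) = 2 * x * D x.
Proof. by move=> dD; rewrite derX// expr1. Qed.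

Lemma derV_eq0 D x : deriv D -> D x = 0 -> D x^-1 = 0.
Proof.
move=> dD Dx; have [->|x0] := eqVneq x 0; first by rewrite invr0 der0.
have: D (x * x^-1) = 0 by rewrite divff// der1.
by rewrite derM// Dx mul0r add0r => /eqP; rewrite mulf_eq0 (negPf x0) => /eqP.
Qed.

Lemma der_ratr D (c : rat) : deriv D -> D (ratr c) = 0.
Proof.
move=> dD; rewrite /ratr derM// der_int// mul0r add0r.
by rewrite derV_eq0 ?mulr0// der_int.
Qed.

Lemma deriv_lin (I : Type) (r : seq I) (P : pred I) (c : I -> F) (D : I -> F -> F) :
  (forall i, deriv (D i)) -> deriv (fun x => \sum_(i <- r | P i) c i * D i x).
Proof.
move=> dD; split=> x y.
  by rewrite -big_split/=; apply: eq_bigr => i _; rewrite derD// mulrDr.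
rewrite mulr_suml mulr_sumr -big_split/=.
by apply: eq_bigr => i _; rewrite derM//; ring.
Qed.

Lemma deriv_add D1 D2 : deriv D1 -> deriv D2 -> deriv (fun x => D1 x + D2 x).
Proof.
move=> d1 d2; split=> x y; first by rewrite (derD d1) (derD d2); ring.
by rewrite (derM d1) (derM d2); ring.
Qed.

Lemma deriv_scale c D : deriv D -> deriv (fun x => c * D x).
Proof. by move=> d1; split=> x y; rewrite ?(derD d1) ?(derM d1); ring. Qed.

(* [G] is a subring of the dual numbers [F[eps]], a pair (a, b) standing for
   a + b eps, on which the projection to [F] is injective. *)
Record dual_graph (G : set (F * F)) : Prop := DualGraph {
  dg1 : G (1, 0);
  dgB : forall a b a' b', G (a, a') -> G (b, b') -> G (a - b, a' - b');
  dgM : forall a b a' b', G (a, a') -> G (b, b') -> G (a * b, a' * b + a * b');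
  dg_inj : forall b, G (0, b) -> b = 0 }.

Section Extension.
Variables (G : set (F * F)) (dG : dual_graph G).

Let g0 : G (0, 0).
Proof. by have := dgB dG (dg1 dG) (dg1 dG); rewrite !subrr. Qed.

Let gN a a' : G (a, a') -> G (- a, - a').
Proof. by move=> h; have := dgB dG g0 h; rewrite !sub0r. Qed.

Let gD a b a' b' : G (a, a') -> G (b, b') -> G (a + b, a' + b').
Proof.
by move=> ha hb; have := dgB dG ha (gN hb); rewrite !opprK.
Qed.

Let g_sum (I : Type) (r : seq I) (f g : I -> F) :
  (forall i, G (f i, g i)) -> G (\sum_(i <- r) f i, \sum_(i <- r) g i).
Proof.
move=> h; elim: r => [|i r IH]; first by rewrite !big_nil.
by rewrite !big_cons; apply: gD.
Qed.

Let gp (P Q : {poly F}) := forall i, G (P`_i, Q`_i).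

Let gpB P Q P' Q' : gp P P' -> gp Q Q' -> gp (P - Q) (P' - Q').
Proof. by move=> h k i; rewrite !coefB; apply: dgB. Qed.

Let gpM P Q P' Q' : gp P P' -> gp Q Q' -> gp (P * Q) (P' * Q + P * Q').
Proof.
move=> h k i; rewrite coefD !coefM -big_split/=; apply: g_sum => j.
exact: dgM.
Qed.

Let gpC a a' : G (a, a') -> gp a%:P a'%:P.
Proof. by move=> h i; rewrite !coefC; case: eqP. Qed.

Let gpX n : gp 'X^n 0.
Proof. by move=> i; rewrite coefXn coef0; case: eqP => // _; exact: dg1. Qed.

Let gp_deriv P P' : gp P P' -> gp P^`() P'^`().
Proof.
move=> h i; rewrite !coef_deriv; elim: i.+1 {1 3}(i.+1) => [|n IH] k.
  by rewrite !mulr0n.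
by rewrite !mulrS; apply: gD.
Qed.

Let gp0 P' : gp 0 P' -> P' = 0.
Proof.
move=> h; apply/polyP => i; rewrite coef0; apply: dg_inj dG _ _.
by have := h i; rewrite coef0.
Qed.

(** Extending to [a] requires an [a'] compatible with every polynomial relation satisfied by [a]
    over the domain of [G]. Without relations any value works. Otherwise a relation [m] of least
    degree has nonzero derivative at [a], in characteristic 0, and determines [a']; the other
    relations follow by pseudo-division by [m]. *)
Lemma dual_graph_extend (a : F) :
  exists a', exists G', [/\ dual_graph G', (G `<=` G')%classic & G' (a, a')].
Proof.
suff [a' ha'] : exists a', forall P P', gp P P' -> P.[a] = 0 ->
    P'.[a] + P^`().[a] * a' = 0.
  exists a', ((fun u : F * F => exists P P', [/\ gp P P', u.1 = P.[a] &
    u.2 = P'.[a] + P^`().[a] * a']) : set (F * F)); split.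
  - split.
    + exists 1, 0; split; rewrite ?hornerE//=; first exact: (@gpC 1 0 (dg1 dG)).
      by rewrite -(polyC1 F) derivC !hornerE.
    + move=> x y x' y' [P [P' [h /= -> ->]]] [Q [Q' [k /= -> ->]]].
      exists (P - Q), (P' - Q'); split; [exact: gpB| |] => /=.
        by rewrite !hornerE.
      by rewrite derivB !hornerE; ring.
    + move=> x y x' y' [P [P' [h /= -> ->]]] [Q [Q' [k /= -> ->]]].
      exists (P * Q), (P' * Q + P * Q'); split; [exact: gpM| |] => /=.
        by rewrite !hornerE.
      by rewrite derivM !hornerE; ring.
    + by move=> b [P [P' [h /= /esym h0 ->]]]; exact: ha'.
  - move=> [x x'] gx; exists x%:P, x'%:P; split=> /=; first exact: gpC.
      by rewrite hornerC.
    by rewrite derivC !hornerE.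
  - exists 'X, 0; split => /=; [|by rewrite hornerX|].
      by have := gpX 1; rewrite expr1.
    by rewrite derivX !hornerE.
have [[P0 [P0' [hP0 P0nz P0a]]]|noroot] :=
  pselect (exists P P', [/\ gp P P', P != 0 & P.[a] = 0]); last first.
  (* Transcendental case: the only relation is the zero polynomial, so 0 is as good as any other
     value. *)
  exists 0 => P P' h Pa; have P0 : P = 0.
    by apply/eqP/negP => /negP nz; apply: noroot; exists P, P'.
  by move: h; rewrite P0 => /gp0 ->; rewrite horner0 mulr0 addr0.
pose sz n := `[< exists P P', [/\ gp P P', P != 0, P.[a] = 0 & size P = n] >].
have exsz : exists n, sz n by exists (size P0); apply/asboolP; exists P0, P0'.
case: (ex_minnP exsz) => n /asboolP[m [m' [hm mnz ma sm]]] nmin.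
have small P P' : gp P P' -> P.[a] = 0 -> (size P < n)%N -> P = 0.
  move=> h Pa; apply: contraTeq => nz; rewrite -leqNgt; apply: nmin.
  by apply/asboolP; exists P, P'.
have m1 : (1 < size m)%N.
  rewrite ltnNge; apply/negP => /size1_polyC mC; move: ma mnz.
  by rewrite mC hornerC => ->; rewrite eqxx.
(* The derivative of [m] has its coefficients in the domain too, so by minimality it can vanish at
   [a] only if it is zero; but its leading coefficient is a nonzero multiple of that of [m]. *)
have dma : m^`().[a] != 0.
  have [k sk] : exists k, size m = k.+2.
    by case: (size m) m1 => [|[|k]] // _; exists k.
  apply/negP => /eqP e; have := small _ _ (gp_deriv hm) e.
  rewrite -sm lt_size_deriv// => /(_ isT) /(congr1 (fun p : {poly F} => p`_k)).
  rewrite coef0 coef_deriv => /eqP; rewrite mulrn_eq0 /=.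
  by have := lead_coef_eq0 m; rewrite lead_coefE sk /= (negPf mnz) => ->.
have [a' key] : exists a', m'.[a] + m^`().[a] * a' = 0.
  by exists (- m'.[a] / m^`().[a]); rewrite mulrCA mulfV// mulr1 subrr.
exists a' => P.
have [k] := ubnP (size P); elim: k P => // k IH P sP P' h Pa.
have [lt|le] := ltnP (size P) n.
  have Pz := small _ _ h Pa lt.
  by move: h; rewrite Pz => /gp0 ->; rewrite deriv0 !horner0 mul0r addr0.
pose N := (size P - size m)%N.
pose l := lead_coef m; pose l' := m'`_(size m).-1.
pose c := lead_coef P; pose c' := P'`_(size P).-1.
have hl : gp l%:P l'%:P by apply: gpC; exact: hm.
have hc : gp c%:P c'%:P by apply: gpC; exact: h.
(* Pseudo-division [l * P - c * 'X^N * m]: the domain is only a ring, so [P] is multiplied by the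
   leading coefficient [l] of [m] rather than divided by it. *)
have hQ := gpB (gpM hl h) (gpM (gpM hc (gpX N)) hm).
set Q := (X in gp X _) in hQ; set Q' := (X in gp _ X) in hQ.
have Qa : Q.[a] = 0 by rewrite /Q !hornerE Pa ma !mulr0 subr0.
have Pnz : P != 0.
  by apply: contraTneq le => ->; rewrite size_poly0 -ltnNge -sm; apply: leq_trans m1.
have sQ : (size Q < k)%N.
  have sPk : (size P <= k)%N by [].
  apply: leq_trans sPk; rewrite (polySpred Pnz) ltnS; apply/leq_sizeP => j hj.
  rewrite /Q coefB coefCM -mulrA coefCM coefXnM.
  have sPj : (size P <= j.+1)%N by rewrite (polySpred Pnz).
  have smP : (size m <= size P)%N by rewrite sm.
  case: ltnP => [jN|Nj].
    by exfalso; move: jN m1 sPj; rewrite /N; clear; lia.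
  have [e|ne] := eqVneq j (size P).-1.
    have -> : (j - N = (size m).-1)%N.
      rewrite e /N; move: m1 smP; clear; lia.
    by rewrite e -/(lead_coef m) -/(lead_coef P) mulrC subrr.
  have big : (size P <= j)%N by move: hj ne; clear; lia.
  rewrite (nth_default _ big) nth_default ?mulr0 ?subr0//.
  by rewrite -{1}(subKn smP) leq_sub2r.
have := IH Q sQ Q' hQ Qa; rewrite /Q /Q' !derivB !derivM !derivC !hornerE.
rewrite Pa ma => e.
have lnz : l != 0 by rewrite lead_coef_eq0.
apply: (mulfI lnz); rewrite mulr0 -[RHS]e.
have -> : m'.[a] = - (m^`().[a] * a') by apply/eqP; rewrite -addr_eq0 key.
ring.
Qed.

End Extension.

(** Zorn's lemma, a maximal extension being total by [dual_graph_extend]. The sets ordered are the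
    [X] whose union with [G] is a dual graph, so that the empty chain is no exception. *)
Lemma dual_graph_deriv (G : set (F * F)) : dual_graph G ->
  exists D : F -> F, deriv D /\ forall a b, G (a, b) -> b = D a.
Proof.
move=> dG.
have [F' F'F chain|G' [dG' G'max]] := @Zorn_bigcup _ (fun X => dual_graph (G `|` X)%classic).
  have pick u v : (G `|` \bigcup_(X in F') X)%classic u ->
      (G `|` \bigcup_(X in F') X)%classic v ->
      (G u /\ G v) \/ exists2 X, F' X & (G `|` X)%classic u /\ (G `|` X)%classic v.
    move=> [gu|[X FX Xu]] [gv|[Y FY Yv]].
    - by left.
    - by right; exists Y => //; split; [left|right].
    - by right; exists X => //; split; [right|left].
    - right; have [XY|YX] := chain _ _ FX FY.
        by exists Y => //; split; right => //; exact: XY.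
      by exists X => //; split; right => //; exact: YX.
  have sub X u : F' X -> (G `|` X)%classic u -> (G `|` \bigcup_(X in F') X)%classic u.
    by move=> FX [gu|Xu]; [left|right; exists X].
  split.
  - by left; exact: dg1 dG.
  - move=> a b a' b' /pick ha /ha [[ga gb]|[X FX [ga gb]]].
      by left; exact: dgB.
    by apply: (sub X) => //; exact: (dgB (F'F _ FX) ga gb).
  - move=> a b a' b' /pick ha /ha [[ga gb]|[X FX [ga gb]]].
      by left; exact: dgM.
    by apply: (sub X) => //; exact: (dgM (F'F _ FX) ga gb).
  - move=> b [gb|[X FX Xb]]; first exact: dg_inj dG _ gb.
    by apply: (dg_inj (F'F _ FX)); right.
set H := (G `|` G')%classic in dG'.
have total a : exists b, H (a, b).
  have [b [H' [dH' HH' H'ab]]] := dual_graph_extend dG' a.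
  exists b; apply: contrapT => nH.
  apply: (G'max H').
    split; first by move=> u G'u; apply: HH'; right.
    by move=> sub; apply: nH; right; exact: sub.
  suff -> : (G `|` H')%classic = H' by [].
  by apply/seteqP; split=> u; [case=> // gu; apply: HH'; left|right].
have uniq a b b' : H (a, b) -> H (a, b') -> b = b'.
  move=> h h'; have := dgB dG' h h'; rewrite subrr => /(dg_inj dG') /eqP.
  by rewrite subr_eq0 => /eqP.
have /choice [D hD] := total; exists D; split; last first.
  by move=> a b gab; apply: uniq (hD a); left.
have H00 : H (0, 0) by have := dgB dG' (dg1 dG') (dg1 dG'); rewrite !subrr.
split=> x y; last by apply: uniq (hD _) _; exact: dgM.
apply: uniq (hD _) _; have := dgB dG' H00 (hD y); rewrite !sub0r => hN.
by have := dgB dG' (hD x) hN; rewrite !opprK.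
Qed.

End Derivations.

Section AlgebraicIndependence.
Variable F : numFieldType.

(** Partial derivatives with respect to the [x i], extended to the whole field. *)
Definition dual_derivs (I : eqType) (x : I -> F) (D : I -> F -> F) : Prop :=
  (forall i, deriv (D i)) /\ forall i j, D i (x j) = (i == j)%:R.

Lemma mderiv_eval n (x : 'I_n -> F) (D : F -> F) (P : mpoly.mpoly n rat) :
  deriv D ->
  D (mpoly.mmap (fun c : rat => ratr c) x P) =
  \sum_i mpoly.mmap (fun c : rat => ratr c) x (mpoly.mderiv i P) * D (x i).
Proof.
move=> dD; pose ev : {rmorphism mpoly.mpoly n rat -> F} := mpoly.mmap (@ratr F) x.
rewrite -[mpoly.mmap _ _]/(ev : _ -> _).
have evC c : ev (mpoly.mpolyC n c) = ratr c by exact: mpoly.mmapC.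
pose good Q := D (ev Q) = \sum_i ev (mpoly.mderiv i Q) * D (x i).
have goodC c : good (mpoly.mpolyC n c).
  rewrite /good evC der_ratr// big1// => i _.
  by rewrite mpoly.mderivC rmorph0 mul0r.
have goodD Q1 Q2 : good Q1 -> good Q2 -> good (Q1 + Q2).
  rewrite /good => h1 h2; rewrite rmorphD/= derD// h1 h2 -big_split/=.
  by apply: eq_bigr => i _; rewrite mpoly.mderivD rmorphD/= mulrDl.
have goodM Q1 Q2 : good Q1 -> good Q2 -> good (Q1 * Q2).
  rewrite /good => h1 h2; rewrite rmorphM/= derM// h1 h2.
  rewrite mulr_suml mulr_sumr -big_split/=.
  by apply: eq_bigr => i _; rewrite mpoly.mderivM rmorphD/= !rmorphM/=; ring.
have goodX i : good (mpoly.mpolyX rat (mpoly.mnm1 i)).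
  rewrite /good [ev _]mpoly.mmapX mpoly.mmap1U (bigD1 i)//= big1 ?addr0.
    rewrite mpoly.mderivX mpoly.mnm1E eqxx scale1r.
    suff -> : mpoly.mnm_sub (mpoly.mnm1 i) (mpoly.mnm1 i) = mpoly.mnm0 (n := n).
      by rewrite mpoly.mpolyX0 rmorph1 mul1r.
    by apply/mpoly.mnmP => j; rewrite mpoly.mnmBE mpoly.mnm0E subnn.
  move=> j ji; rewrite mpoly.mderivX mpoly.mnm1E eq_sym (negPf ji).
  by rewrite scale0r rmorph0 mul0r.
suff: good P by [].
elim/mpoly.mpolyind: P => [|c m Q _ _ gQ].
  by rewrite -(mpoly.mpolyC0 _ _); exact: goodC.
apply: (goodD) => //; rewrite -mpoly.mul_mpolyC; apply: (goodM) => //.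
rewrite mpoly.mpolyXE_id; elim/big_rec: _ => [|i Q' _ gQ'].
  by rewrite -(mpoly.mpolyC1 _ _); exact: goodC.
apply: (goodM) => //; elim: (m i) => [|k IH].
  by rewrite expr0 -(mpoly.mpolyC1 _ _); exact: goodC.
by rewrite exprS; apply: (goodM).
Qed.

(** Independence makes evaluation at [x] injective on rational polynomials, so the pairs formed by
    the value of [P] and that of its [i]-th partial derivative are the graph of a derivation on the
    ring generated by [x]; [dual_graph_deriv] extends it to [F]. *)
Lemma alg_indep_dual_derivs (I : finType) (x : I -> F) :
  alg_indep_Q x -> exists D, dual_derivs x D.
Proof.
move=> ix; suff /choice[D hD] : forall i, exists D : F -> F, deriv D /\
    forall j, D (x j) = (i == j)%:R.
  by exists D; split=> [i|i j]; have [] := hD i.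
move=> i; pose y (k : 'I_#|I|) := x (enum_val k).
pose ev : {rmorphism mpoly.mpoly #|I| rat -> F} := mpoly.mmap (@ratr F) y.
pose G : set (F * F) :=
  fun u => exists P, u = (ev P, ev (mpoly.mderiv (enum_rank i) P)).
have ev_inj P : ev P = 0 -> P = 0.
  by move=> e; have [//|/ix] := eqVneq P 0; rewrite -[mpoly.mmap _ _ _]/(ev P) e eqxx.
have dG : dual_graph G.
  split.
  - by exists 1; rewrite rmorph1 -(mpoly.mpolyC1 _ _) mpoly.mderivC rmorph0.
  - move=> a b a' b' [P [-> ->]] [Q [-> ->]]; exists (P - Q).
    by rewrite mpoly.mderivB !rmorphB.
  - move=> a b a' b' [P [-> ->]] [Q [-> ->]]; exists (P * Q).
    by rewrite mpoly.mderivM rmorphD !rmorphM.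
  - by move=> b [P [/esym /ev_inj -> ->]]; rewrite mpoly.mderiv0 rmorph0.
have [D [dD hD]] := dual_graph_deriv dG; exists D; split=> // j.
symmetry; apply: hD; exists (mpoly.mpolyX rat (mpoly.mnm1 (enum_rank j))).
congr (_, _); first by rewrite [RHS]mpoly.mmapX mpoly.mmap1U /y enum_rankK.
rewrite mpoly.mderivX mpoly.mnm1E (inj_eq enum_rank_inj) eq_sym.
case: eqVneq => [->|_]; last by rewrite scale0r [RHS]rmorph0.
rewrite scale1r.
suff -> : mpoly.mnm_sub (mpoly.mnm1 (enum_rank i)) (mpoly.mnm1 (enum_rank i)) =
    mpoly.mnm0 (n := #|I|) by rewrite mpoly.mpolyX0 [RHS]rmorph1.
by apply/mpoly.mnmP => k; rewrite mpoly.mnmBE mpoly.mnm0E subnn.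
Qed.

(** Induction on the degree: deriving [P(x) = 0] along [D i] shows that each partial derivative of
    [P] vanishes at [x], hence is zero. Then [P] is constant, in characteristic 0, and the constant
    is 0. *)
Lemma dual_derivs_alg_indep (I : finType) (x : I -> F) D :
  dual_derivs x D -> alg_indep_Q x.
Proof.
move=> [dD hD] P; apply: contraNneq.
pose y (k : 'I_#|I|) := x (enum_val k).
rewrite -[mpoly.mmap _ _ _]/(mpoly.mmap (@ratr F) y P) => Py.
have [k hk] : exists k, forall m, (k <= mpoly.mdeg m)%N -> mpoly.mcoeff m P = 0.
  exists (mpoly.msize P) => m /mpoly.msize_mdeg_ge.
  exact: mpoly.memN_msupp_eq0.
elim: k P hk Py => [|k IH] P hk Py.
  by apply/eqP/mpoly.mpolyP => m; rewrite hk// mpoly.mcoeff0.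
have dP i : mpoly.mderiv i P = 0.
  apply/eqP; apply: IH => [m hm|].
    rewrite mpoly.mcoeff_deriv hk ?mul0rn// mpoly.mdegD mpoly.mdeg1.
    by rewrite addn1 ltnS.
  have := mderiv_eval y P (dD (enum_val i)); rewrite Py der0//.
  rewrite (bigD1 i)//= big1 ?addr0 => [|j ji].
    by rewrite hD eqxx mulr1.
  by rewrite hD (inj_eq enum_val_inj) eq_sym (negPf ji) mulr0.
have PC : P = mpoly.mpolyC _ (mpoly.mcoeff mpoly.mnm0 P).
  apply/mpoly.mpolyP => m; rewrite mpoly.mcoeffC.
  have [->|m0] := eqVneq m mpoly.mnm0; first by rewrite mulr1.
  rewrite mulr0; have [i mi] : exists i, m i != 0%N.
    apply/existsP; apply: contraNT m0; rewrite negb_exists => /forallP h.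
    by apply/eqP/mpoly.mnmP => i; rewrite mpoly.mnm0E; apply/eqP; have := h i; rewrite negbK.
  have := congr1 (mpoly.mcoeff (mpoly.mnm_sub m (mpoly.mnm1 i))) (dP i).
  rewrite mpoly.mcoeff_deriv mpoly.mcoeff0 mpoly.submK; last first.
    by apply/mpoly.mnm_lepP => l; rewrite mpoly.mnm1E; case: eqP => // <-; rewrite lt0n.
  by move/eqP; rewrite mulrn_eq0 => /orP[//|/eqP].
move: Py; rewrite PC mpoly.mmapC => /eqP.
by rewrite fmorph_eq0 => /eqP ->; rewrite mpoly.mpolyC0.
Qed.

End AlgebraicIndependence.

(** * Derivations with prescribed directions, and semicontinuity of rank *)

Section Directions.
Variable F : numFieldType.

Lemma dual_derivs_dir (I : finType) (x : I -> F) D (v : I -> F) :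
  dual_derivs x D ->
  exists D', [/\ deriv D', forall i, D' (x i) = v i &
    forall z, (forall i, D i z = 0) -> D' z = 0].
Proof.
move=> [dD hD]; exists (fun z => \sum_i v i * D i z); split.
- exact: deriv_lin.
- move=> i; rewrite (bigD1 i)//= big1 ?addr0 => [|j ji].
    by rewrite hD eqxx mulr1.
  by rewrite hD (negPf ji) mulr0.
- by move=> z h; rewrite big1// => i _; rewrite h mulr0.
Qed.

(** Typical use: [x] was chosen transcendental over some data, all killed by the [D i]; then [D0]
    can be kept on the data and overridden on [x]. *)
Lemma deriv_adjust (I : finType) (x : I -> F) D D0 (v : I -> F) :
  dual_derivs x D -> deriv D0 ->
  exists D', [/\ deriv D', forall i, D' (x i) = v i &
    forall z, (forall i, D i z = 0) -> D' z = D0 z].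
Proof.
move=> hD d0; have [D' [dD' D'x D'z]] := dual_derivs_dir (fun i => v i - D0 (x i)) hD.
exists (fun z => D0 z + D' z); split; first exact: deriv_add.
  by move=> i; rewrite D'x addrC subrK.
by move=> z h; rewrite D'z// addr0.
Qed.

(** Eigenvectors of [D] for distinct eigenvalues are independent: applying [D - n] to the relation
    removes its last term. *)
Lemma eigen_sum_eq0 (D : F -> F) n (f : nat -> F) : deriv D ->
  (forall k, D (f k) = k%:R * f k) -> \sum_(k < n) f k = 0 ->
  forall k, (k < n)%N -> f k = 0.
Proof.
move=> dD; elim: n f => [//|n IH] f hf s0 k.
have fk j : (j < n)%N -> f j = 0.
  have hg i : D ((i%:R - n%:R) * f i) = i%:R * ((i%:R - n%:R) * f i).
    by rewrite (derM dD) (derB _ _ dD) !(der_nat _ dD) hf; ring.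
  have sg : \sum_(k < n) (k%:R - n%:R) * f k = 0.
    have := congr1 D s0; rewrite der0// der_sum// => sD.
    have : \sum_(k < n.+1) (k%:R - n%:R) * f k = 0.
      under eq_bigr do rewrite mulrBl -hf.
      by rewrite sumrB sD -mulr_sumr s0 mulr0 subr0.
    by rewrite big_ord_recr/= subrr mul0r addr0.
  move=> jn; have /eqP := IH _ hg sg j jn.
  by rewrite mulf_eq0 subr_eq0 eqr_nat (ltn_eqF jn) => /eqP.
rewrite ltnS leq_eqVlt => /orP[/eqP ->|]; last exact: fk.
by move: s0; rewrite big_ord_recr/= big1 ?add0r// => i _; rewrite fk.
Qed.

(** The coefficient of ['X^k] in [det (M0 + 'X M1)] is an eigenvector of [D] for [k]. A zero at
    ['X = 1] says that these eigenvectors sum to 0, so each is 0, in particular the one for [k = 0],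
    which is [det M0]. *)
Lemma det_spec r (D : F -> F) (M0 M1 : 'M[F]_r) : deriv D ->
  (forall i j, D (M0 i j) = 0) -> (forall i j, D (M1 i j) = M1 i j) ->
  \det (M0 + M1) = 0 -> \det M0 = 0.
Proof.
move=> dD h0 h1 det0.
pose P := \det (\matrix_(i, j) ((M0 i j)%:P + 'X * (M1 i j)%:P)).
pose good (Q : {poly F}) := forall k, D Q`_k = k%:R * Q`_k.
have good1 : good 1.
  move=> k; rewrite coef1; case: k => [|k] /=; first by rewrite der1// mul0r.
  by rewrite der0// mulr0.
have good0 : good 0 by move=> k; rewrite coef0 der0// mulr0.
have goodD Q R : good Q -> good R -> good (Q + R).
  by move=> hQ hR k; rewrite coefD derD// hQ hR mulrDr.
have goodM Q R : good Q -> good R -> good (Q * R).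
  move=> hQ hR k; rewrite coefM der_sum// mulr_sumr; apply: eq_bigr => i _.
  rewrite derM// hQ hR.
  have -> : k%:R = i%:R + (k - i)%:R :> F by rewrite -natrD subnKC// -ltnS.
  by ring.
have goodN Q : good Q -> good (- Q).
  by move=> hQ k; rewrite coefN derN// hQ mulrN.
have gP : good P.
  rewrite /P /determinant; elim/big_ind: _ => // s _.
  apply: (goodM).
    move: (nat_of_bool _) => k; elim: k => [|k IH]; rewrite ?expr0 ?exprS ?mulN1r //.
    exact: (goodN).
  elim/big_ind: _ => // i _; rewrite mxE; apply: (goodD).
    move=> k; rewrite coefC; case: k => [|k] /=; first by rewrite h0 mul0r.
    by rewrite (der0 dD) mulr0.
  move=> k; rewrite coefXM coefC; case: k => [|[|k]] /=; rewrite ?(der0 dD) ?mulr0//.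
  by rewrite h1 mul1r.
have evP a : P.[a] = \det (\matrix_(i, j) (M0 i j + a * M1 i j)).
  rewrite /P -horner_evalE -det_map_mx; congr (\det _).
  by apply/matrixP => i j; rewrite !mxE /= horner_evalE !hornerE.
have P1 : P.[1] = 0.
  by rewrite evP -[RHS]det0; congr (\det _); apply/matrixP => i j; rewrite !mxE mul1r.
have -> : \det M0 = P`_0.
  by rewrite -horner_coef0 evP; congr (\det _); apply/matrixP => i j; rewrite !mxE mul0r addr0.
have [s|s] := ltnP 0 (size P); last by rewrite nth_default.
apply: (eigen_sum_eq0 dD gP _ s).
transitivity P.[1] => //; rewrite horner_coef; apply: eq_bigr => i _; by rewrite expr1n mulr1.
Qed.

(** Semicontinuity of rank: [M0] is the specialisation at 0 of a matrix whose linear part [M1] is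
    scaled by the Euler derivation [D]. An invertible submatrix of [M0] of maximal size stays
    invertible in [M0 + M1] by [det_spec]. *)
Lemma mxrank_spec m n (D : F -> F) (M0 M1 : 'M[F]_(m, n)) : deriv D ->
  (forall i j, D (M0 i j) = 0) -> (forall i j, D (M1 i j) = M1 i j) ->
  (\rank M0 <= \rank (M0 + M1)%R)%N.
Proof.
move=> dD h0 h1.
pose B := rowsub (maxrankfun M0) M0.
have fB : row_full B^T by rewrite /row_full mxrank_tr -/(row_free B) maxrowsub_free.
pose f := maxrankfun M0; pose g := fullrankfun fB.
have u0 : mxsub f g M0 \in unitmx.
  have := fullrowsub_unit fB; rewrite -unitmx_tr; congr (_ \in unitmx).
  by apply/matrixP => i j; rewrite !mxE.
have u1 : mxsub f g (M0 + M1) \in unitmx.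
  move: u0; rewrite !unitmxE !unitfE; apply: contra => /eqP det0.
  apply/eqP; apply: (@det_spec _ D _ (mxsub f g M1)) => // [i j|i j|].
  - by rewrite mxE.
  - by rewrite !mxE.
  - by rewrite -[RHS]det0; congr (\det _); apply/matrixP => i j; rewrite !mxE.
rewrite -{1}(mxrank_unit u1).
have -> : mxsub f g (M0 + M1) = rowsub f (colsub g (M0 + M1)).
  by apply/matrixP => i j; rewrite !mxE.
apply: leq_trans (mxrankS (rowsub_sub _ _)) _.
rewrite -mxrank_tr -[leqRHS]mxrank_tr.
have -> : (colsub g (M0 + M1))^T = rowsub g (M0 + M1)^T.
  by apply/matrixP => i j; rewrite !mxE.
exact: mxrankS (rowsub_sub _ _).
Qed.

End Directions.

(** * Elements transcendental over given ones, by counting *)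

Section Transcendence.
Variable F : numFieldType.
Hypothesis uncF : ~ countable [set: F].

Section Countable.
Variables (J : finType) (y : J -> F).

(** [GenTree.tree] serves as a syntax of ring expressions because it is countable; the values are
    the subring generated by the [y j]. *)
Fixpoint ring_eval (t : GenTree.tree J) : F :=
  match t with
  | GenTree.Leaf j => y j
  | GenTree.Node 0 l => foldr (fun t acc => ring_eval t + acc) 0 l
  | GenTree.Node 1 l => foldr (fun t acc => ring_eval t * acc) 1 l
  | GenTree.Node _ l => - foldr (fun t acc => ring_eval t + acc) 0 l
  end.

Let A (a : F) := exists t, a = ring_eval t.

Let A0 : A 0. Proof. by exists (GenTree.Node 0 [::]). Qed.
Let A1 : A 1. Proof. by exists (GenTree.Node 1 [::]). Qed.
Let AD a b : A a -> A b -> A (a + b).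
Proof. by move=> [t ->] [u ->]; exists (GenTree.Node 0 [:: t; u]); rewrite /= addr0. Qed.
Let AM a b : A a -> A b -> A (a * b).
Proof. by move=> [t ->] [u ->]; exists (GenTree.Node 1 [:: t; u]); rewrite /= mulr1. Qed.
Let AN a : A a -> A (- a).
Proof. by move=> [t ->]; exists (GenTree.Node 2 [:: t]); rewrite /= addr0. Qed.
Let Ay j : A (y j). Proof. by exists (GenTree.Leaf j). Qed.

Let AP (P : {poly F}) := forall i, A P`_i.

Let AP_enum P : AP P -> exists s, P = Poly (map ring_eval s).
Proof.
move=> /choice[t ht]; exists (mkseq t (size P)).
apply/polyP => i; rewrite coef_Poly.
have [iP|Pi] := ltnP i (size P); last by rewrite !nth_default// size_map size_mkseq.
by rewrite (nth_map (GenTree.Node 0 [::])) ?size_mkseq// nth_mkseq.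
Qed.

(** Countably many polynomials over the ring generated by [y], each with finitely many roots, cannot
    exhaust [F]. For [x] outside all these roots, [d/dx] on polynomial expressions in [x] is well
    defined, and it extends to [F]. *)
Lemma exists_transcendental :
  exists x D, [/\ deriv D, D x = 1 & forall j, D (y j) = 0].
Proof.
have [x hx] : exists x, forall P, AP P -> P.[x] = 0 -> P = 0.
  apply: contrapT => /forallNP alg; apply: uncF.
  pose roots (s : seq (GenTree.tree J)) : set F :=
    fun x => Poly (map ring_eval s) != 0 /\ root (Poly (map ring_eval s)) x.
  have : countable (\bigcup_(s in [set: seq (GenTree.tree J)]) roots s)%classic.
    apply: bigcup_countable; first exact: countableP.
    move=> s _; set P := Poly (map ring_eval s).
    have [P0|Pn0] := eqVneq P 0.
      rewrite (_ : roots s = set0)%classic; first exact: countable0.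
      by apply/seteqP; split=> // x [] /=; rewrite -/P P0 eqxx.
    apply: finite_set_countable; apply: contrapT => inf.
    have [X Xsub Xcard] := infinite_set_fset (size P) inf.
    have := max_poly_roots (rs := finmap.enum_fset X) Pn0.
    rewrite finmap.fset_uniq => /(_ _ isT); rewrite ltnNge Xcard => /(_ _)/negP; apply=> //.
    by apply/allP => x xX; have [] := Xsub x xX.
  apply: sub_countable; apply: subset_card_le => x _.
  have /existsNP[P /not_implyP[AP_P /not_implyP[Px Pn0]]] := alg x.
  have [s Ps] := AP_enum AP_P; exists s => //; split; rewrite -Ps.
    by apply/eqP.
  by apply/eqP.
pose G : set (F * F) := fun u => exists2 P, AP P & u = (P.[x], P^`().[x]).
have dG : dual_graph G.
  split.
  - exists 1; last by rewrite hornerC -(polyC1 F) derivC horner0.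
    by move=> i; rewrite coef1; case: i.
  - move=> a b a' b' [P hP [-> ->]] [Q hQ [-> ->]]; exists (P - Q).
      by move=> i; rewrite coefB; apply: AD => //; exact: AN.
    by rewrite derivB !hornerE.
  - move=> a b a' b' [P hP [-> ->]] [Q hQ [-> ->]]; exists (P * Q).
      move=> i; rewrite coefM; elim/big_ind: _ => [||j _]; [exact: A0|exact: AD|exact: AM].
    by rewrite derivM !hornerE.
  - by move=> b [P hP [/esym /hx -> // ->]]; rewrite deriv0 horner0.
have [D [dD hD]] := dual_graph_deriv dG; exists x, D; split=> //.
  symmetry; apply: hD; exists 'X; last by rewrite hornerX derivX hornerC.
  by move=> i; rewrite coefX; case: eqP.
move=> j; symmetry; apply: hD; exists (y j)%:P; last by rewrite derivC hornerC horner0.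
by move=> i; rewrite coefC; case: eqP.
Qed.

End Countable.

Lemma exists_dual_derivs (K J : finType) (y : J -> F) :
  exists c : K -> F, exists D, dual_derivs c D /\ forall i j, D i (y j) = 0.
Proof.
suff [c [D [dD hD hy]]] : exists (c : K -> F) (D : K -> F -> F),
    [/\ forall i, deriv (D i),
      forall i j, i \in enum K -> j \in enum K -> D i (c j) = (i == j)%:R &
      forall i j, i \in enum K -> D i (y j) = 0].
  exists c, D; split; first by split=> // i j; apply: hD; rewrite mem_enum.
  by move=> i j; apply: hy; rewrite mem_enum.
elim: (enum K) (enum_uniq K) => [_|k s IH /= /andP[ks us]].
  exists (fun=> 0), (fun _ _ => 0); split=> // i; split=> x z; rewrite ?addr0//.
  by rewrite mul0r mulr0 addr0.
have [c [D [dD hD hy]]] := IH us.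
have [x [D0 [d0 D0x D0y]]] := exists_transcendental
  (fun u : J + K => match u with inl j => y j | inr i => c i end).
exists (fun i => if i == k then x else c i).
(* The old derivations are corrected by a multiple of [D0] so that they kill the new element [x]; as
   [D0] kills the earlier [c j] and the [y j], their values there do not change. *)
exists (fun i z => if i == k then D0 z else D i z - D i x * D0 z); split.
- move=> i; case: eqP => // _.
  have -> : (fun z => D i z - D i x * D0 z) = (fun z => D i z + (- D i x) * D0 z).
    by apply/funext => z; rewrite mulNr.
  by apply: deriv_add => //; exact: deriv_scale.
- move=> i j; rewrite !inE.
  case: (eqVneq i k) => [->|ik] /=; case: (eqVneq j k) => [->|jk] /=.
  + by rewrite D0x.
  + by move=> _ js; rewrite (D0y (inr j)).
  + by move=> _ _; rewrite D0x mulr1 subrr (negPf ik).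
  + by move=> si sj; rewrite (D0y (inr j)) mulr0 subr0 hD.
- move=> i j; rewrite !inE; case: eqVneq => [->|ik] /=; first by rewrite (D0y (inl j)).
  by move=> si; rewrite hy// (D0y (inl j)) mulr0 subr0.
Qed.

End Transcendence.

(** * Linear systems indexed by finite types *)

Section FiniteSystems.
Variable F : fieldType.

Definition fmx (I J : finType) (M : I -> J -> F) : 'M[F]_(#|I|, #|J|) :=
  \matrix_(i, j) M (enum_val i) (enum_val j).

Definition frow (I : finType) (f : I -> F) : 'rV[F]_#|I| :=
  \row_i f (enum_val i).

Definition fanti (I : finType) (u : 'rV[F]_#|I|) (i : I) : F := u 0 (enum_rank i).

Lemma frowK (I : finType) (f : I -> F) : fanti (frow f) =1 f.
Proof. by move=> i; rewrite /fanti mxE enum_rankK. Qed.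

Lemma fantiK (I : finType) (u : 'rV[F]_#|I|) : frow (fanti u) = u.
Proof. by apply/rowP => i; rewrite mxE /fanti enum_valK. Qed.

Lemma big_ord_enum_val (I : finType) (f : I -> F) :
  \sum_(i < #|I|) f (enum_val i) = \sum_i f i.
Proof. by rewrite [RHS]big_enum_val. Qed.

Lemma frow_mul (I J : finType) (f : I -> F) (M : I -> J -> F) :
  frow f *m fmx M = frow (fun j => \sum_i f i * M i j).
Proof.
apply/rowP => j; rewrite !mxE -[RHS]big_ord_enum_val.
by apply: eq_bigr => i _; rewrite !mxE.
Qed.

Lemma frow_eq0 (I : finType) (f : I -> F) : frow f = 0 <-> forall i, f i = 0.
Proof.
split=> [h i|h]; last by apply/rowP => i; rewrite !mxE.
by rewrite -(frowK f) h /fanti mxE.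
Qed.

Lemma fmul_eq0 (I J : finType) (f : I -> F) (M : I -> J -> F) :
  frow f *m fmx M = 0 <-> forall j, \sum_i f i * M i j = 0.
Proof. by rewrite frow_mul frow_eq0. Qed.

Lemma frow_submx (I J : finType) (f : J -> F) (M : I -> J -> F) :
  (frow f <= fmx M)%MS <-> exists c, forall j, f j = \sum_i c i * M i j.
Proof.
split=> [/submxP[u hu]|[c hc]].
  exists (fanti u) => j; rewrite -[LHS]frowK hu -{1}(fantiK u) frow_mul.
  by rewrite frowK.
by apply/submxP; exists (frow c); rewrite frow_mul; apply/rowP => j; rewrite !mxE hc.
Qed.

Lemma fmx_mul_eq0 (I J L : finType) (N : L -> I -> F) (M : I -> J -> F) :
  (forall l j, \sum_i N l i * M i j = 0) -> fmx N *m fmx M = 0.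
Proof.
move=> h; apply/matrixP => l j; rewrite !mxE -[RHS](h (enum_val l) (enum_val j)).
by rewrite -[RHS]big_ord_enum_val; apply: eq_bigr => i _; rewrite !mxE.
Qed.

(** Fredholm alternative: the left kernel of [M] is the only obstruction to solving. *)
Lemma fsolvable (I J : finType) (M : I -> J -> F) (eta : I -> F) :
  (forall w, (forall j, \sum_i w i * M i j = 0) -> \sum_i w i * eta i = 0) ->
  exists xi, forall i, eta i = \sum_j M i j * xi j.
Proof.
move=> h; have : (frow eta <= fmx (fun j i => M i j))%MS.
  have -> : fmx (fun j i => M i j) = (fmx M)^T by apply/matrixP => i j; rewrite !mxE.
  rewrite submxE; apply/eqP/trmx_inj; rewrite trmx0 trmx_mul.
  apply/row_matrixP => i; rewrite row0 row_mul.
  set w := row i _; rewrite -(fantiK w).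
  have wM : frow (fanti w) *m fmx M = 0.
    rewrite fantiK; apply: trmx_inj; rewrite trmx_mul trmx0 /w tr_row trmxK.
    by rewrite colE mulmxA mulmx_coker mul0mx.
  have := h _ ((fmul_eq0 _ _).1 wM) => e; apply/rowP => j.
  rewrite !mxE -[RHS]e -[RHS]big_ord_enum_val; apply: eq_bigr => k _.
  by rewrite !mxE.
move=> /frow_submx[c hc]; exists c => i; rewrite hc.
by apply: eq_bigr => j _; rewrite mulrC.
Qed.

Lemma fker_eq (I J : finType) (M M' : I -> J -> F) :
  (forall w, (forall j, \sum_i w i * M i j = 0) ->
             forall j, \sum_i w i * M' i j = 0) ->
  (\rank (fmx M) <= \rank (fmx M'))%N ->
  forall w, (forall j, \sum_i w i * M' i j = 0) ->
            forall j, \sum_i w i * M i j = 0.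
Proof.
move=> h rk w hw.
have sub : (kermx (fmx M) <= kermx (fmx M'))%MS.
  apply/row_subP => i; apply/sub_kermxP; rewrite -(fantiK (row i _)).
  apply/fmul_eq0/h/fmul_eq0; rewrite fantiK.
  by apply/sub_kermxP/row_sub.
have /eqmxP/eqmx_sym eqK : (kermx (fmx M) == kermx (fmx M'))%MS.
  by rewrite -(geq_leqif (mxrank_leqif_eq sub)) !mxrank_ker leq_sub2l.
apply/fmul_eq0/sub_kermxP; rewrite -eqK; apply/sub_kermxP/fmul_eq0.
exact: hw.
Qed.

(** Exactness in the middle of [L -> I -> J], restricted to the nontrivial inclusion; the composite
    being zero is stated separately, as in [fexactP]. *)
Definition fexact (I J L : finType) (N : L -> I -> F) (M : I -> J -> F) : Prop :=
  forall v, (forall j, \sum_i v i * M i j = 0) ->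
            exists c, forall i, v i = \sum_l c l * N l i.

(** The rows of [N] lie in the left kernel of [M], of dimension [#|I| - rank M], so exactness is a
    lower bound on ranks. In this form it passes to generic points by [mxrank_spec] and is
    unaffected by field extension. *)
Lemma fexactP (I J L : finType) (N : L -> I -> F) (M : I -> J -> F) :
  (forall l j, \sum_i N l i * M i j = 0) ->
  fexact N M <-> (#|I| <= \rank (fmx M) + \rank (fmx N))%N.
Proof.
move=> NM; have sub : (fmx N <= kermx (fmx M))%MS.
  by apply/sub_kermxP; exact: fmx_mul_eq0.
have rM : (\rank (fmx M) <= #|I|)%N by exact: rank_leq_row.
split=> [ex|rk v hv].
  have : (kermx (fmx M) <= fmx N)%MS.
    apply/row_subP => i; rewrite -(fantiK (row i _)); apply/frow_submx/ex.
    by apply/fmul_eq0; rewrite fantiK; apply/sub_kermxP/row_sub.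
  by move=> /mxrankS; rewrite mxrank_ker leq_subLR.
have /eqmxP eqK : (fmx N == kermx (fmx M))%MS.
  by rewrite -(geq_leqif (mxrank_leqif_eq sub)) mxrank_ker leq_subLR.
by apply/frow_submx; rewrite eqK; apply/sub_kermxP/fmul_eq0.
Qed.

(* A linear map [Phi] for which preimages of a subspace stay in the subspace
   induces an injection, hence a surjection, modulo that subspace. *)
Lemma fsurj_mod (I L : finType) (Phi : I -> I -> F) (C : I -> L -> F) :
  (forall u, (forall l, \sum_i (\sum_k u k * Phi k i) * C i l = 0) ->
             forall l, \sum_i u i * C i l = 0) ->
  forall v, exists u, forall l, \sum_i (v i - \sum_k u k * Phi k i) * C i l = 0.
Proof.
move=> h v.
have PC u : frow u *m (fmx Phi *m fmx C) = 0 <->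
    forall l, \sum_i (\sum_k u k * Phi k i) * C i l = 0.
  by rewrite mulmxA frow_mul fmul_eq0.
have sub : (kermx (fmx Phi *m fmx C) <= kermx (fmx C))%MS.
  apply/row_subP => i; apply/sub_kermxP; rewrite -(fantiK (row i _)).
  by apply/fmul_eq0/h/PC; rewrite fantiK; apply/sub_kermxP/row_sub.
have rk : (\rank (fmx C) <= \rank (fmx Phi *m fmx C))%N.
  have := mxrankS sub; rewrite !mxrank_ker.
  have := rank_leq_row (fmx C); have := rank_leq_row (fmx Phi *m fmx C).
  by lia.
have : (fmx C <= fmx Phi *m fmx C)%MS.
  by rewrite -(geq_leqif (mxrank_leqif_sup (submxMl (fmx Phi) (fmx C)))).
move=> /(submx_trans (submxMl (frow v) (fmx C)))/submxP[u hu].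
exists (fanti u); apply/fmul_eq0.
have -> : frow (fun i => v i - \sum_k fanti u k * Phi k i) = frow v - u *m fmx Phi.
  by rewrite -{2}(fantiK u) frow_mul; apply/rowP => i; rewrite !mxE.
by rewrite mulmxBl hu mulmxA subrr.
Qed.

End FiniteSystems.

(** * Frameworks, stresses and the stress kernel *)

Lemma sum_indic (F : pzRingType) (I : finType) (i : I) (f : I -> F) :
  \sum_j (i == j)%:R * f j = f i.
Proof.
rewrite (bigD1 i)//= eqxx mul1r big1 ?addr0// => j ji.
by rewrite eq_sym (negPf ji) mul0r.
Qed.

Lemma sum_indicr (F : pzRingType) (I : finType) (i : I) (f : I -> F) :
  \sum_j f j * (i == j)%:R = f i.
Proof.
rewrite (bigD1 i)//= eqxx mulr1 big1 ?addr0// => j ji.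
by rewrite eq_sym (negPf ji) mulr0.
Qed.

Lemma sum_pair (F : nmodType) (I J : finType) (f : I -> J -> F) :
  \sum_(x : I * J) f x.1 x.2 = \sum_i \sum_j f i j.
Proof. by rewrite pair_bigA. Qed.

Lemma sum_option (F : nmodType) (I : finType) (f : option I -> F) :
  \sum_x f x = f None + \sum_i f (Some i).
Proof.
rewrite (bigD1 None)//=; congr (_ + _).
rewrite (reindex_omap Some id)//=; last by case.
by apply: eq_bigl => i; rewrite eqxx.
Qed.

Section Polarization.
Variables (F : fieldType) (V : finType).

(** On expanding the product, the terms in [u] alone or in [v] alone are killed by one of the zero
    sums and the cross terms remain. With functionals dual to a configuration this reads off the
    coefficients of a form known only on differences of points. *)
Lemma polarize (phi psi f g : V -> F) :
  \sum_v phi v = 0 -> \sum_v psi v = 0 ->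
  \sum_u \sum_v phi u * psi v * ((f u - f v) * (g u - g v)) =
  - ((\sum_u phi u * f u) * (\sum_v psi v * g v) +
     (\sum_v psi v * f v) * (\sum_u phi u * g u)).
Proof.
move=> phi0 psi0.
have e u : \sum_v phi u * psi v * ((f u - f v) * (g u - g v)) =
    phi u * f u * g u * (\sum_v psi v) + phi u * (\sum_v psi v * (f v * g v))
    - (phi u * f u * (\sum_v psi v * g v) + phi u * g u * (\sum_v psi v * f v)).
  rewrite !mulr_sumr -!big_split -sumrB/=; apply: eq_bigr => v _; ring.
under eq_bigr do rewrite e psi0 mulr0 add0r.
rewrite sumrB -mulr_suml phi0 mul0r sub0r big_split/= -!mulr_suml.
by rewrite [X in _ + X]mulrC.
Qed.

Definition aff_indep (I : finType) (p : V -> I -> F) : Prop :=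
  forall a t, (forall v, \sum_k a k * p v k + t = 0) -> forall k, a k = 0.

Definition affine (I : finType) (p : V -> I -> F) (z : V -> F) : Prop :=
  exists a t, forall v, z v = \sum_k a k * p v k + t.

Lemma aff_indep_dual (I : finType) (p : V -> I -> F) : aff_indep p ->
  exists phi : I -> V -> F, forall l, \sum_v phi l v = 0 /\
    forall k, \sum_v phi l v * p v k = (l == k)%:R.
Proof.
move=> ip; suff /choice[phi hphi] : forall l, exists phi : V -> F,
    \sum_v phi v = 0 /\ forall k, \sum_v phi v * p v k = (l == k)%:R.
  by exists phi.
move=> l.
pose M (o : option I) v := if o is Some k then p v k else 1.
pose eta o : F := if o is Some k then (l == k)%:R else 0.
have [w hw|phi hphi] := @fsolvable F _ _ M eta.
  have w0 : forall k, w (Some k) = 0.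
    apply: (ip _ (w None)) => v; have := hw v.
    by rewrite sum_option /= mulr1 addrC.
  by rewrite sum_option /= mulr0 add0r big1// => k _; rewrite w0 mul0r.
exists phi; split=> [|k].
  by rewrite [RHS](hphi None); apply: eq_bigr => v _; rewrite /= mul1r.
by rewrite [RHS](hphi (Some k)); apply: eq_bigr => v _; rewrite /= mulrC.
Qed.

Lemma affineP (I : finType) (p : V -> I -> F) z :
  (forall phi, \sum_v phi v = 0 -> (forall k, \sum_v phi v * p v k = 0) ->
    \sum_v phi v * z v = 0) -> affine p z.
Proof.
move=> h; pose M v (o : option I) := if o is Some k then p v k else 1.
have [w hw|a ha] := @fsolvable F _ _ M z.
  apply: h => [|k]; last exact: (hw (Some k)).
  by have := hw None; rewrite /=; under eq_bigr do rewrite mulr1.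
exists (fun k => a (Some k)), (a None) => v.
rewrite ha sum_option /= mul1r addrC; congr (_ + _).
by apply: eq_bigr => k _; rewrite mulrC.
Qed.

Lemma form_eq0 (I : finType) (p : V -> I -> F) (Q : I -> I -> F) :
  aff_indep p ->
  (forall u v, \sum_k \sum_l Q k l * ((p u k - p v k) * (p u l - p v l)) = 0) ->
  forall k l, Q k l + Q l k = 0.
Proof.
move=> /aff_indep_dual[phi hphi] hQ k l.
have [k0 hk] := hphi k; have [l0 hl] := hphi l.
have : \sum_u \sum_v phi k u * phi l v *
    (\sum_i \sum_j Q i j * ((p u i - p v i) * (p u j - p v j))) = 0.
  by rewrite big1// => u _; rewrite big1// => v _; rewrite hQ mulr0.
have -> : \sum_u \sum_v phi k u * phi l v *
    (\sum_i \sum_j Q i j * ((p u i - p v i) * (p u j - p v j))) =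
  \sum_i \sum_j Q i j * (\sum_u \sum_v phi k u * phi l v *
    ((p u i - p v i) * (p u j - p v j))).
  under eq_bigr do under eq_bigr do rewrite mulr_sumr.
  under eq_bigr do rewrite exchange_big /=.
  rewrite exchange_big /=; apply: eq_bigr => i _.
  under eq_bigr do under eq_bigr do rewrite mulr_sumr.
  under eq_bigr do rewrite exchange_big /=.
  rewrite exchange_big /=; apply: eq_bigr => j _.
  rewrite mulr_sumr; apply: eq_bigr => u _.
  by rewrite mulr_sumr; apply: eq_bigr => v _; ring.
under eq_bigr do under eq_bigr do rewrite polarize// !hk !hl mulrN mulrDr.
under eq_bigr do rewrite sumrN big_split /=.
rewrite sumrN big_split /= => /eqP; rewrite oppr_eq0 => /eqP h; rewrite -[RHS]h.
congr (_ + _).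
  rewrite -[LHS](sum_indic k (fun i => Q i l)); apply: eq_bigr => i _.
  rewrite -[Q i l](sum_indic l (fun j => Q i j)) mulr_sumr.
  by apply: eq_bigr => j _; ring.
rewrite -[LHS](sum_indic l (fun i => Q i k)); apply: eq_bigr => i _.
rewrite -[Q i k](sum_indic k (fun j => Q i j)) mulr_sumr.
by apply: eq_bigr => j _; ring.
Qed.

Definition trivial_motion (I : finType) (p xi : V -> I -> F) : Prop :=
  exists X t, (forall k l, X k l = - X l k) /\
    forall v k, xi v k = \sum_l X k l * p v l + t k.

(** Polarizing flatness with functionals dual to [p] shows that the matrix of [xi] in the
    coordinates of [p] is skew; the functional taking the value at [v] minus that at [v0] then
    expresses [xi v] through this matrix. *)
Lemma flat_trivial (I : finType) (p xi : V -> I -> F) : aff_indep p ->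
  (forall u v, \sum_k (p u k - p v k) * (xi u k - xi v k) = 0) ->
  trivial_motion p xi.
Proof.
move=> /aff_indep_dual[phi hphi] flat.
have [v0|noV] := pselect (exists v : V, True); last first.
  exists (fun _ _ => 0), (fun=> 0); split=> [k l|v]; first by rewrite oppr0.
  by case: noV; exists v.
case: v0 => v0 _.
have key f g : \sum_v f v = 0 -> \sum_v g v = 0 ->
    \sum_k ((\sum_v f v * p v k) * (\sum_v g v * xi v k) +
            (\sum_v g v * p v k) * (\sum_v f v * xi v k)) = 0.
  move=> f0 g0; apply/eqP; rewrite -oppr_eq0 -sumrN; apply/eqP.
  under eq_bigr do rewrite -polarize//.
  rewrite exchange_big big1//= => u _; rewrite exchange_big big1//= => v _.
  by rewrite -mulr_sumr flat mulr0.
pose Xi f k := \sum_v f v * xi v k.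
have keyl l g : \sum_v g v = 0 ->
    Xi g l = - \sum_k (\sum_v g v * p v k) * Xi (phi l) k.
  move=> g0; have [l0 hl] := hphi l; have := key _ _ l0 g0.
  rewrite big_split /= => /eqP; rewrite addr_eq0 => /eqP <-.
  rewrite -[LHS](sum_indic l (Xi g)); apply: eq_bigr => k _.
  by rewrite hl.
exists (fun l k => - Xi (phi l) k).
exists (fun l => xi v0 l + \sum_k p v0 k * Xi (phi l) k).
split=> [k l|v l].
  have [k0 hk] := hphi k; rewrite opprK (keyl l _ k0) opprK.
  by under eq_bigr do rewrite hk; rewrite sum_indic.
pose g w : F := (v == w)%:R - (v0 == w)%:R.
have gE (f : V -> F) : \sum_w g w * f w = f v - f v0.
  under eq_bigr do rewrite mulrBl.
  by rewrite sumrB !sum_indic.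
have g0 : \sum_w g w = 0.
  by have := gE (fun=> 1); under eq_bigr do rewrite mulr1; rewrite subrr.
have := keyl l g g0; rewrite /Xi gE => /eqP; rewrite subr_eq => /eqP ->.
rewrite addrCA [LHS]addrC; congr (_ + _).
rewrite -sumrN -big_split/=; apply: eq_bigr => k _.
by rewrite gE /Xi; ring.
Qed.

End Polarization.

Section Frameworks.
Variables (F : numFieldType) (V E : finType) (s t : E -> V).

Definition dl (f : V -> F) (e : E) : F := f (s e) - f (t e).

Lemma dl_der (D : F -> F) f e : deriv D -> D (dl f e) = dl (fun v => D (f v)) e.
Proof. by move=> dD; rewrite /dl (derB _ _ dD). Qed.

Lemma dlD f g e : dl (fun v => f v + g v) e = dl f e + dl g e.
Proof. by rewrite /dl opprD addrACA. Qed.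

Lemma dlB f g e : dl (fun v => f v - g v) e = dl f e - dl g e.
Proof. by rewrite /dl; ring. Qed.

Lemma dlZ c f e : dl (fun v => c * f v) e = c * dl f e.
Proof. by rewrite /dl mulrBr. Qed.

Lemma dl_cst c e : dl (fun=> c) e = 0.
Proof. by rewrite /dl subrr. Qed.

Lemma dl_sum (I : finType) (f : I -> V -> F) e :
  dl (fun v => \sum_i f i v) e = \sum_i dl (f i) e.
Proof. by rewrite /dl sumrB. Qed.

Lemma dl_lin (I : finType) (a : I -> F) c (p : V -> I -> F) e :
  dl (fun v => \sum_i a i * p v i + c) e = \sum_i a i * dl (p^~ i) e.
Proof.
rewrite dlD dl_cst addr0 dl_sum; apply: eq_bigr => i _; exact: dlZ.
Qed.

Lemma eq_dl f g e : f =1 g -> dl f e = dl g e.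
Proof. by move=> fg; rewrite /dl !fg. Qed.

(** Weak form of equilibrium: the Laplacian with edge weights [w] annihilates [z]. Testing against
    all [eta] avoids sums over the edges at a vertex and does not depend on the orientation of
    edges. *)
Definition balanced (w : E -> F) (z : V -> F) : Prop :=
  forall eta, \sum_e w e * dl z e * dl eta e = 0.

Lemma balanced_lin (I : finType) (a : I -> F) c (p : V -> I -> F) z w :
  (forall k, balanced w (p^~ k)) -> (forall v, z v = \sum_i a i * p v i + c) ->
  balanced w z.
Proof.
move=> hp hz eta; under eq_bigr do rewrite (eq_dl _ hz) dl_lin mulr_sumr mulr_suml.
rewrite exchange_big big1//= => i _.
have := hp i eta => /(congr1 (fun x => a i * x)); rewrite mulr0 mulr_sumr => e0.
by rewrite -[RHS]e0; apply: eq_bigr => e _; ring.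
Qed.

(** Product rule; the term where [D] falls on [eta] vanishes, since [w] balances [z] against [D eta]
    as well. *)
Lemma balanced_der (D : F -> F) w z eta : deriv D -> balanced w z ->
  \sum_e D (w e) * dl z e * dl eta e +
  \sum_e w e * dl (fun v => D (z v)) e * dl eta e = 0.
Proof.
move=> dD wz; have := congr1 D (wz eta).
rewrite (der0 dD) (der_sum _ _ _ dD) => e0.
transitivity (\sum_e D (w e * dl z e * dl eta e) -
              \sum_e w e * dl z e * dl (fun v => D (eta v)) e).
  rewrite -sumrB -big_split/=; apply: eq_bigr => e _.
  by rewrite !(derM dD) !(dl_der _ _ dD); ring.
by rewrite e0 wz subr0.
Qed.

Variable (I : finType).
Implicit Types (p q xi : V -> I -> F) (w : E -> F) (z : V -> F).

Definition stress p w : Prop := forall k, balanced w (p^~ k).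

Definition stress_kernel p z : Prop := forall w, stress p w -> balanced w z.

Definition inf_motion p xi : Prop :=
  forall e, \sum_k dl (p^~ k) e * dl (xi^~ k) e = 0.

Definition inf_rigid p : Prop := forall xi, inf_motion p xi -> trivial_motion p xi.

Definition conf_generic p : Prop :=
  exists D, dual_derivs (fun vk : V * I => p vk.1 vk.2) D.

(** The derivative of the equilibrium equations has two terms, so one vanishes with the other;
    [kernel_der] is the converse. Thus a derivation preserves stresses exactly when it keeps [p] in
    the stress kernel. *)
Lemma stress_der (D : F -> F) p w : deriv D -> stress p w ->
  (forall k, balanced w (fun v => D (p v k))) -> stress p (fun e => D (w e)).
Proof.
move=> dD pw Dp k eta; have := balanced_der eta dD (pw k).
by rewrite Dp addr0.
Qed.

Lemma kernel_der (D : F -> F) p w : deriv D -> stress p w ->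
  stress p (fun e => D (w e)) -> forall k, balanced w (fun v => D (p v k)).
Proof.
move=> dD pw Dw k eta; have := balanced_der eta dD (pw k).
by rewrite Dw add0r.
Qed.

Definition rigidity_mx p (e : E) (x : V * I) : F :=
  dl (p^~ x.2) e * ((s e == x.1)%:R - (t e == x.1)%:R).

Lemma rigidity_mxE p e xi :
  \sum_x rigidity_mx p e x * xi x.1 x.2 = \sum_k dl (p^~ k) e * dl (xi^~ k) e.
Proof.
rewrite (sum_pair (fun v k => rigidity_mx p e (v, k) * xi v k)) exchange_big/=.
apply: eq_bigr => k _; rewrite {2}/dl.
rewrite -(sum_indic (s e) (xi^~ k)) -(sum_indic (t e) (xi^~ k)) -sumrB mulr_sumr.
by apply: eq_bigr => v _; rewrite /rigidity_mx /=; ring.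
Qed.

Lemma stress_rigidity_mx p w :
  stress p w <-> forall x, \sum_e w e * rigidity_mx p e x = 0.
Proof.
split=> [pw [u k]|hw k f].
  rewrite -[RHS](pw k (fun v => (v == u)%:R)); apply: eq_bigr => e _.
  by rewrite /rigidity_mx /= /dl; ring.
have := congr1 (fun g => \sum_v g v * f v)
  (funext (fun v => hw (v, k)) : _ = (fun v => 0)).
under eq_bigr do rewrite mulr_suml.
rewrite exchange_big/= [RHS]big1 => [|v _]; last by rewrite mul0r.
move=> e0; rewrite -[RHS]e0; apply: eq_bigr => e _.
rewrite {2}/dl -(sum_indic (s e) f) -(sum_indic (t e) f) -sumrB mulr_sumr.
by apply: eq_bigr => v _; rewrite /rigidity_mx /=; ring.
Qed.

(** [fsolvable] for the rigidity matrix, whose left kernel is the space of stresses. *)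
Lemma stress_dual p (eta : E -> F) :
  (forall w, stress p w -> \sum_e w e * eta e = 0) ->
  exists xi : V -> I -> F, forall e, eta e = \sum_k dl (p^~ k) e * dl (xi^~ k) e.
Proof.
move=> h; have [w /stress_rigidity_mx|xi hxi] := @fsolvable F _ _ (rigidity_mx p) eta.
  exact: h.
exists (fun v k => xi (v, k)) => e; rewrite hxi -rigidity_mxE.
by apply: eq_bigr => -[].
Qed.

(** Specialisation to [p0], which puts distinct vertices [f i] at the unit vectors and the others,
    among them [v0], at the origin. Independence there is a rank condition and passes to [p] by
    [mxrank_spec]. *)
Lemma generic_aff_indep p : (#|I| < #|V|)%N -> conf_generic p -> aff_indep p.
Proof.
move=> IV [D hD].
have [f finj] : exists f : I -> V, injective f.
  exists (fun i => enum_val (widen_ord (ltnW IV) (enum_rank i))) => i j.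
  by move=> /enum_val_inj [] /ord_inj /enum_rank_inj.
have [v0 hv0] : exists v0, forall i, v0 != f i.
  have : ~~ [forall v, v \in codom f].
    apply: contraL IV => /forallP h; rewrite -leqNgt.
    rewrite -(card_codom finj).
    have /subset_leq_card : V \subset codom f by apply/fintype.subsetP => v _.
    by [].
  rewrite negb_forall => /existsP[v0 hv0]; exists v0 => i.
  by apply: contraNneq hv0 => ->; exact: codom_f.
pose p0 v i : F := (v == f i)%:R.
have [D' [dD' D'p D'c]] := dual_derivs_dir
  (fun x : V * I => p x.1 x.2 - p0 x.1 x.2) hD.
have D'p0 v i : D' (p0 v i) = 0 by rewrite (der_nat _ dD').
pose M (r : V -> I -> F) (o : option I) v := if o is Some k then r v k else 1.
have rk : (\rank (fmx (M p0)) <= \rank (fmx (M p)))%N.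
  pose M1 o v := if o is Some k then p v k - p0 v k else 0.
  have -> : fmx (M p) = fmx (M p0) + fmx M1.
    apply/matrixP => i j; rewrite !mxE /M /M1.
    by case: (enum_val i) => [k|]; rewrite ?addr0// addrC subrK.
  apply: (mxrank_spec dD') => i j; rewrite !mxE /M /M1.
    by case: (enum_val i) => [k|]; rewrite ?D'p0 ?(der1 dD').
  case: (enum_val i) => [k|]; last exact: der0.
  by rewrite (derB _ _ dD') D'p0 subr0 (D'p (_, _)).
move=> a c h.
have := @fker_eq F _ _ (M p0) (M p) _ rk (fun o => if o is Some k then a k else c).
move=> H k; have {}H : forall v, \sum_i (if i is Some k then a k else c) * M p0 i v = 0.
  apply: H => [w hw v|v].
    have w0 : w None = 0.
      have := hw v0; rewrite sum_option /= mulr1 big1 ?addr0// => i _.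
      by rewrite /p0 (negPf (hv0 i)) mulr0.
    have w1 i : w (Some i) = 0.
      have := hw (f i); rewrite sum_option /= w0 mul0r add0r /p0.
      rewrite (bigD1 i)//= eqxx mulr1 big1 ?addr0// => j ji.
      by rewrite (inj_eq finj) eq_sym (negPf ji) mulr0.
    by rewrite big1// => -[i|] _; rewrite ?w0 ?w1 mul0r.
  by rewrite sum_option /= mulr1 addrC -[RHS](h v).
have := H v0; rewrite sum_option /= mulr1 big1 ?addr0 => [c0|i _]; last first.
  by rewrite /p0 (negPf (hv0 i)) mulr0.
have := H (f k); rewrite sum_option /= c0 mul0r add0r /p0.
rewrite (bigD1 k)//= eqxx mulr1 big1 ?addr0// => j jk.
by rewrite (inj_eq finj) eq_sym (negPf jk) mulr0.
Qed.

End Frameworks.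

Section Subspaces.
Variables (F : fieldType) (V : finType).

Lemma aff_indep_card (I : finType) (p : V -> I -> F) :
  aff_indep p -> (#|I| <= #|V|)%N.
Proof.
move=> /aff_indep_dual[phi hphi].
apply: (@mulmx1_min _ _ _ (fmx phi) (fmx p)).
apply/matrixP => i j; rewrite !mxE -(inj_eq enum_val_inj) -(hphi _).2.
by rewrite -[RHS]big_ord_enum_val; apply: eq_bigr => v _; rewrite !mxE.
Qed.

Lemma aff_indep_option (I : finType) (p : V -> I -> F) y :
  aff_indep p -> ~ affine p y ->
  aff_indep (fun v o => if o is Some k then p v k else y v).
Proof.
move=> ip ny a t h.
have aN : a None = 0.
  apply: contrapT => /eqP a0; apply: ny.
  exists (fun k => - (a None)^-1 * a (Some k)), (- (a None)^-1 * t) => v.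
  have := h v; rewrite sum_option /= => /eqP.
  rewrite -addrA addr_eq0 => /eqP e.
  rewrite -[LHS](mulKf a0) e.
  rewrite [X in _ = X + _](_ : _ = - (a None)^-1 * \sum_k a (Some k) * p v k).
    by rewrite -mulrDr mulrN mulNr.
  by rewrite mulr_sumr; apply: eq_bigr => k _; rewrite mulrA.
move=> [k|//]; apply: (ip (fun k => a (Some k)) t) => v.
by have := h v; rewrite sum_option /= aN mul0r add0r.
Qed.

Lemma basis_extension (K : (V -> F) -> Prop) (I : finType) (p : V -> I -> F) :
  aff_indep p -> (forall k, K (p^~ k)) ->
  exists (J : finType) (z : V -> J -> F),
    [/\ forall j, K (z^~ j),
        aff_indep (fun v (x : I + J) => match x with inl k => p v k | inr j => z v j end) &
        forall y, K y ->
          affine (fun v (x : I + J) => match x with inl k => p v k | inr j => z v j end) y].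
Proof.
have [n] := ubnP (#|V| - #|I|)%N.
elim: n I p => // n IH I p nI ip Kp.
have [all_aff|/existsNP[y /not_implyP[Ky ny]]] := pselect (forall y, K y -> affine p y).
  exists void, (fun _ => @of_void F); split=> [[]|a t h [k|[]]|y /all_aff[a [t h]]].
    apply: (ip (fun k => a (inl k)) t) => v; rewrite -[RHS](h v); congr (_ + _).
    by rewrite big_sumType/= [X in _ + X]big1 ?addr0// => -[].
  exists (fun x => match x with inl k => a k | inr j => of_void _ j end), t => v.
  by rewrite h big_sumType/= [X in _ = _ + X + _]big1 ?addr0// => -[].
have ip' := aff_indep_option ip ny.
have [|o|J [z [Kz iz sz]]] := IH _ _ _ ip'.
- have := aff_indep_card ip'; rewrite card_option => lt.
  by move: nI lt; clear; lia.
- by case: o => [k|] //=; exact: Kp.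
exists (option J), (fun v o => if o is Some j then z v j else y v).
pose f (x : I + option J) : option I + J :=
  match x with inl k => inl (Some k) | inr (Some j) => inr j | inr None => inl None end.
pose g (x : option I + J) : I + option J :=
  match x with inl (Some k) => inl k | inr j => inr (Some j) | inl None => inr None end.
have fK : cancel f g by move=> [k|[j|]].
have gK : cancel g f by move=> [[k|]|j].
have reix (h : I + option J -> F) : \sum_x h x = \sum_x h (g x).
  by rewrite (reindex g)//; exists f => x _; [exact: gK|exact: fK].
split=> [[j|]|a t h x|x /sz[a [t h]]]; first exact: Kz.
- exact: Ky.
- have := iz (a \o g) t _ (f x); rewrite /= fK; apply=> v.
  rewrite -[RHS](h v) reix; congr (_ + _).
  by apply: eq_bigr => -[[k|]|j].
- exists (a \o f), t => v; rewrite h reix; congr (_ + _).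
  by apply: eq_bigr => -[[k|]|j].
Qed.

(** A cokernel matrix provides equations for the span of the constants and the [z j], and equations
    are the form in which [fsurj_mod] takes a subspace. *)
Lemma affine_kernel (J : finType) (z : V -> J -> F) :
  exists C : V -> 'I_#|V| -> F,
    forall y, affine z y <-> forall l, \sum_v y v * C v l = 0.
Proof.
pose M (o : option J) v := if o is Some j then z v j else 1.
exists (fun v l => cokermx (fmx M) (enum_rank v) l) => y.
have -> : affine z y <-> (frow y <= fmx M)%MS.
  rewrite frow_submx; split=> [[a [t h]]|[c h]].
    exists (fun o => if o is Some j then a j else t) => v.
    by rewrite sum_option /= mulr1 addrC.
  exists (fun j => c (Some j)), (c None) => v.
  by rewrite h sum_option /= mulr1 addrC.
rewrite submxE; split=> [/eqP /rowP h l|h].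
  have hl := h l; rewrite !mxE in hl; rewrite -[RHS]hl -[LHS]big_ord_enum_val.
  by apply: eq_bigr => v _; rewrite !mxE enum_valK.
apply/eqP/rowP => l; rewrite !mxE -[RHS](h l) -[RHS]big_ord_enum_val.
by apply: eq_bigr => v _; rewrite !mxE enum_valK.
Qed.

End Subspaces.

Section GenericFrameworks.
Variables (F : numFieldType) (V E : finType) (s t : E -> V) (I : finType).
Local Notation dG := (dl s t).
Local Notation stress := (stress s t).
Local Notation stress_kernel := (stress_kernel s t).
Implicit Types (p q xi P kap : V -> I -> F).

Lemma stress_kernel_lin p (J : finType) (z : V -> J -> F) y :
  (forall j, stress_kernel p (z^~ j)) -> affine z y -> stress_kernel p y.
Proof.
move=> Kz [a [c hy]] w pw; apply: balanced_lin hy => j; exact: Kz.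
Qed.

Lemma stress_kernel_self p k : stress_kernel p (p^~ k).
Proof. by move=> w; apply. Qed.

Lemma dual_derivs_hits (T : finType) (x : T -> F) :
  (forall v : T -> F, exists D, deriv D /\ forall i, D (x i) = v i) ->
  exists D, dual_derivs x D.
Proof.
move=> h; have /choice[D hD] : forall i, exists D, deriv D /\ forall j, D (x j) = (i == j)%:R.
  by move=> i; exact: h.
by exists D; split=> [i|i j]; have [] := hD i.
Qed.

(** [D] is an Euler derivation about [p] in the direction [P - p], so the rigidity matrix of [P] has
    at least the rank of that of [p]. Its left kernel is therefore no larger, and the assumed
    inclusion is an equality. *)
Lemma stress_spec p P (D : F -> F) : deriv D ->
  (forall v k, D (p v k) = 0) -> (forall v k, D (P v k) = P v k - p v k) ->
  (forall w, stress p w -> stress P w) ->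
  forall w, stress P w -> stress p w.
Proof.
move=> dD Dp DP sub w /stress_rigidity_mx hw; apply/stress_rigidity_mx.
apply: fker_eq hw => [w' /stress_rigidity_mx/sub/stress_rigidity_mx//|].
pose M1 := rigidity_mx s t (fun v k => P v k - p v k).
have -> : fmx (rigidity_mx s t P) = fmx (rigidity_mx s t p) + fmx M1.
  apply/matrixP => i j; rewrite !mxE /M1 /rigidity_mx -mulrDl -dlD.
  by congr (_ * _); apply: eq_dl => v; rewrite addrC subrK.
have Dind (a b : bool) : D (a%:R - b%:R) = 0.
  by rewrite (derB _ _ dD) !(der_nat _ dD) subrr.
apply: (mxrank_spec dD) => i j; rewrite !mxE /M1 /rigidity_mx (derM dD) Dind mulr0 addr0.
  rewrite (dl_der _ _ _ _ dD) (_ : dG _ _ = 0) ?mul0r//.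
  by rewrite /dl !Dp subrr.
congr (_ * _); rewrite (dl_der _ _ _ _ dD); apply: eq_dl => v.
by rewrite (derB _ _ dD) DP Dp subr0.
Qed.

(* A configuration [P] in the stress kernel of a generic [p], with the same
   stresses and which is generic inside that kernel, is generic: derivations
   that keep [P] in the kernel preserve the stresses, hence keep [p] in it. *)
Lemma generic_in_kernel p P :
  conf_generic p -> (forall k, stress_kernel p (P^~ k)) ->
  (forall kap, (forall k, stress_kernel p (kap^~ k)) ->
    exists D, deriv D /\ forall v k, D (P v k) = kap v k) ->
  (forall w, stress P w -> stress p w) -> conf_generic P.
Proof.
move=> [D hD] KP hits sub.
have sub' w : stress p w -> stress P w by move=> pw k; exact: KP.
have [||J [z [Kz _ sz]]] := @basis_extension F V (stress_kernel p) void
    (fun _ => @of_void F).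
- by move=> a c h [].
- by case.
have [C hC] := affine_kernel (fun v (x : void + J) =>
  match x with inl k => of_void _ k | inr j => z v j end).
have KC y : stress_kernel p y <-> forall l, \sum_v y v * C v l = 0.
  rewrite -hC; split; first exact: sz.
  by apply: stress_kernel_lin => -[[]|j]; exact: Kz.
pose C' (x : V * I) (l : I * 'I_#|V|) := (x.2 == l.1)%:R * C x.1 l.2.
have C'E (u : V * I -> F) k l :
    \sum_x u x * C' x (k, l) = \sum_v u (v, k) * C v l.
  pose f v i := u (v, i) * C' (v, i) (k, l).
  transitivity (\sum_(x : V * I) f x.1 x.2); first by apply: eq_bigr => -[].
  rewrite sum_pair; apply: eq_bigr => v _.
  rewrite -(sum_indic k (fun i => u (v, i) * C v l)); apply: eq_bigr => i _.
  by rewrite /f /C' /= eq_sym; ring.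
have KC' (u : V * I -> F) : (forall l, \sum_x u x * C' x l = 0) <->
    forall k, stress_kernel p (fun v => u (v, k)).
  split=> [h k|h [k l]]; first by apply/KC => l; rewrite -C'E.
  by rewrite C'E; apply: (KC (fun v => u (v, k))).1.
pose Phi (x y : V * I) := D x (P y.1 y.2).
(* [fsurj_mod] reaches any direction up to configurations in the kernel, and [hits] supplies those.
   What remains is that a combination of the [D x] which keeps [P] in the kernel also moves [p]
   inside the kernel. *)
suff surj : forall u, (forall l, \sum_x (\sum_y u y * Phi y x) * C' x l = 0) ->
    forall l, \sum_x u x * C' x l = 0.
  apply: dual_derivs_hits => v.
  have [u /KC' hu] := fsurj_mod surj v.
  have [D1 [dD1 hD1]] := hits (fun x k => v (x, k) - \sum_y u y * Phi y (x, k)) hu.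
  exists (fun x => \sum_y u y * D y x + D1 x); split.
    by apply: deriv_add => //; apply: deriv_lin => i; have [] := hD.
  by move=> [x k] /=; rewrite hD1 /Phi /= addrC subrK.
move=> u hu.
apply/KC' => k; have {}hu : forall k, stress_kernel p (fun v => \sum_y u y * D y (P v k)).
  exact: (KC' (fun x => \sum_y u y * Phi y x)).1 hu.
pose D' (x : F) := \sum_y u y * D y x.
have dD' : deriv D' by apply: deriv_lin => i; have [] := hD.
have D'p v i : D' (p v i) = u (v, i).
  rewrite /D' -(sum_indicr (v, i) u); apply: eq_bigr => y _.
  by rewrite (hD.2 y (v, i)) eq_sym.
move=> w pw; have /sub Dw : stress P (fun e => D' (w e)).
  by apply: stress_der => // [|i]; [exact: sub'|exact: hu].
have := kernel_der dD' pw Dw k.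
by under eq_fun do rewrite D'p.
Qed.

End GenericFrameworks.

(** * Generic globally rigid frameworks over a real field *)

Section Averaging.
Variables (F : numFieldType) (V E : finType) (s t : E -> V) (I : finType).
Hypothesis uncF : ~ countable [set: F].
Local Notation dG := (dl s t).
Local Notation stress := (stress s t).
Local Notation stress_kernel := (stress_kernel s t).
Implicit Types (p q xi P : V -> I -> F).

(** Global rigidity over any field, with squared lengths in place of distances and derivations in
    place of algebraic independence; [globally_rigid_generic] derives it over the reals. *)
Definition generic_glob_rigid : Prop :=
  forall p q, conf_generic p ->
  (forall e, \sum_k dG (p^~ k) e ^+ 2 = \sum_k dG (q^~ k) e ^+ 2) ->
  forall u v, \sum_k (p u k - p v k) ^+ 2 = \sum_k (q u k - q v k) ^+ 2.

Lemma sub_sqr_lengths (J : finType) (x y : J -> F) c :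
  \sum_k (x k + c * y k) ^+ 2 - \sum_k (x k - c * y k) ^+ 2 =
  4 * c * \sum_k x k * y k.
Proof. by rewrite -sumrB mulr_sumr; apply: eq_bigr => k _; ring. Qed.

(* If [p] is generic then so is [p + c xi] for [c] transcendental over [p], [xi]
   and the derivatives of [xi], and [p + c xi], [p - c xi] have equal lengths. *)
Lemma glob_rigid_flat p xi : generic_glob_rigid -> conf_generic p ->
  inf_motion s t p xi ->
  forall u v, \sum_k (p u k - p v k) * (xi u k - xi v k) = 0.
Proof.
move=> gr [D hD] pxi u v.
pose T : finType := (V * I)%type.
pose y (x : T + T + T * T) := match x with
  | inl (inl (v, k)) => p v k
  | inl (inr (v, k)) => xi v k
  | inr (x, (v, k)) => D x (xi v k) end.
have [c' [d [hd hy]]] := exists_dual_derivs uncF unit y.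
pose c := c' tt; pose dc := d tt.
have ddc : deriv dc by exact: hd.1.
have dcc : dc c = 1 by rewrite /dc /c hd.2.
have dcp v' k : dc (p v' k) = 0 by exact: hy tt (inl (inl (v', k))).
have dcxi v' k : dc (xi v' k) = 0 by exact: hy tt (inl (inr (v', k))).
have dcD x v' k : dc (D x (xi v' k)) = 0 by exact: hy tt (inr (x, (v', k))).
have c0 : c != 0.
  by apply/eqP => c0; move: dcc; rewrite c0 (der0 ddc) => /eqP; rewrite eq_sym oner_eq0.
(* [D' x] agrees with [D x] on the data and treats [c] as a constant. *)
have /choice[D' hD'] : forall x : T, exists D', [/\ deriv D', D' c = 0 &
    forall z, dc z = 0 -> D' z = D x z].
  move=> x; have [D' [dD' D'c D'z]] := deriv_adjust (fun=> 0) hd (hD.1 x).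
  exists D'; split=> // [|z dz]; first exact: (D'c tt).
  by apply: D'z => -[].
pose P v k := p v k + c * xi v k; pose Q v k := p v k - c * xi v k.
have gP : conf_generic P.
  (* The derivatives of [P] form the identity plus [c] times the derivatives of [xi]; this matrix
     has full rank because it does at [c = 0]. *)
  pose M0 (x y : T) : F := (x == y)%:R.
  pose M1 (x y : T) : F := c * D x (xi y.1 y.2).
  have D'P x z : D' x (P z.1 z.2) = M0 x z + M1 x z.
    have [dD' D'c D'z] := hD' x.
    rewrite /P (derD dD') (derM dD') D'c mul0r add0r !D'z//.
    by rewrite (hD.2 x z).
  have rk : (\rank (fmx M0) <= \rank (fmx M0 + fmx M1)%R)%N.
    have dC : deriv (fun x => c * dc x) by exact: deriv_scale.
    apply: (mxrank_spec dC) => i j; rewrite !mxE ?(der_nat _ ddc) ?mulr0//.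
    by rewrite /M1 (derM ddc) dcc dcD mulr0 addr0 mul1r.
  have full : \rank (fmx M0) = #|T|.
    rewrite -[RHS](mxrank1 F); congr (\rank _).
    by apply/matrixP => i j; rewrite !mxE /M0 (inj_eq enum_val_inj).
  apply: dual_derivs_hits => v'.
  have : (frow v' <= fmx (fun x z => D' x (P z.1 z.2)))%MS.
    apply: submx_full; rewrite /row_full.
    have -> : fmx (fun x z => D' x (P z.1 z.2)) = fmx M0 + fmx M1.
      by apply/matrixP => i j; rewrite !mxE D'P.
    by rewrite eqn_leq rank_leq_col /=; apply: leq_trans rk; rewrite full.
  move=> /frow_submx[a ha]; exists (fun z => \sum_x a x * D' x z); split.
    by apply: deriv_lin => x; have [] := hD' x.
  by move=> z; rewrite ha.
have eqL : (forall e, \sum_k dG (P^~ k) e ^+ 2 = \sum_k dG (Q^~ k) e ^+ 2).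
  move=> e; apply/eqP; rewrite -subr_eq0; apply/eqP.
  transitivity (4 * c * \sum_k dG (p^~ k) e * dG (xi^~ k) e); last by rewrite pxi mulr0.
  rewrite -sub_sqr_lengths.
  congr (_ - _); apply: eq_bigr => k _; rewrite /P /Q /=.
    by rewrite dlD dlZ.
  by rewrite dlB dlZ.
have /eqP := gr P Q gP eqL u v; rewrite -subr_eq0.
have -> : \sum_k (P u k - P v k) ^+ 2 - \sum_k (Q u k - Q v k) ^+ 2 =
    4 * c * \sum_k (p u k - p v k) * (xi u k - xi v k).
  rewrite -sub_sqr_lengths; congr (_ - _); apply: eq_bigr => k _; rewrite /P /Q.
    by congr (_ ^+ 2); ring.
  by congr (_ ^+ 2); ring.
by rewrite !mulf_eq0 pnatr_eq0 (negPf c0) /= => /eqP.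
Qed.

Lemma glob_rigid_inf_rigid p : (#|I| < #|V|)%N ->
  generic_glob_rigid -> conf_generic p -> inf_rigid s t p.
Proof.
move=> IV gr gp xi pxi; apply: flat_trivial; first exact: generic_aff_indep.
exact: glob_rigid_flat.
Qed.

(** Every stress annihilates [dG z * dG y], whence some [xi]. It lies in the kernel: when the
    coordinate [k] of [p] moves by [f], deriving the equilibrium of [z] against [y] and that of each
    [p j] against [xi j], then comparing, leaves the equilibrium of [xi k] against [f]. This puts
    all tangent spaces of the measurement map on the kernel inside the one at [p]. *)
Lemma kernel_product p z y : conf_generic p ->
  stress_kernel p z -> stress_kernel p y ->
  exists xi : V -> I -> F, (forall k, stress_kernel p (xi^~ k)) /\
    forall e, dG z e * dG y e = \sum_k dG (p^~ k) e * dG (xi^~ k) e.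
Proof.
move=> [D hD] Kz Ky.
have [w pw|xi hxi] := @stress_dual _ _ _ s t _ p (fun e => dG z e * dG y e).
  by rewrite -[RHS](Kz w pw y); apply: eq_bigr => e _; rewrite mulrA.
exists xi; split=> // k w pw f.
have [D' [dD' D'p _]] := dual_derivs_dir (fun x : V * I => (x.2 == k)%:R * f x.1) hD.
have e1 : \sum_e D' (w e) * (dG z e * dG y e) = 0.
  have := balanced_der y dD' (Kz w pw).
  rewrite [X in _ + X](_ : _ = 0).
    by rewrite addr0 => e0; rewrite -[RHS]e0; apply: eq_bigr => e _; rewrite mulrA.
  rewrite -[RHS](Ky w pw (fun v => D' (z v))); apply: eq_bigr => e _; ring.
have e2 : \sum_j (\sum_e D' (w e) * dG (p^~ j) e * dG (xi^~ j) e +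
    \sum_e w e * dG (fun v => D' (p v j)) e * dG (xi^~ j) e) = 0.
  by apply: big1 => j _; exact: balanced_der.
rewrite big_split /= exchange_big /= in e2.
have e3 : \sum_e \sum_j D' (w e) * dG (p^~ j) e * dG (xi^~ j) e = 0.
  rewrite -[RHS]e1; apply: eq_bigr => e _; rewrite hxi mulr_sumr.
  by apply: eq_bigr => j _; rewrite mulrA.
rewrite e3 add0r in e2; rewrite -[RHS]e2 (bigD1 k)//= [X in _ + X]big1 ?addr0.
  apply: eq_bigr => e _; rewrite mulrAC; congr (_ * _ * _).
  by apply: eq_dl => v; rewrite (D'p (v, k)) /= eqxx mul1r.
move=> j jk; apply: big1 => e _.
rewrite (_ : dG _ _ = 0) ?mulr0 ?mul0r//.
by rewrite /dl !(D'p (_, _)) /= (negPf jk) !mul0r subrr.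
Qed.

End Averaging.

(** * The stress kernel of a generic globally rigid framework *)

Section PolynomialOptimization.
Variable R : realType.

Inductive polyfun (J : Type) : ((J -> R) -> R) -> Prop :=
| polyfun_cst c : polyfun (fun=> c)
| polyfun_var j : polyfun (fun v => v j)
| polyfun_add f g : polyfun f -> polyfun g -> polyfun (fun v => f v + g v)
| polyfun_mul f g : polyfun f -> polyfun g -> polyfun (fun v => f v * g v).

Lemma polyfun_opp (J : Type) (f : (J -> R) -> R) : polyfun f -> polyfun (fun v => - f v).
Proof.
move=> pf; have -> : (fun v => - f v) = (fun v => -1 * f v).
  by apply/funext => v; rewrite mulN1r.
by apply: polyfun_mul => //; exact: polyfun_cst.
Qed.

Lemma polyfun_sub (J : Type) (f g : (J -> R) -> R) :
  polyfun f -> polyfun g -> polyfun (fun v => f v - g v).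
Proof. by move=> pf pg; apply: polyfun_add => //; exact: polyfun_opp. Qed.

Lemma polyfun_sum (J : Type) (K : finType) (f : K -> (J -> R) -> R) :
  (forall k, polyfun (f k)) -> polyfun (fun v => \sum_k f k v).
Proof.
move=> pf; suff h s : polyfun (fun v => \sum_(k <- s) f k v) by exact: h.
elim: s => [|k s IH].
  have -> : (fun v => \sum_(k <- [::]) f k v) = (fun=> 0).
    by apply/funext => v; rewrite big_nil.
  exact: polyfun_cst.
have -> : (fun v => \sum_(k <- k :: s) f k v) =
    (fun v => f k v + \sum_(k <- s) f k v).
  by apply/funext => v; rewrite big_cons.
by apply: polyfun_add.
Qed.

Lemma polyfun_sqr (J : Type) (f : (J -> R) -> R) : polyfun f -> polyfun (fun v => f v ^+ 2).
Proof.
move=> pf; have -> : (fun v => f v ^+ 2) = (fun v => f v * f v).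
  by apply/funext => v; rewrite expr2.
exact: polyfun_mul.
Qed.

Lemma polyfun_continuous (J : finType) (f : (J -> R) -> R) : polyfun f ->
  continuous (fun u : 'rV[R]_#|J| => f (fanti u)).
Proof.
elim=> [c|j|g h _ cg _ ch|g h _ cg _ ch] u.
- exact: cst_continuous.
- exact: coord_continuous.
- by apply: continuousD; [exact: cg|exact: ch].
- by apply: continuousM; [exact: cg|exact: ch].
Qed.

(** Extreme value theorem on a closed bounded set. Variables are indexed by any finite type so that
    a point, a parameter and a covector can be packed into one vector. *)
Lemma polyfun_min (J K : finType) (f : K -> (J -> R) -> R) (g : (J -> R) -> R) B :
  (forall k, polyfun (f k)) -> polyfun g ->
  (forall v, (forall k, f k v <= 0) -> forall j, `|v j| <= B) ->
  (exists v, forall k, f k v <= 0) ->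
  exists v, (forall k, f k v <= 0) /\ forall w, (forall k, f k w <= 0) -> g v <= g w.
Proof.
move=> pf pg bnd [v0 hv0].
pose A : set 'rV[R]_#|J| := (fun u => forall k, f k (fanti u) <= 0).
have fr v : fanti (frow v) = v :> (J -> R) by apply/funext; exact: frowK.
have Acl : closed A.
  have -> : A = (\bigcap_(k in [set: K]) ((fun u => f k (fanti u)) @^-1` [set x | x <= 0]))%classic.
    by apply/seteqP; split=> [u Au k _|u Au k]; [exact: Au|exact: (Au k I)].
  apply: closed_bigI => k _; apply: closed_comp; last exact: closed_le.
  by move=> u _; exact: polyfun_continuous.
have Abd : bounded_set A.
  exists `|B|; split; first by rewrite num_real.
  move=> M BM u Au; rewrite /= [leLHS]mx_normrE; apply/bigmax_leP; split=> /=.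
    by apply: ltW; apply: le_lt_trans BM.
  move=> [i j] _ /=; rewrite ord1.
  have := bnd _ Au (enum_val j); rewrite /fanti enum_valK => /le_trans; apply.
  by apply: le_trans (ler_norm _) _; exact: ltW.
have A0 : (A !=set0)%classic by exists (frow v0); rewrite /A /= fr.
have cg : {within A, continuous (fun u : 'rV[R]_#|J| => g (fanti u))}%classic.
  by apply: continuous_subspaceT; exact: polyfun_continuous.
have [u uA umin] := EVT_min_rV A0 (bounded_closed_compact Abd Acl) cg.
exists (fanti u); split; first by move: uA; rewrite inE.
by move=> w hw; have := umin (frow w); rewrite fr; apply; rewrite inE /A /= fr.
Qed.

Lemma quartic_ge0 (a b c d : R) :
  (forall r, 0 <= a * r + b * r ^+ 2 + c * r ^+ 3 + d * r ^+ 4) -> a = 0.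
Proof.
move=> h; apply: contrapT => /eqP a0.
pose S := `|b| + `|c * a| + `|d * a ^+ 2|.
have S0 : 0 <= S by rewrite !addr_ge0.
(* At [r = - a * e] the linear term is [- a ^+ 2 * e], and the others add at most
   [a ^+ 2 * e ^+ 2 * S], which is smaller in size because [e * S < 1]. *)
pose e := (2 * (1 + S))^-1.
have e0 : 0 < e by rewrite invr_gt0; lra.
have e1 : e <= 1 by rewrite invf_le1; lra.
have eS : e * S < 1.
  rewrite /e mulrC ltr_pdivrMr; lra.
have := h (- a * e).
have -> : a * (- a * e) + b * (- a * e) ^+ 2 + c * (- a * e) ^+ 3 + d * (- a * e) ^+ 4 =
   a ^+ 2 * e * (- 1 + e * (b - (c * a) * e + (d * a ^+ 2) * e ^+ 2)) by ring.
rewrite pmulr_rge0; last by rewrite mulr_gt0// exprn_even_gt0.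
have : b - c * a * e + d * a ^+ 2 * e ^+ 2 <= S.
  rewrite /S; apply: lerD; last first.
    apply: le_trans (ler_norm _) _; rewrite normrM ler_piMr//.
    by rewrite ger0_norm ?exprn_ge0 ?exprn_ile1// ltW.
  apply: lerD; first exact: ler_norm.
  apply: le_trans (ler_norm _) _; rewrite normrN normrM ler_piMr//.
  by rewrite ger0_norm// ltW.
by move=> /(ler_wpM2l (ltW e0)); lra.
Qed.

End PolynomialOptimization.

(** * Quadratic measurement maps and the first point of a segment in their image *)

Section Measurement.
Variables (R : realType) (E T I : finType) (h : E -> T -> R).
Implicit Types (a b zeta x : T -> I -> R) (e : E).

Definition edge_vec a e k : R := \sum_i h e i * a i k.

(* The squared edge lengths are [bimeas a a]; their differential at [a] is
   [2 * bimeas a]. *)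
Definition bimeas a zeta e : R := \sum_k edge_vec a e k * edge_vec zeta e k.

Lemma edge_vec_lin a b r e k :
  edge_vec (fun i k => a i k + r * b i k) e k = edge_vec a e k + r * edge_vec b e k.
Proof.
rewrite /edge_vec mulr_sumr -big_split/=; apply: eq_bigr => i _; ring.
Qed.

Lemma bimeas_sym a b e : bimeas a b e = bimeas b a e.
Proof. by apply: eq_bigr => k _; rewrite mulrC. Qed.

Lemma bimeas_lin a b c r e :
  bimeas a (fun i k => b i k + r * c i k) e = bimeas a b e + r * bimeas a c e.
Proof.
rewrite /bimeas mulr_sumr -big_split/=; apply: eq_bigr => k _.
by rewrite edge_vec_lin; ring.
Qed.

Lemma bimeas_sqr a b r e :
  bimeas (fun i k => a i k + r * b i k) (fun i k => a i k + r * b i k) e =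
  bimeas a a e + 2 * r * bimeas a b e + r ^+ 2 * bimeas b b e.
Proof.
rewrite /bimeas !mulr_sumr -!big_split/=; apply: eq_bigr => k _.
by rewrite edge_vec_lin; ring.
Qed.

Lemma bimeas_ge0 a e : 0 <= bimeas a a e.
Proof. by apply: sumr_ge0 => k _; rewrite -expr2 sqr_ge0. Qed.

Hypothesis h_span : forall v : T -> R, (forall e, \sum_i h e i * v i = 0) -> forall i, v i = 0.

(** Properness: [h_span] gives a left inverse [L] of [h], so bounded edge vectors bound the
    configuration. *)
Lemma bimeas_bound (M : E -> R) : exists B, forall a,
  (forall e, bimeas a a e <= M e) -> forall i k, `|a i k| <= B.
Proof.
have /choice[L hL] : forall i : T, exists L : E -> R, forall j, (i == j)%:R = \sum_e h e j * L e.
  move=> i; apply: fsolvable => w hw; rewrite sum_indicr.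
  by apply: h_span => e; rewrite -[RHS](hw e); apply: eq_bigr => j _; rewrite mulrC.
exists (\sum_i \sum_e `|L i e| * (1 + `|M e|)) => a ha i k.
have -> : a i k = \sum_e L i e * edge_vec a e k.
  rewrite -[LHS](sum_indic i (fun j => a j k)).
  under eq_bigr do rewrite hL mulr_suml.
  rewrite exchange_big /=; apply: eq_bigr => e _; rewrite /edge_vec mulr_sumr.
  by apply: eq_bigr => j _; ring.
apply: le_trans (ler_norm_sum _ _ _) _.
rewrite [leRHS](bigD1 i)//= -[leLHS]addr0; apply: lerD; last first.
  by apply: sumr_ge0 => j _; apply: sumr_ge0 => e _; rewrite mulr_ge0// addr_ge0.
apply: ler_sum => e _; rewrite normrM ler_wpM2l//.
have : edge_vec a e k ^+ 2 <= M e.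
  apply: le_trans (ha e); rewrite /bimeas (bigD1 k)//= -expr2 lerDl.
  by apply: sumr_ge0 => j _; rewrite -expr2 sqr_ge0.
move=> hM; have := ler_norm (M e); set y := edge_vec a e k in hM *.
have : `|y| <= 1 + y ^+ 2.
  by rewrite -(real_normK (num_real y)); have := sqr_ge0 (`|y| - 1); nra.
lra.
Qed.

Let T2 := (T * I)%type.
Let mk (v : T2 -> R) i k := v (i, k).

Lemma polyfun_edge (J : Type) (f : T -> I -> (J -> R) -> R) e k :
  (forall i k, polyfun (f i k)) -> polyfun (fun v => edge_vec (fun i k => f i k v) e k).
Proof.
move=> pf; apply: polyfun_sum => i; apply: polyfun_mul => //; exact: polyfun_cst.
Qed.

Lemma polyfun_bimeas (J : Type) (f g : T -> I -> (J -> R) -> R) e :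
  (forall i k, polyfun (f i k)) -> (forall i k, polyfun (g i k)) ->
  polyfun (fun v => bimeas (fun i k => f i k v) (fun i k => g i k v) e).
Proof.
by move=> pf pg; apply: polyfun_sum => k; apply: polyfun_mul; exact: polyfun_edge.
Qed.

(** At a minimiser of the squared distance to [beta], the residual is orthogonal to the image of the
    differential. The point [a1] cuts out a nonempty sublevel set, compact by [bimeas_bound]. *)
Lemma nearest_point (beta : E -> R) a1 :
  exists a, \sum_e (bimeas a a e - beta e) ^+ 2 <= \sum_e (bimeas a1 a1 e - beta e) ^+ 2 /\
    forall zeta, \sum_e (bimeas a a e - beta e) * bimeas a zeta e = 0.
Proof.
pose g (v : T2 -> R) := \sum_e (bimeas (mk v) (mk v) e - beta e) ^+ 2.
pose v1 (x : T2) := a1 x.1 x.2.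
have pg : polyfun g.
  apply: polyfun_sum => e; apply: polyfun_sqr; apply: polyfun_sub; last exact: polyfun_cst.
  by apply: (polyfun_bimeas (f := fun i k v => v (i, k)) (g := fun i k v => v (i, k))) => i k; exact: polyfun_var.
have [B hB] := bimeas_bound (fun e => beta e + (1 + g v1)).
have gv v e : bimeas (mk v) (mk v) e <= beta e + (1 + g v).
  have : (bimeas (mk v) (mk v) e - beta e) ^+ 2 <= g v.
    by rewrite /g (bigD1 e)//= lerDl; apply: sumr_ge0 => j _; rewrite sqr_ge0.
  set y := bimeas _ _ _ - _ => hy; have := sqr_ge0 (y - 1 / 2).
  have -> : bimeas (mk v) (mk v) e = beta e + y by rewrite /y; ring.
  by lra.
have [||||a [ha amin]] := @polyfun_min R _ unit (fun _ v => g v - g v1) g B.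
- by move=> _; apply: polyfun_sub => //; exact: polyfun_cst.
- exact: pg.
- move=> v /(_ tt); rewrite subr_le0 => gvv1 [i k].
  have := hB (mk v) _ i k; apply=> e; apply: le_trans (gv v e) _.
  by rewrite lerD2l lerD2l.
- by exists v1 => _; rewrite subrr.
exists (mk a); split.
  have := ha tt; rewrite subr_le0.
  by have -> : g v1 = \sum_e (bimeas a1 a1 e - beta e) ^+ 2 by [].
move=> zeta.
have gmin w : g a <= g w.
  have [le|/ltW le] := leP (g w) (g v1); first by apply: amin => _; rewrite subr_le0.
  by apply: le_trans le; have := ha tt; rewrite subr_le0.
pose rho e := bimeas (mk a) (mk a) e - beta e.
have /quartic_ge0 : forall r, 0 <= (4 * \sum_e rho e * bimeas (mk a) zeta e) * r +
    (\sum_e (4 * bimeas (mk a) zeta e ^+ 2 + 2 * rho e * bimeas zeta zeta e)) * r ^+ 2 +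
    (\sum_e 4 * bimeas (mk a) zeta e * bimeas zeta zeta e) * r ^+ 3 +
    (\sum_e bimeas zeta zeta e ^+ 2) * r ^+ 4.
  move=> r; have := gmin (fun x : T2 => a x + r * zeta x.1 x.2).
  rewrite -subr_ge0; congr (0 <= _); rewrite /g -sumrB mulr_sumr !mulr_suml -!big_split/=.
  apply: eq_bigr => e _.
  have -> : mk (fun x : T2 => a x + r * zeta x.1 x.2) = (fun i k => mk a i k + r * zeta i k) by [].
  by rewrite bimeas_sqr /rho; ring.
by move/eqP; rewrite mulf_eq0 pnatr_eq0 /= => /eqP.
Qed.

Variables (L : finType) (C : E -> L -> R).
Hypothesis bimeas_C : forall a zeta l, \sum_e bimeas a zeta e * C e l = 0.

(* Follow the segment from [- m a0], which is not a vector of squared lengths, to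
   [m x]: at its first point in the image of [m], the differential of [m]
   misses a direction [phi], a limit of normalised nearest-point residuals. *)
Lemma critical_point a0 x : (exists i k, a0 i k != 0) ->
  exists tt a phi, [/\ 0 < tt,
    forall e, bimeas a a e = tt * (bimeas a0 a0 e + bimeas x x e) - bimeas a0 a0 e,
    exists e, phi e != 0,
    forall l, \sum_e phi e * C e l = 0 &
    forall zeta, \sum_e phi e * bimeas a zeta e = 0].
Proof.
move=> [i0 [k0 a0n]].
pose c e := bimeas a0 a0 e + bimeas x x e.
pose line t e := t * c e - bimeas a0 a0 e.
have [B hB] := bimeas_bound (bimeas x x).
(* The first parameter is attained because [t] is minimised over a compact set of pairs, a parameter
   together with a configuration. *)
have [t0 [a1 [t0p t01 ha1 tmin]]] : exists t a, [/\ 0 < t, t <= 1,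
    forall e, bimeas a a e = line t e &
    forall t' a', 0 <= t' -> t' <= 1 -> (forall e, bimeas a' a' e = line t' e) -> t <= t'].
  pose mk' (v : option T2 -> R) i k := v (Some (i, k)).
  pose f (j : E + E + bool) (v : option T2 -> R) := match j with
    | inl (inl e) => bimeas (mk' v) (mk' v) e - line (v None) e
    | inl (inr e) => line (v None) e - bimeas (mk' v) (mk' v) e
    | inr true => v None - 1
    | inr false => - v None end.
  have pm e : polyfun (fun v => bimeas (mk' v) (mk' v) e).
    by apply: (polyfun_bimeas (f := fun i k v => v (Some (i, k))) (g := fun i k v => v (Some (i, k))))
      => i k; exact: polyfun_var.
  have pl e : polyfun (fun v : option T2 -> R => line (v None) e).
    apply: polyfun_sub; last exact: polyfun_cst.
    by apply: polyfun_mul; [exact: polyfun_var|exact: polyfun_cst].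
  have fP v : (forall j, f j v <= 0) -> [/\ 0 <= v None, v None <= 1 &
      forall e, bimeas (mk' v) (mk' v) e = line (v None) e].
    move=> fv; split; first by have := fv (inr false); rewrite /= oppr_le0.
      by have := fv (inr true); rewrite /= subr_le0.
    move=> e; apply/eqP; rewrite eq_le -subr_le0 (fv (inl (inl e))) /=.
    by rewrite -subr_le0 (fv (inl (inr e))).
  have fI t a : 0 <= t -> t <= 1 -> (forall e, bimeas a a e = line t e) ->
      forall j, f j (fun o => if o is Some y then a y.1 y.2 else t) <= 0.
    move=> tp t1 at_; have at' e : bimeas (mk' (fun o => if o is Some y then a y.1 y.2 else t))
        (mk' (fun o => if o is Some y then a y.1 y.2 else t)) e = line t e by rewrite -at_.
    by move=> [[e|e]|[]] /=; rewrite ?at' ?subrr ?subr_le0 ?oppr_le0.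
  have [||||v [fv vmin]] := @polyfun_min R _ _ f (fun v => v None) (1 + `|B|).
  - move=> [[e|e]|[]] /=.
    + exact: polyfun_sub.
    + exact: polyfun_sub.
    + by apply: polyfun_sub; [exact: polyfun_var|exact: polyfun_cst].
    + by apply: polyfun_opp; exact: polyfun_var.
  - exact: polyfun_var.
  - move=> v /fP[v0 v1 hv] [[i k]|].
      apply: le_trans (_ : B <= _); last by have := ler_norm B; lra.
      apply: (hB (mk' v)) => e; rewrite hv /line /c.
      have := bimeas_ge0 a0 e; have := bimeas_ge0 x e.
      by move: v0 v1; set u := v None; nra.
    by rewrite ger0_norm//; have := normr_ge0 B; lra.
  - exists (fun o => if o is Some y then x y.1 y.2 else 1); apply: fI => // e.
    by rewrite /line /c mul1r addrAC subrr add0r.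
  have [v0 v1 hv] := fP v fv.
  exists (v None), (mk' v); split=> //; last first.
    by move=> t' a' t'0 t'1 h'; exact: (vmin _ (fI t' a' t'0 t'1 h')).
  (* At [t = 0] the squared lengths would be those of [a0] with the opposite sign, so all would
     vanish and [a0] would be 0 by [h_span]. *)
  rewrite lt_neqAle v0 andbT; apply: contraNneq a0n => vN.
  have z e : bimeas a0 a0 e = 0.
    apply/eqP; rewrite eq_le bimeas_ge0 andbT -oppr_ge0.
    by have := hv e; rewrite /line -vN mul0r sub0r => <-; exact: bimeas_ge0.
  apply/eqP; apply: (h_span (v := a0^~ k0)) => e.
  have := z e; rewrite /bimeas; under eq_bigr do rewrite -expr2.
  move/eqP; rewrite psumr_eq0; last by move=> k _; exact: sqr_ge0.
  by move/allP => /(_ k0); rewrite mem_index_enum sqrf_eq0 => /(_ isT) /eqP.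
pose y e := bimeas a1 a1 e.
pose S := \sum_e c e ^+ 2.
have S0 : 0 <= S by apply: sumr_ge0 => e _; exact: sqr_ge0.
pose M e := `|y e| + `|c e| + 1 + S.
(* Basis configurations turn criticality against all [zeta] into finitely many polynomial equations,
   as [polyfun_min] needs. *)
pose tv (i : T) (k : I) (i' : T) (k' : I) : R := ((i, k) == (i', k'))%:R.
have critP a phi : (forall i k, \sum_e phi e * bimeas a (tv i k) e = 0) ->
    forall zeta, \sum_e phi e * bimeas a zeta e = 0.
  move=> hc zeta.
  have e1 e : bimeas a zeta e = \sum_i \sum_k zeta i k * bimeas a (tv i k) e.
    have ev k : edge_vec zeta e k = \sum_i \sum_k' zeta i k' * edge_vec (tv i k') e k.
      rewrite /edge_vec; apply: eq_bigr => i _.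
      rewrite (bigD1 k)//= [X in _ = _ + X]big1 ?addr0 => [|k' kk']; last first.
        rewrite big1 ?mulr0// => j _; rewrite /tv xpair_eqE (negPf kk') andbF mulr0//.
      rewrite (bigD1 i)//= big1 ?addr0 => [|j ji].
        by rewrite /tv eqxx mulr1 mulrC.
      by rewrite /tv xpair_eqE eq_sym (negPf ji) mulr0.
    rewrite /bimeas; under eq_bigr do rewrite ev mulr_sumr.
    rewrite exchange_big /=; apply: eq_bigr => i _.
    under eq_bigr do rewrite mulr_sumr.
    rewrite exchange_big /=; apply: eq_bigr => k _; rewrite mulr_sumr.
    by apply: eq_bigr => k' _; ring.
  under eq_bigr do rewrite e1 mulr_sumr.
  rewrite exchange_big big1//= => i _.
  under eq_bigr do rewrite mulr_sumr.
  rewrite exchange_big big1//= => k _.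
  transitivity (zeta i k * \sum_e phi e * bimeas a (tv i k) e); last by rewrite hc mulr0.
  rewrite mulr_sumr; by apply: eq_bigr => e _; ring.
(* The target at parameter [t0 - d] is outside the image by minimality of [t0], so its residual from
   a nearest point is nonzero and can be normalised to [phi]. *)
have near d : 0 < d -> d < t0 -> exists a phi, [/\
    forall e, bimeas a a e <= M e, \sum_e phi e ^+ 2 = 1,
    forall l, \sum_e phi e * C e l = 0,
    forall zeta, \sum_e phi e * bimeas a zeta e = 0 &
    \sum_e (bimeas a a e - y e) ^+ 2 <= 4 * d ^+ 2 * S].
  move=> d0 dt; pose beta e := y e - d * c e.
  have [a [ale acrit]] := nearest_point beta a1.
  pose rho e := bimeas a a e - beta e.
  have rho_le : \sum_e rho e ^+ 2 <= d ^+ 2 * S.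
    apply: le_trans ale _; rewrite /S mulr_sumr; apply: ler_sum => e _.
    by rewrite /beta /y opprB addrC subrK exprMn.
  have rho_gt0 : 0 < \sum_e rho e ^+ 2.
    rewrite lt_neqAle sumr_ge0 ?andbT; last by move=> e _; exact: sqr_ge0.
    apply/negP => /eqP/esym/eqP; rewrite psumr_eq0; last by move=> e _; exact: sqr_ge0.
    move=> /allP r0.
    have : t0 <= t0 - d.
      apply: (tmin _ a); [lra|lra|move=> e].
      have := r0 e; rewrite mem_index_enum sqrf_eq0 => /(_ isT); rewrite subr_eq0 => /eqP ->.
      by rewrite /beta /y ha1 /line; ring.
    by lra.
  pose nr := Num.sqrt (\sum_e rho e ^+ 2).
  have nr0 : 0 < nr by rewrite sqrtr_gt0.
  have nr2 : nr ^+ 2 = \sum_e rho e ^+ 2 by rewrite sqr_sqrtr// ltW.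
  exists a, (fun e => rho e / nr); split.
  - move=> e; have : rho e ^+ 2 <= d ^+ 2 * S.
      apply: le_trans rho_le; rewrite (bigD1 e)//= lerDl.
      by apply: sumr_ge0 => j _; exact: sqr_ge0.
    have -> : bimeas a a e = y e - d * c e + rho e by rewrite /rho /beta; ring.
    have d1 : d ^+ 2 * S <= S by rewrite ler_piMl// expr_le1// ?ltW//; lra.
    move=> h1; rewrite /M.
    have h2 : rho e <= 1 + S by have := sqr_ge0 (rho e - 1 / 2); lra.
    have h3 : - (d * c e) <= `|c e|.
      apply: le_trans (ler_norm _) _; rewrite normrN normrM ler_piMl//.
      by rewrite ger0_norm ?ltW//; lra.
    by have := ler_norm (y e); lra.
  - by under eq_bigr do rewrite expr_div_n; rewrite -mulr_suml -nr2 divff// expf_neq0// gt_eqF.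
  - move=> l; under eq_bigr do rewrite mulrAC.
    rewrite -mulr_suml (_ : \sum_e _ = 0) ?mul0r//.
    transitivity (\sum_e bimeas a a e * C e l - (\sum_e bimeas a1 a1 e * C e l) +
      d * (\sum_e bimeas a0 a0 e * C e l + \sum_e bimeas x x e * C e l)).
      rewrite -sumrB -big_split/= mulr_sumr -big_split/=; apply: eq_bigr => e _.
      by rewrite /rho /beta /y /c; ring.
    by rewrite !bimeas_C; ring.
  - move=> zeta; under eq_bigr do rewrite mulrAC.
    by rewrite -mulr_suml acrit mul0r.
  - apply: le_trans (_ : \sum_e (2 * rho e ^+ 2 + 2 * (d ^+ 2 * c e ^+ 2)) <= _).
      apply: ler_sum => e _.
      have -> : bimeas a a e - y e = rho e - d * c e by rewrite /rho /beta; ring.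
      by have := sqr_ge0 (rho e + d * c e); nra.
    by rewrite big_split/= -!mulr_sumr -/S; lra.
have [B2 hB2] := bimeas_bound M.
pose J := (T2 + E)%type.
pose mka (v : J -> R) i k := v (inl (i, k)).
pose fs (j : option (L + T2)) (v : J -> R) := match j with
  | None => \sum_e v (inr e) ^+ 2 - 1
  | Some (inl l) => \sum_e v (inr e) * C e l
  | Some (inr (i, k)) => \sum_e v (inr e) * bimeas (mka v) (tv i k) e end.
(* A minimum replaces the limit [d -> 0]: on the compact set of pairs of a bounded configuration and
   a normalised critical covector, the distance [g] of the lengths to [y] attains a minimum, which
   [near] forces to be 0. *)
pose f (j : option (L + T2) + option (L + T2) + E) (v : J -> R) := match j with
  | inl (inl j) => fs j v
  | inl (inr j) => - fs j v
  | inr e => bimeas (mka v) (mka v) e - M e end.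
have pm e : polyfun (fun v => bimeas (mka v) (mka v) e).
  by apply: (polyfun_bimeas (f := fun i k v => v (inl (i, k))) (g := fun i k v => v (inl (i, k))))
      => i k; exact: polyfun_var.
have pfs j : polyfun (fs j).
  case: j => [[l|[i k]]|] /=.
  - by apply: polyfun_sum => e; apply: polyfun_mul; [exact: polyfun_var|exact: polyfun_cst].
  - apply: polyfun_sum => e; apply: polyfun_mul; first exact: polyfun_var.
    by apply: (polyfun_bimeas (f := fun i k v => v (inl (i, k))) (g := fun i' k' _ => tv i k i' k'))
      => i' k'; [exact: polyfun_var|exact: polyfun_cst].
  - apply: polyfun_sub; last exact: polyfun_cst.
    by apply: polyfun_sum => e; apply: polyfun_sqr; exact: polyfun_var.
have fP v : (forall j, f j v <= 0) <->
    (forall j, fs j v = 0) /\ (forall e, bimeas (mka v) (mka v) e <= M e).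
  split=> [fv|[fs0 hM] [[j|j]|e] /=]; last 1 first.
  - by rewrite subr_le0.
  - split=> [j|e]; last by have := fv (inr e); rewrite /= subr_le0.
    apply/eqP; rewrite eq_le (fv (inl (inl j))) /= -oppr_le0.
    exact: (fv (inl (inr j))).
  - by rewrite fs0.
  - by rewrite fs0 oppr0.
pose g (v : J -> R) := \sum_e (bimeas (mka v) (mka v) e - y e) ^+ 2.
have nearf d : 0 < d -> d < t0 -> exists v, (forall j, f j v <= 0) /\ g v <= 4 * d ^+ 2 * S.
  move=> d0 dt; have [a [phi [hM p1 pC pcrit ple]]] := near d d0 dt.
  exists (fun j => match j with inl z => a z.1 z.2 | inr e => phi e end); split=> //.
  apply/fP; split; last exact: hM.
  move=> [[l|[i k]]|] /=; [exact: pC|exact: pcrit|by rewrite p1 subrr].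
have [||||v [fv vmin]] := @polyfun_min R _ _ f g (2 + `|B2|).
- move=> [[j|j]|e] /=; [exact: pfs|exact: polyfun_opp|].
  by apply: polyfun_sub => //; exact: polyfun_cst.
- by apply: polyfun_sum => e; apply: polyfun_sqr; apply: polyfun_sub => //; exact: polyfun_cst.
- move=> v /fP[fs0 hM] [[i k]|e].
    apply: le_trans (_ : B2 <= _); last by have := ler_norm B2; lra.
    exact: (hB2 (mka v)).
  have : v (inr e) ^+ 2 <= 1.
    have /eqP := fs0 None; rewrite /= subr_eq0 => /eqP <-.
    by rewrite (bigD1 e)//= lerDl; apply: sumr_ge0 => j _; exact: sqr_ge0.
  rewrite -(real_normK (num_real _)); set u := `|v _|.
  by have := sqr_ge0 (u - 1); have := normr_ge0 B2; nra.
- by have [||v [fv _]] := nearf (t0 / 2); [lra|lra|exists v].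
have /fP[fs0 hM] := fv.
have g0 : g v = 0.
  have gp : 0 <= g v by apply: sumr_ge0 => e _; exact: sqr_ge0.
  apply/eqP; rewrite eq_le gp andbT leNgt; apply/negP => gv0.
  (* As [d <= 1], [near] gives a value at most [4 * d * S], below [d * (8 * (S + 1)) <= g v],
     against the minimality of [v]. *)
  pose d := Num.min (t0 / 2) (g v / (8 * (S + 1))).
  have d0 : 0 < d by rewrite lt_min; apply/andP; split; [lra|apply: divr_gt0 => //; lra].
  have dt : d <= t0 / 2 by rewrite ge_min lexx.
  have dg : d * (8 * (S + 1)) <= g v.
    by rewrite -ler_pdivlMr; [rewrite ge_min lexx orbT|lra].
  have [|w [fw gw]] := nearf d d0 _; first lra.
  have := le_trans (vmin w fw) gw.
  have : d ^+ 2 * S <= d * S.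
    by rewrite expr2 -mulrA ler_pM2l// ler_piMl//; lra.
  by lra.
exists t0, (mka v), (fun e => v (inr e)); split=> //.
- move=> e; rewrite -/(c e) -/(line t0 e) -ha1; apply/eqP; rewrite -subr_eq0 -sqrf_eq0.
  move/eqP: g0; rewrite /g psumr_eq0 => [/allP/(_ e)|j _]; last exact: sqr_ge0.
  by rewrite mem_index_enum => /(_ isT).
- have [/forallP z|] := boolP [forall e, v (inr e) == 0]; last first.
    by rewrite negb_forall => /existsP.
  have := fs0 None; rewrite /= big1 => [|e _]; last by rewrite (eqP (z e)) expr0n.
  by rewrite sub0r => /eqP; rewrite oppr_eq0 oner_eq0.
- by move=> l; exact: (fs0 (Some (inl l))).
- by apply: critP => i k; exact: (fs0 (Some (inr (i, k)))).
Qed.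

End Measurement.

Section KernelComparison.
Variable F : fieldType.

Lemma frank_ker_inj (I I' J J' : finType) (M : I -> J -> F) (M' : I' -> J' -> F)
    (Phi : I -> I' -> F) :
  (forall v, (forall j, \sum_i v i * M i j = 0) ->
     forall j, \sum_i' (\sum_i v i * Phi i i') * M' i' j = 0) ->
  (forall v, (forall i', \sum_i v i * Phi i i' = 0) -> forall i, v i = 0) ->
  (#|I| + \rank (fmx M') <= #|I'| + \rank (fmx M))%N.
Proof.
move=> hker hinj.
have freePhi : row_free (fmx Phi).
  rewrite -kermx_eq0; apply/eqP/row_matrixP => i; rewrite row0.
  rewrite -(fantiK (row i _)); apply/frow_eq0/hinj/fmul_eq0.
  by rewrite fantiK; apply/sub_kermxP/row_sub.
have : (kermx (fmx M) *m fmx Phi <= kermx (fmx M'))%MS.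
  apply/row_subP => i; apply/sub_kermxP; rewrite row_mul -(fantiK (row i _)) frow_mul.
  by apply/fmul_eq0/hker/fmul_eq0; rewrite fantiK; apply/sub_kermxP/row_sub.
move/mxrankS; rewrite mxrankMfree// !mxrank_ker.
have := rank_leq_row (fmx M); have := rank_leq_row (fmx M'); lia.
Qed.

Lemma frank_ker_sub (I J J' : finType) (M : I -> J -> F) (M' : I -> J' -> F) :
  (forall v, (forall j, \sum_i v i * M i j = 0) ->
     forall j, \sum_i v i * M' i j = 0) ->
  (\rank (fmx M') <= \rank (fmx M))%N.
Proof.
move=> sub; have := @frank_ker_inj _ _ _ _ M M' (fun i i' => (i == i')%:R).
rewrite leq_add2l; apply=> v hv.
  by move=> j; rewrite -[RHS](sub v hv j); apply: eq_bigr => i _; under eq_bigr do rewrite eq_sym; rewrite sum_indicr.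
by move=> i; rewrite -[RHS](hv i); under eq_bigr do rewrite eq_sym; rewrite sum_indicr.
Qed.

(** The rank bound leaves at most one dimension between the two left kernels, and [xi] already
    accounts for it. *)
Lemma fker_add1 (I J J' : finType) (M : I -> J -> F) (M' : I -> J' -> F) xi :
  (forall v, (forall j, \sum_i v i * M i j = 0) ->
     forall j, \sum_i v i * M' i j = 0) ->
  (\rank (fmx M) <= (\rank (fmx M')).+1)%N ->
  (forall j, \sum_i xi i * M' i j = 0) -> ~ (forall j, \sum_i xi i * M i j = 0) ->
  forall v, (forall j, \sum_i v i * M' i j = 0) ->
  exists r, forall j, \sum_i (v i - r * xi i) * M i j = 0.
Proof.
move=> sub rk xiM' xiM v vM'.
have subK : (kermx (fmx M) + frow xi <= kermx (fmx M'))%MS.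
  rewrite addsmx_sub; apply/andP; split; last exact/sub_kermxP/fmul_eq0.
  apply/row_subP => i; apply/sub_kermxP; rewrite -(fantiK (row i _)).
  by apply/fmul_eq0/sub/fmul_eq0; rewrite fantiK; apply/sub_kermxP/row_sub.
have ltK : (kermx (fmx M) < kermx (fmx M) + frow xi)%MS.
  rewrite ltmxE addsmxSl addsmx_sub submx_refl /=; apply/negP => /sub_kermxP.
  by move=> /fmul_eq0.
have /eqmxP eqK : (kermx (fmx M) + frow xi == kermx (fmx M'))%MS.
  rewrite -(geq_leqif (mxrank_leqif_eq subK)).
  have := rank_ltmx ltK; rewrite !mxrank_ker.
  by move: rk; have := rank_leq_row (fmx M); lia.
have : (frow v <= kermx (fmx M'))%MS by apply/sub_kermxP/fmul_eq0.
rewrite -eqK => /sub_addsmxP[[u1 u2] /= vE]; exists (u2 0 0).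
apply/fmul_eq0; have -> : frow (fun i => v i - u2 0 0 * xi i) = frow v - u2 *m frow xi.
  by apply/rowP => i; rewrite !mxE big_ord1 !mxE.
by rewrite vE addrK -mulmxA mulmx_ker mulmx0.
Qed.

End KernelComparison.

(** * Rank of the differential of the Gram map *)

Section SymmetricProducts.
Variables (F : numFieldType) (n d : nat).
Implicit Types a zeta : 'M[F]_(n, d).

(** Differential of [a *m a^T] at [a] in the direction [zeta]; when [a] has rank [d] its kernel
    consists of the infinitesimal rotations. *)
Definition sym_prod a zeta : 'M[F]_n := a *m zeta^T + zeta *m a^T.

Definition sym_prod_mx a (x : 'I_n * 'I_d) (y : 'I_n * 'I_n) : F :=
  a y.1 x.2 * (y.2 == x.1)%:R + (y.1 == x.1)%:R * a y.2 x.2.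

Lemma sym_prod_mxE a (v : 'I_n * 'I_d -> F) y :
  \sum_x v x * sym_prod_mx a x y = sym_prod a (\matrix_(i, k) v (i, k)) y.1 y.2.
Proof.
pose f i k := v (i, k) * sym_prod_mx a (i, k) y.
transitivity (\sum_(x : 'I_n * 'I_d) f x.1 x.2); first by apply: eq_bigr => -[].
rewrite sum_pair exchange_big /= !mxE -big_split /=; apply: eq_bigr => k _.
rewrite !mxE /f /sym_prod_mx /=.
rewrite -(sum_indic y.2 (fun i => v (i, k))) -(sum_indic y.1 (fun i => v (i, k))).
rewrite mulr_sumr mulr_suml -big_split/=; apply: eq_bigr => i _; ring.
Qed.

Lemma sym_prod_kerP a (v : 'I_n * 'I_d -> F) :
  (forall y, \sum_x v x * sym_prod_mx a x y = 0) <->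
  sym_prod a (\matrix_(i, k) v (i, k)) = 0.
Proof.
split=> [h|h y]; last by rewrite sym_prod_mxE h mxE.
by apply/matrixP => i j; rewrite -(sym_prod_mxE a v (i, j)) h mxE.
Qed.

(** Base change on both sides, with [zeta] transforming contragrediently on the right; it reduces
    ranks at [a] to ranks at a normal form. *)
Lemma sym_prod_base (G : 'M[F]_n) (M : 'M[F]_d) a zeta : M \in unitmx ->
  sym_prod (G *m a *m M) (G *m zeta *m (invmx M)^T) = G *m sym_prod a zeta *m G^T.
Proof.
move=> uM; rewrite /sym_prod !trmx_mul !trmxK mulmxDr mulmxDl; congr (_ + _).
  by rewrite !mulmxA mulmxK.
rewrite !mulmxA -(mulmxA (G *m zeta) (invmx M)^T M^T).
by rewrite -trmx_mul mulmxV// trmx1 mulmx1.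
Qed.

Lemma rank_sym_prod_base (G : 'M[F]_n) (M : 'M[F]_d) a :
  G \in unitmx -> M \in unitmx ->
  (\rank (fmx (sym_prod_mx (G *m a *m M))) <= \rank (fmx (sym_prod_mx a)))%N.
Proof.
move=> uG uM.
pose Phi (x y : 'I_n * 'I_d) := G y.1 x.1 * (invmx M)^T x.2 y.2.
have PhiE (v : 'I_n * 'I_d -> F) :
    \matrix_(i, k) \sum_x v x * Phi x (i, k) = G *m (\matrix_(i, k) v (i, k)) *m (invmx M)^T.
  apply/matrixP => i k; rewrite !mxE.
  pose f i' k' := v (i', k') * Phi (i', k') (i, k).
  transitivity (\sum_(x : 'I_n * 'I_d) f x.1 x.2); first by apply: eq_bigr => -[].
  rewrite sum_pair exchange_big /=; apply: eq_bigr => k' _; rewrite !mxE mulr_suml.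
  by apply: eq_bigr => i' _; rewrite !mxE /f /Phi /= !mxE; ring.
have := @frank_ker_inj _ _ _ _ _ (sym_prod_mx a) (sym_prod_mx (G *m a *m M)) Phi.
rewrite leq_add2l; apply=> v.
  move=> /sym_prod_kerP h; apply/sym_prod_kerP.
  rewrite -[X in sym_prod _ X]/(\matrix_(i, k) _) PhiE sym_prod_base// h.
  by rewrite mulmx0 mul0mx.
move=> h [i k].
have : G *m (\matrix_(i, k) v (i, k)) *m (invmx M)^T = 0.
  by rewrite -PhiE; apply/matrixP => i' k'; rewrite !mxE h.
move/(congr1 (fun X => invmx G *m X *m M^T)).
rewrite mulmx0 mul0mx !mulmxA mulVmx// mul1mx -mulmxA -trmx_mul mulmxV// trmx1 mulmx1.
by move/matrixP/(_ i k); rewrite !mxE.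
Qed.

Hypothesis dn : (d < n)%N.
Local Notation a0 := (pid_mx d : 'M[F]_(n, d)).

Lemma sym_prod_pidE zeta p q : sym_prod a0 zeta p q =
  (if insub (p : nat) is Some k then zeta q k else 0) +
  (if insub (q : nat) is Some k then zeta p k else 0).
Proof.
have E (i j : 'I_n) : (a0 *m zeta^T) i j = if insub (i : nat) is Some k then zeta j k else 0.
  rewrite !mxE; case: insubP => [k kd ki|].
    rewrite -(sum_indic k (fun k => zeta j k)); apply: eq_bigr => l _.
    by rewrite !mxE -ki ltn_ord andbT.
  rewrite -leqNgt => di; apply: big1 => l _; rewrite !mxE.
  by rewrite [(i < d)%N]ltnNge di andbF mul0r.
rewrite /sym_prod [LHS]mxE E; congr (_ + _).
by rewrite -[zeta *m _]trmxK trmx_mul trmxK mxE E.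
Qed.

Lemma sym_prod_pid_image (B : 'M[F]_n) : B^T = B ->
  (forall p q : 'I_n, (d <= p)%N -> (d <= q)%N -> B p q = 0) ->
  exists zeta, sym_prod a0 zeta = B.
Proof.
move=> symB B0; have sB p q : B p q = B q p by rewrite -{1}symB mxE.
(* An entry with both indices below [d] receives a contribution from each of the two summands, hence
   the half. *)
pose zeta : 'M[F]_(n, d) := \matrix_(q, k)
  (if (q < d)%N then B (widen_ord (ltnW dn) k) q / 2 else B (widen_ord (ltnW dn) k) q).
exists zeta; apply/matrixP => p q; rewrite sym_prod_pidE.
case: insubP => [k kd kp|]; case: insubP => [l ld lq|].
- rewrite !mxE kd ld.
  have -> : widen_ord (ltnW dn) k = p by apply: val_inj.
  have -> : widen_ord (ltnW dn) l = q by apply: val_inj.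
  by rewrite (sB q p); field.
- move=> qd; rewrite addr0 !mxE (negPf qd).
  by have -> : widen_ord (ltnW dn) k = p by apply: val_inj.
- move=> pd; rewrite add0r !mxE (negPf pd).
  by have -> : widen_ord (ltnW dn) l = q; [apply: val_inj|rewrite sB].
- by rewrite -!leqNgt => qd pd; rewrite addr0 B0.
Qed.

Lemma sym_prod_sym a zeta : (sym_prod a zeta)^T = sym_prod a zeta.
Proof. by rewrite /sym_prod linearD /= !trmx_mul !trmxK addrC. Qed.

Lemma rank_sym_prod_full a : \rank a = d ->
  \rank (fmx (sym_prod_mx a)) = \rank (fmx (sym_prod_mx a0)).
Proof.
move=> ra; apply/eqP; rewrite eqn_leq; apply/andP; split.
  rewrite -{1}(mulmx_ebase a) ra.
  by apply: rank_sym_prod_base; [exact: col_ebase_unit|exact: row_ebase_unit].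
have -> : a0 = invmx (col_ebase a) *m a *m invmx (row_ebase a).
  rewrite -{2}(mulmx_ebase a) ra !mulmxA mulVmx ?col_ebase_unit// mul1mx.
  by rewrite mulmxK ?row_ebase_unit.
by apply: rank_sym_prod_base; rewrite unitmx_inv ?col_ebase_unit ?row_ebase_unit.
Qed.

(** After base change, rank below [d] makes the image lose at least the entries [(d-1, d-1)] and
    [(d-1, d)]; the second exists because [d < n]. Losing two dimensions is what separates such
    points from a fold, where one is lost. *)
Lemma rank_sym_prod_deficient a : (\rank a < d)%N ->
  (\rank (fmx (sym_prod_mx a)) + 2 <= \rank (fmx (sym_prod_mx a0)))%N.
Proof.
move=> ra; pose r := \rank a.
have d1n : (d.-1 < n)%N by apply: leq_ltn_trans dn; exact: leq_pred.
have d1 : d.-1.+1 = d by rewrite prednK//; apply: leq_ltn_trans ra.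
pose i0 := Ordinal d1n; pose i1 := Ordinal dn.
pose a' : 'M[F]_(n, d) := pid_mx r *m row_ebase a.
have aE : a = col_ebase a *m a' *m 1%:M by rewrite mulmx1 mulmxA mulmx_ebase.
have h0 : (\rank (fmx (sym_prod_mx a)) + 2 <= \rank (fmx (sym_prod_mx a')) + 2)%N.
  by rewrite leq_add2r {1}aE rank_sym_prod_base ?unitmx1 ?col_ebase_unit.
have a'0 (p : 'I_n) k : (d.-1 <= p)%N -> a' p k = 0.
  move=> dp; rewrite mxE big1// => l _; rewrite mxE.
  rewrite (_ : (p < r)%N = false) ?andbF ?mul0r//.
  by apply/negbTE; rewrite -leqNgt; apply: leq_trans dp; rewrite -ltnS d1.
clearbody a'.
have B0 zeta (p q : 'I_n) : (d.-1 <= p)%N -> (d.-1 <= q)%N -> sym_prod a' zeta p q = 0.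
  move=> dp dq; rewrite !mxE !big1 ?addr0// => l _; rewrite !mxE.
    by rewrite a'0// mulr0.
  by rewrite a'0// mul0r.
pose c (p q : 'I_n) : 'cV[F]_#|{: 'I_n * 'I_n}| := delta_mx (enum_rank (p, q)) 0.
have cE (v : 'I_n * 'I_n -> F) p q : frow v *m c p q = 0 <-> v (p, q) = 0.
  rewrite -colE; split=> [/matrixP/(_ 0 0)|h].
    by rewrite !mxE enum_rankK.
  by apply/matrixP => i j; rewrite !mxE enum_rankK h.
have memB (B : 'M[F]_n) : B^T = B ->
    (forall p q : 'I_n, (d <= p)%N -> (d <= q)%N -> B p q = 0) ->
    (frow (fun y => B y.1 y.2) <= fmx (sym_prod_mx a0))%MS.
  move=> sB hB; have [zeta hz] := sym_prod_pid_image sB hB.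
  apply/frow_submx; exists (fun x => zeta x.1 x.2) => y.
  rewrite sym_prod_mxE -hz; congr (sym_prod _ _ _ _).
  by apply/matrixP => i k; rewrite mxE.
pose B1 : 'M[F]_n := delta_mx i0 i0.
pose B2 : 'M[F]_n := delta_mx i0 i1 + delta_mx i1 i0.
have i01 : (i0 == i1) = false by apply/negbTE; rewrite -val_eqE /= neq_ltn d1 leqnn.
have u1 : (frow (fun y => B1 y.1 y.2) <= fmx (sym_prod_mx a0))%MS.
  apply: memB; first by rewrite trmx_delta.
  move=> p q dp dq; rewrite mxE; case: eqP => //= pi.
  by move: dp; rewrite pi /= -ltnS d1 ltnn.
have u2 : (frow (fun y => B2 y.1 y.2) <= fmx (sym_prod_mx a0))%MS.
  apply: memB; first by rewrite linearD /= !trmx_delta addrC.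
  move=> p q dp dq; rewrite !mxE.
  have -> : (p == i0) = false by apply/negbTE; apply: contraL dp => /eqP ->; rewrite -ltnNge /= d1.
  have -> : (q == i0) = false by apply/negbTE; apply: contraL dq => /eqP ->; rewrite -ltnNge /= d1.
  by rewrite andbF addr0.
set X' := fmx (sym_prod_mx a').
have rowE i : row i X' = frow (fun y => sym_prod_mx a' (enum_val i) y).
  by apply/rowP => j; rewrite !mxE.
have rowz (x0 : 'I_n * 'I_d) : exists zeta, forall y, sym_prod_mx a' x0 y = sym_prod a' zeta y.1 y.2.
  exists (\matrix_(i', k') ((i', k') == x0)%:R) => y.
  transitivity (\sum_x (x == x0)%:R * sym_prod_mx a' x y).
    rewrite -[LHS](sum_indic x0 (fun x => sym_prod_mx a' x y)).
    by apply: eq_bigr => x _; rewrite eq_sym.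
  exact: (sym_prod_mxE a' (fun x => (x == x0)%:R)).
have X'X : (X' <= fmx (sym_prod_mx a0))%MS.
  apply/row_subP => i; rewrite rowE; have [zeta hz] := rowz (enum_val i).
  have -> : frow (fun y : 'I_n * 'I_n => sym_prod_mx a' (enum_val i) y) =
      frow (fun y : 'I_n * 'I_n => sym_prod a' zeta y.1 y.2).
    by apply/rowP => j; rewrite [LHS]mxE [RHS]mxE hz.
  apply: memB; first exact: sym_prod_sym.
  by move=> p q dp dq; apply: B0; [apply: leq_trans dp|apply: leq_trans dq]; rewrite leq_pred.
have X'c (p q : 'I_n) : (d.-1 <= p)%N -> (d.-1 <= q)%N -> X' *m c p q = 0.
  move=> dp dq; apply/row_matrixP => i; rewrite row0 row_mul rowE; apply/cE.
  by have [zeta ->] := rowz (enum_val i); rewrite /= B0.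
pose X1 := (X' + frow (fun y => B1 y.1 y.2))%MS.
have subc p (A : 'M[F]_(p, #|{: 'I_n * 'I_n}|)) m (A2 : 'M[F]_(m, #|{: 'I_n * 'I_n}|)) cc :
    (A <= A2)%MS -> A2 *m cc = 0 :> 'cV_m -> A *m cc = 0.
  by move=> /submxP[D ->] h; rewrite -mulmxA h mulmx0.
have lt1 : (\rank X' < \rank X1)%N.
  apply: rank_ltmx; rewrite ltmxE addsmxSl /=; apply/negP => /(submx_trans (addsmxSr _ _)).
  move=> /subc/(_ (X'c i0 i0 (leqnn _) (leqnn _)))/cE.
  by rewrite /= mxE !eqxx => /eqP; rewrite oner_eq0.
have X1c : X1 *m c i0 i1 = 0.
  apply: (subc _ _ _ (col_mx X' (frow (fun y => B1 y.1 y.2)))).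
    by rewrite addsmxE.
  rewrite mul_col_mx X'c ?leq_pred//.
  have e1 : B1 i0 i1 = 0 by rewrite mxE [i1 == _]eq_sym i01 andbF.
  by rewrite ((cE (fun y => B1 y.1 y.2) i0 i1).2 e1) col_mx0.
have lt2 : (\rank X1 < \rank (X1 + frow (fun y => B2 y.1 y.2))%MS)%N.
  apply: rank_ltmx; rewrite ltmxE addsmxSl /=; apply/negP => /(submx_trans (addsmxSr _ _)).
  move=> /subc/(_ X1c)/cE.
  rewrite /= !mxE !eqxx i01 /= addr0 => /eqP.
  by rewrite oner_eq0.
apply: leq_trans h0 _; rewrite addn2.
apply: leq_trans (_ : (\rank X1).+1 <= _)%N; first exact: lt1.
apply: leq_trans lt2 _; apply: mxrankS.
by rewrite !addsmx_sub X'X u1 u2.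
Qed.

(** With a left inverse [L^T] of [a], multiplying the equation by [L] on the right expresses [zeta]
    as [- a *m zeta^T *m L]; multiplying on both sides shows that [L^T *m zeta] is skew. *)
Lemma sym_prod_ker_full a zeta : \rank a = d -> sym_prod a zeta = 0 ->
  exists Y : 'M[F]_d, Y^T = - Y /\ zeta = a *m Y.
Proof.
move=> ra az; pose L := pinvmx a^T.
have aL : L^T *m a = 1%:M.
  apply: trmx_inj; rewrite trmx_mul trmxK trmx1; apply: mulmxVp.
  by rewrite /row_free mxrank_tr ra.
clearbody L.
have aT : a^T *m L = 1%:M by rewrite -[LHS]trmxK trmx_mul trmxK aL trmx1.
have Lz : zeta^T *m L + L^T *m zeta = 0.
  have h1 : L^T *m (a *m zeta^T) *m L = zeta^T *m L by rewrite mulmxA aL mul1mx.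
  have h2 : L^T *m (zeta *m a^T) *m L = L^T *m zeta by rewrite -!mulmxA aT mulmx1.
  by rewrite -h1 -h2 -mulmxDl -mulmxDr -/(sym_prod a zeta) az mulmx0 mul0mx.
exists (L^T *m zeta); split.
  by rewrite trmx_mul trmxK; apply/eqP; rewrite -addr_eq0 Lz.
have : sym_prod a zeta *m L = 0 by rewrite az mul0mx.
rewrite /sym_prod mulmxDl -!mulmxA aT mulmx1 => /eqP; rewrite addrC addr_eq0 => /eqP e.
have /eqP := Lz; rewrite addr_eq0 => /eqP e2.
by rewrite [LHS]e e2 mulmxN opprK.
Qed.

End SymmetricProducts.

Section DerivMatrix.
Variable F : numFieldType.

Lemma der_mulmx (D : F -> F) m n p (A : 'M[F]_(m, n)) (B : 'M[F]_(n, p)) :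
  deriv D -> map_mx D (A *m B) = map_mx D A *m B + A *m map_mx D B.
Proof.
move=> dD; apply/matrixP => i j; rewrite !mxE (der_sum _ _ _ dD) -big_split/=.
by apply: eq_bigr => k _; rewrite !mxE (derM dD).
Qed.

Lemma der_addmx (D : F -> F) m n (A B : 'M[F]_(m, n)) :
  deriv D -> map_mx D (A + B) = map_mx D A + map_mx D B.
Proof. by move=> dD; apply/matrixP => i j; rewrite !mxE (derD dD). Qed.

Lemma der_oppmx (D : F -> F) m n (A : 'M[F]_(m, n)) :
  deriv D -> map_mx D (- A) = - map_mx D A.
Proof. by move=> dD; apply/matrixP => i j; rewrite !mxE (derN _ dD). Qed.

Lemma der_mx1 (D : F -> F) n : deriv D -> map_mx D (1%:M : 'M_n) = 0.
Proof. by move=> dD; apply/matrixP => i j; rewrite !mxE (der_nat _ dD). Qed.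

End DerivMatrix.

(** * Rotations parametrised by skew matrices *)

Section Cayley.
Variables (R : realFieldType) (d : nat).
Implicit Types X Z : 'M[R]_d.

Lemma skew_unit X : X^T = - X -> 1%:M - X \in unitmx.
Proof.
move=> sX; rewrite -row_free_unit -kermx_eq0; apply/eqP/row_matrixP => i.
set v := row i _; rewrite row0.
have : v *m (1%:M - X) = 0 by apply/sub_kermxP/row_sub.
rewrite mulmxBr mulmx1 => /eqP; rewrite subr_eq0 => /eqP vX.
have vXv : v *m X *m v^T = 0.
  have e : v *m X *m v^T = - (v *m X *m v^T).
    have t11 (A : 'M[R]_1) : A^T = A by apply/matrixP => a b; rewrite mxE !ord1.
    by rewrite -[LHS]t11 !trmx_mul trmxK sX mulNmx mulmxN mulmxA.
  move: (v *m X *m v^T) e => w /matrixP e; apply/matrixP => a b.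
  by have := e a b; rewrite !mxE; lra.
rewrite -vX in vXv; apply/rowP => k.
have /eqP : \sum_j v 0 j ^+ 2 = 0.
  have /matrixP/(_ 0 0) := vXv; rewrite !mxE => h0; rewrite -[RHS]h0.
  by apply: eq_bigr => j _; rewrite !mxE expr2.
rewrite psumr_eq0 => [/allP/(_ k)|j _]; last exact: sqr_ge0.
by rewrite mem_index_enum sqrf_eq0 => /(_ isT) /eqP ->; rewrite mxE.
Qed.

(** The Cayley transform is rational in [X], so derivatives of the entries of [X] determine those of
    the rotation. *)
Definition cayley X : 'M[R]_d := invmx (1%:M - X) *m (1%:M + X).

Lemma cayley_orth X : X^T = - X -> cayley X *m (cayley X)^T = 1%:M.
Proof.
move=> sX; have u := skew_unit sX.
have t1 : (1%:M + X)^T = 1%:M - X by rewrite raddfD /= trmx1 sX.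
have t2 : (1%:M - X)^T = 1%:M + X by rewrite raddfB /= trmx1 sX opprK.
rewrite /cayley trmx_mul trmx_inv t1 t2.
have comm : (1%:M + X) *m (1%:M - X) = (1%:M - X) *m (1%:M + X).
  by rewrite !mulmxDl !mulmxDr !mulmx1 !mul1mx mulmxN mulNmx; apply/matrixP => i j; rewrite !mxE; ring.
have u2 : 1%:M + X \in unitmx by rewrite -unitmx_tr t1.
rewrite mulmxA -(mulmxA _ (1%:M + X) (1%:M - X)) comm mulmxA mulVmx// mul1mx.
by rewrite mulmxV.
Qed.

(** Derive [(1 - X) g = 1 + X] and use [(1 + g) (1 - X) = 2]: the prescribed derivative of [X] is
    the solution of [D g = Z g]. It is skew when [Z] is, hence attainable if the entries of [X] are
    free. *)
Lemma cayley_der (D : R -> R) X Z : deriv D -> X^T = - X ->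
  map_mx D X = 2^-1 *: ((1%:M - X) *m Z *m (1%:M + X)) ->
  map_mx D (cayley X) = Z *m cayley X.
Proof.
move=> dD sX DX; have u := skew_unit sX; set g := cayley X.
have gE : (1%:M - X) *m g = 1%:M + X by rewrite /g /cayley mulmxA mulmxV// mul1mx.
have comm : (1%:M + X) *m (1%:M - X) = (1%:M - X) *m (1%:M + X).
  by rewrite !mulmxDl !mulmxDr !mulmx1 !mul1mx mulmxN mulNmx; apply/matrixP => i j; rewrite !mxE; ring.
have gE' : g *m (1%:M - X) = 1%:M + X.
  by rewrite /g /cayley -mulmxA comm mulmxA mulVmx// mul1mx.
clearbody g.
have g1 : (1%:M + g) *m (1%:M - X) = 2 *: 1%:M.
  rewrite mulmxDl mul1mx gE' addrACA addNr addr0 -mulr2n.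
  by rewrite -scaler_nat.
have := congr1 (map_mx D) gE.
rewrite (der_mulmx _ _ dD) !(der_addmx _ _ dD) (der_oppmx _ dD) !(der_mx1 _ dD) !add0r.
rewrite mulNmx => /eqP; rewrite addrC subr_eq -{1}[map_mx D X]mulmx1 -mulmxDr => /eqP e.
have : (1%:M - X) *m map_mx D g *m (1%:M - X) = (1%:M - X) *m (Z *m g) *m (1%:M - X).
  rewrite e -mulmxA g1 -scalemxAr mulmx1 DX scalerA mulfV ?scale1r ?pnatr_eq0//.
  by rewrite -!mulmxA gE'.
move/(congr1 (fun Y => invmx (1%:M - X) *m Y *m invmx (1%:M - X))).
by rewrite !mulmxA !mulVmx// !mul1mx !mulmxK.
Qed.

End Cayley.

(** * Folds of the measurement map, generic over given data *)

Section Folding.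
Variables (R : realType) (n d : nat) (E : finType) (h : E -> 'I_n -> R).
Hypotheses (uncR : ~ countable [set: R]) (d0 : (0 < d)%N) (dn : (d < n)%N).
Local Notation conf := ('I_n -> 'I_d -> R).
Local Notation bm := (bimeas h).
Implicit Types (a b zeta xi x : conf) (e : E).

Definition conf_mx a : 'M[R]_(n, d) := \matrix_(i, k) a i k.

(** Configurations will be written in a basis of the stress kernel modulo constants whose first [d]
    members are the coordinates of [p]; in it, this configuration is [p]. *)
Definition base_conf : conf := fun i k => (pid_mx d : 'M[R]_(n, d)) i k.
Local Notation a0 := base_conf.

Definition bimeas_mx a (y : 'I_n * 'I_d) e : R := edge_vec h a e y.2 * h e y.1.

Lemma bimeas_mxE a (v : 'I_n * 'I_d -> R) e :
  \sum_y v y * bimeas_mx a y e = bm a (fun i k => v (i, k)) e.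
Proof.
pose f i k := v (i, k) * bimeas_mx a (i, k) e.
transitivity (\sum_(y : 'I_n * 'I_d) f y.1 y.2); first by apply: eq_bigr => -[].
rewrite sum_pair exchange_big /=; apply: eq_bigr => k _.
rewrite {2}/edge_vec mulr_sumr; apply: eq_bigr => i _.
by rewrite /f /bimeas_mx /=; ring.
Qed.

Lemma bimeas_sym_prod a zeta e :
  \sum_p \sum_q h e p * h e q * sym_prod (conf_mx a) (conf_mx zeta) p q =
  2 * bm a zeta e.
Proof.
have key a1 a2 : \sum_p \sum_q h e p * h e q * (\sum_k a1 p k * a2 q k) = bm a1 a2 e.
  under eq_bigr do under eq_bigr do rewrite mulr_sumr.
  under eq_bigr do rewrite exchange_big /=.
  rewrite exchange_big /=; apply: eq_bigr => k _.
  rewrite /edge_vec mulr_suml; apply: eq_bigr => p _.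
  by rewrite mulr_sumr; apply: eq_bigr => q _; ring.
transitivity (bm a zeta e + bm zeta a e); last by rewrite (bimeas_sym h zeta); ring.
rewrite -!key -big_split/=; apply: eq_bigr => p _.
rewrite -big_split/=; apply: eq_bigr => q _.
rewrite -mulrDr; congr (_ * _); rewrite /sym_prod mxE; congr (_ + _);
  by rewrite mxE; apply: eq_bigr => k _; rewrite !mxE.
Qed.

Lemma conf_mxK (v : 'I_n * 'I_d -> R) :
  conf_mx (fun i k => v (i, k)) = \matrix_(i, k) v (i, k).
Proof. by apply/matrixP => i k; rewrite !mxE. Qed.

Lemma sym_prod_mx_ker a (v : 'I_n * 'I_d -> R) :
  (forall y, \sum_j v j * sym_prod_mx (conf_mx a) j y = 0) ->
  forall e, \sum_j v j * bimeas_mx a j e = 0.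
Proof.
move=> /sym_prod_kerP; rewrite -conf_mxK => h0 e; rewrite bimeas_mxE.
have := bimeas_sym_prod a (fun i k => v (i, k)) e; rewrite h0.
rewrite big1 => [|p _]; last by rewrite big1// => q _; rewrite mxE mulr0.
by move/esym/eqP; rewrite mulf_eq0 pnatr_eq0 /= => /eqP.
Qed.

Hypothesis h_span :
  forall v : 'I_n -> R, (forall e, \sum_i h e i * v i = 0) -> forall i, v i = 0.
(** What the base framework contributes: the image of every differential lies in the image at the
    base, by [kernel_product], and at the base only rotations preserve the lengths to first order,
    by [glob_rigid_flat]. *)
Hypothesis base_tangent : forall a zeta, exists zeta', forall e, bm a zeta e = bm a0 zeta' e.
Hypothesis base_rigid : forall zeta, (forall e, bm a0 zeta e = 0) ->
  sym_prod (conf_mx a0) (conf_mx zeta) = 0.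

Lemma conf_base : conf_mx a0 = pid_mx d.
Proof. by apply/matrixP => i k; rewrite mxE. Qed.

Lemma bimeas_mx_sub a : (fmx (bimeas_mx a) <= fmx (bimeas_mx a0))%MS.
Proof.
apply/row_subP => i.
have [zeta hz] := base_tangent a (fun p k => (enum_val i == (p, k))%:R).
have -> : row i (fmx (bimeas_mx a)) = frow (bimeas_mx a (enum_val i)).
  by apply/rowP => j; rewrite !mxE.
apply/frow_submx; exists (fun y => zeta y.1 y.2) => e; rewrite bimeas_mxE -hz.
have <- := bimeas_mxE a (fun y => (enum_val i == y)%:R) e.
by rewrite sum_indic.
Qed.

Lemma rank_base_sym : \rank (fmx (bimeas_mx a0)) = \rank (fmx (sym_prod_mx (conf_mx a0))).
Proof.
apply/eqP; rewrite eqn_leq; apply/andP; split; apply: frank_ker_sub => v hv.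
  exact: sym_prod_mx_ker.
apply/sym_prod_kerP; rewrite -conf_mxK; apply: base_rigid => e.
by rewrite -bimeas_mxE.
Qed.

Lemma bimeas_der (D : R -> R) a b e : deriv D -> (forall i, D (h e i) = 0) ->
  D (bm a b e) = bm (fun i k => D (a i k)) b e + bm a (fun i k => D (b i k)) e.
Proof.
move=> dD Dh; have Dv c k : D (edge_vec h c e k) = edge_vec h (fun i k => D (c i k)) e k.
  rewrite (der_sum _ _ _ dD); apply: eq_bigr => i _.
  by rewrite (derM dD) Dh mul0r add0r.
rewrite (der_sum _ _ _ dD) -big_split/=; apply: eq_bigr => k _.
by rewrite (derM dD) !Dv.
Qed.

Lemma bimeas_sumr a (J : finType) (c : J -> R) (b : J -> conf) e :
  bm a (fun i k => \sum_j c j * b j i k) e = \sum_j c j * bm a (b j) e.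
Proof.
rewrite /bimeas; under [RHS]eq_bigr do rewrite mulr_sumr.
rewrite exchange_big /=; apply: eq_bigr => k _; rewrite /edge_vec mulr_sumr.
under eq_bigr do rewrite !mulr_sumr.
rewrite exchange_big/=.
apply: eq_bigr => j _; rewrite !mulr_sumr; apply: eq_bigr => i _; ring.
Qed.

(* A real configuration [a] at which the measurement map folds transversally
   along [xi], while [a] is generic on the fold. *)
Lemma generic_fold (Y : finType) (y : Y -> R) :
  exists a xi (D : 'I_n * 'I_d -> R -> R), [/\
    forall j, deriv (D j),
    forall j, (forall e i, D j (h e i) = 0) /\ forall l, D j (y l) = 0,
    forall e, bm a xi e = 0,
    sym_prod (conf_mx a) (conf_mx xi) != 0 &
    forall B : conf, exists (al : 'I_n * 'I_d -> R) (Z : 'M[R]_d) r, Z^T = - Z /\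
      forall i k, B i k = \sum_j al j * D j (a i k) + (conf_mx a *m Z) i k + r * xi i k].
Proof.
pose y1 (u : Y + E * 'I_n) := match u with inl j => y j | inr (e, i) => h e i end.
have [r [D [hD Dy]]] := exists_dual_derivs uncR ('I_n * 'I_d)%type y1.
have dD j : deriv (D j) by exact: hD.1.
have Dh j e i : D j (h e i) = 0 by exact: Dy j (inr (e, i)).
have Da0 (D' : R -> R) i k : deriv D' -> D' (a0 i k) = 0.
  by move=> dD'; rewrite /base_conf mxE (der_nat _ dD').
pose x : conf := fun i k => a0 i k + r (i, k).
have Dx j i k : D j (x i k) = (j == (i, k))%:R.
  by rewrite /x (derD (dD j)) (Da0 (D j))// add0r hD.2.
(* [x] specialises to [a0] under the Euler derivation in [r], so the differential at [x] has at
   least the rank of that at the base; with [base_tangent] the two images coincide. *)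
have rk_x : (\rank (fmx (bimeas_mx a0)) <= \rank (fmx (bimeas_mx x)))%N.
  have [D' [dD' D'r D'y]] := dual_derivs_dir r hD.
  have D'h e i : D' (h e i) = 0 by apply: D'y => j; exact: Dh.
  have -> : fmx (bimeas_mx x) = fmx (bimeas_mx a0) + fmx (bimeas_mx (fun i k => r (i, k))).
    apply/matrixP => i j; rewrite !mxE /bimeas_mx -mulrDl; congr (_ * _).
    by rewrite /edge_vec -big_split/=; apply: eq_bigr => l _; rewrite mulrDr.
  apply: (mxrank_spec dD') => i j; rewrite !mxE /bimeas_mx (derM dD') D'h mulr0 addr0.
    rewrite (der_sum _ _ _ dD') big1 ?mul0r// => l _.
    by rewrite (derM dD') D'h (Da0 D')// mul0r mulr0 addr0.
  congr (_ * _); rewrite (der_sum _ _ _ dD'); apply: eq_bigr => l _.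
  by rewrite (derM dD') D'h mul0r add0r D'r.
have sub_x : (fmx (bimeas_mx a0) <= fmx (bimeas_mx x))%MS.
  by rewrite -(geq_leqif (mxrank_leqif_sup (bimeas_mx_sub x))).
have through_x zeta : exists zeta', forall e, bm a0 zeta e = bm x zeta' e.
  have : (frow (bm a0 zeta) <= fmx (bimeas_mx x))%MS.
    apply: submx_trans sub_x; apply/frow_submx; exists (fun y => zeta y.1 y.2) => e.
    by rewrite bimeas_mxE.
  by move=> /frow_submx[c hc]; exists (fun i k => c (i, k)) => e; rewrite hc bimeas_mxE.
pose C e l := cokermx (fmx (bimeas_mx a0)) (enum_rank e) l.
have CE (phi : E -> R) : (forall l, \sum_e phi e * C e l = 0) <->
    (frow phi <= fmx (bimeas_mx a0))%MS.
  rewrite submxE; split=> [hc|/eqP/rowP hc l].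
    apply/eqP/rowP => l; rewrite [RHS]mxE -[RHS](hc l) mxE -[RHS]big_ord_enum_val.
    by apply: eq_bigr => i _; rewrite mxE /C enum_valK.
  have := hc l; rewrite [in X in _ = X -> _]mxE => h0.
  rewrite -[RHS]h0 mxE -[LHS]big_ord_enum_val.
  by apply: eq_bigr => i _; rewrite mxE /C enum_valK.
have bmC a zeta l : \sum_e bm a zeta e * C e l = 0.
  apply: (CE _).2; have [zeta' hz] := base_tangent a zeta.
  by apply/frow_submx; exists (fun y => zeta' y.1 y.2) => e; rewrite bimeas_mxE -hz.
have a0n : exists i k, a0 i k != 0.
  exists (Ordinal (ltn_trans d0 dn)), (Ordinal d0).
  by rewrite /base_conf mxE /= d0 oner_eq0.
have [tt [a [phi [tt0 ha [e0 phi0] phiC phi_crit]]]] := critical_point h_span bmC x a0n.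
pose c e := bm a0 a0 e + bm x x e.
have phi_sq : \sum_e phi e * phi e != 0.
  apply: contraNneq phi0 => s0; move/eqP: s0; under eq_bigr do rewrite -expr2.
  rewrite psumr_eq0 => [/allP/(_ e0)|e _]; last exact: sqr_ge0.
  by rewrite mem_index_enum sqrf_eq0; apply.
pose Da (al : 'I_n * 'I_d -> R) : conf := fun i k => \sum_j al j * D j (a i k).
(* Derive the length equations of [a] along the [D j]: the base lengths are constants, [x] moves
   arbitrarily, and the unknown derivatives of [tt] contribute only a multiple of [c]. *)
have key al : exists kap, forall e,
    tt * bm x (fun i k => al (i, k)) e = bm a (Da al) e + kap * c e.
  exists (- (\sum_j al j * D j tt) / 2) => e.
  have e1 j : 2 * bm a (fun i k => D j (a i k)) e =
      D j tt * c e + tt * (2 * bm x (fun i k => (j == (i, k))%:R) e).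
    have := congr1 (D j) (ha e); rewrite (derB _ _ (dD j)) (derM (dD j)) (derD (dD j)).
    have z1 : bm (fun i k => D j (a0 i k)) a0 e = 0.
      by rewrite /bimeas big1// => k _; rewrite /edge_vec big1 ?mul0r// => i _; rewrite Da0// mulr0.
    rewrite !(bimeas_der _ _ (dD j) (Dh j e)) z1 (bimeas_sym h a0) z1 addr0 subr0 add0r.
    rewrite (bimeas_sym h (fun i k => D j (a i k))) (bimeas_sym h (fun i k => D j (x i k))).
    have -> : bm x (fun i k => D j (x i k)) e = bm x (fun i k => (j == (i, k))%:R) e.
      by congr (bimeas _ _ _ _); apply/funext => i; apply/funext => k; rewrite Dx.
    by move=> e1; rewrite mulrDl mul1r e1 /c; ring.
  have e2 : bm x (fun i k => al (i, k)) e = \sum_j al j * bm x (fun i k => (j == (i, k))%:R) e.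
    rewrite -bimeas_sumr; congr (bimeas _ _ _ _); apply/funext => i; apply/funext => k.
    by rewrite -[LHS](sum_indic (i, k) al); apply: eq_bigr => j _; rewrite eq_sym mulrC.
  rewrite e2 bimeas_sumr !mulNr !mulr_suml mulr_sumr -sumrB.
  apply: eq_bigr => j _; have := e1 j; set u := bm a _ e; set w := bm x _ e => e3.
  have -> : u = (D j tt * c e + tt * (2 * w)) / 2 by rewrite -e3; field.
  by field.
have phi_mem : (frow phi <= fmx (bimeas_mx a0))%MS by exact/CE.
(* The segment is transverse to the fold: otherwise [phi], which lies in the image of the
   differential at [x], would be orthogonal to itself by [key]. *)
have phic : \sum_e phi e * c e != 0.
  have /frow_submx[z0 hz0] := submx_trans phi_mem sub_x.
  have [kap hk] := key z0.
  apply: contraNneq phi_sq => c0.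
  have : tt * \sum_e phi e * phi e = 0.
    transitivity (\sum_e phi e * (bm a (Da z0) e + kap * c e)).
      rewrite mulr_sumr; apply: eq_bigr => e _; rewrite -hk {2}hz0 bimeas_mxE; ring.
    under eq_bigr do rewrite mulrDr mulrCA.
    by rewrite big_split/= phi_crit -mulr_sumr c0 mulr0 addr0.
  by move/eqP; rewrite mulf_eq0 gt_eqF.
(* Pairing [key] with [phi] removes the multiple of [c]: up to the kernel of the differential at
   [a], every direction is a derivative of [a]. *)
have toD zeta : exists al, forall e, bm a zeta e = bm a (Da al) e.
  have [z1 h1] := base_tangent a zeta; have [z2 h2] := through_x z1.
  have [kap hk] := key (fun u => z2 u.1 u.2).
  have hk' e : tt * bm a zeta e = bm a (Da (fun u => z2 u.1 u.2)) e + kap * c e.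
    by rewrite h1 h2 hk.
  have kap0 : kap = 0.
    have : \sum_e phi e * (tt * bm a zeta e) = \sum_e phi e * (bm a (Da (fun u => z2 u.1 u.2)) e + kap * c e).
      by apply: eq_bigr => e _; rewrite hk'.
    under eq_bigr do rewrite mulrCA; under [X in _ = X]eq_bigr do rewrite mulrDr mulrCA.
    rewrite -mulr_sumr big_split/= -mulr_sumr !phi_crit mulr0 add0r => /esym/eqP.
    by rewrite mulf_eq0 (negPf phic) orbF => /eqP.
  exists (fun u => tt^-1 * z2 u.1 u.2) => e.
  have -> : bm a (Da (fun u => tt^-1 * z2 u.1 u.2)) e = tt^-1 * bm a (Da (fun u => z2 u.1 u.2)) e.
    rewrite !bimeas_sumr mulr_sumr; apply: eq_bigr => j _; ring.
  have := hk' e; rewrite kap0 mul0r addr0 => <-.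
  by rewrite mulKf// gt_eqF.
(* By [key] the image at [x] lies in the image at [a] plus the line of [c], so at most one dimension
   is lost; [phi] shows in [rk2] that one is. *)
have rk1 : (\rank (fmx (bimeas_mx a0)) <= (\rank (fmx (bimeas_mx a))).+1)%N.
  apply: leq_trans rk_x _.
  have : (fmx (bimeas_mx x) <= fmx (bimeas_mx a) + frow c)%MS.
    apply/row_subP => i; have [kap hk] := key (fun y => (enum_val i == y)%:R).
    have -> : row i (fmx (bimeas_mx x)) = tt^-1 *: frow (bm a (Da (fun y => (enum_val i == y)%:R))) + (tt^-1 * kap) *: frow c.
      apply/rowP => e; rewrite !mxE -mulrA -mulrDr -hk mulKf ?gt_eqF//.
      have <- := bimeas_mxE x (fun y => (enum_val i == y)%:R) (enum_val e).
      by rewrite sum_indic.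
    apply: addmx_sub; apply: scalemx_sub; last exact: addsmxSr.
    apply: submx_trans (addsmxSl _ _); apply/frow_submx.
    exists (fun u => Da (fun y => (enum_val i == y)%:R) u.1 u.2) => e.
    by rewrite bimeas_mxE.
  move=> /mxrankS/leq_trans; apply; apply: leq_trans (mxrank_adds_leqif _ _).1 _.
  by rewrite -[leqRHS]addn1 leq_add2l rank_leq_row.
have rk2 : (\rank (fmx (bimeas_mx a)) < \rank (fmx (bimeas_mx a0)))%N.
  apply: rank_ltmx; rewrite ltmxE bimeas_mx_sub /=; apply: contra phi_sq => sub.
  have /frow_submx[z hz] := submx_trans phi_mem sub.
  apply/eqP; transitivity (\sum_e phi e * bm a (fun i k => z (i, k)) e).
    apply: eq_bigr => e _.
    by rewrite {2}hz bimeas_mxE.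
  exact: phi_crit.
have rkS : (\rank (fmx (bimeas_mx a)) <= \rank (fmx (sym_prod_mx (conf_mx a))))%N.
  by apply: frank_ker_sub => v; exact: sym_prod_mx_ker.
(* Rank below [d] would cost two dimensions by [rank_sym_prod_deficient], and [rk1] allows only
   one. *)
have rka : \rank (conf_mx a) = d.
  apply/eqP; rewrite eqn_leq rank_leq_col /= leqNgt; apply/negP => /(rank_sym_prod_deficient dn).
  rewrite -conf_base -rank_base_sym addn2 => lt.
  have := leq_trans lt rk1; rewrite ltnS => lt2.
  by have := leq_trans lt2 rkS; rewrite ltnn.
have rkSa : \rank (fmx (sym_prod_mx (conf_mx a))) = \rank (fmx (bimeas_mx a0)).
  by rewrite (rank_sym_prod_full rka) -conf_base -rank_base_sym.
(* The kernel at [a] is one dimension larger than the space of infinitesimal rotations; [xi] spans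
   the rest. *)
have [xi [xi1 xi2]] : exists xi : 'I_n * 'I_d -> R, (forall e, \sum_j xi j * bimeas_mx a j e = 0) /\
    ~ (forall y, \sum_j xi j * sym_prod_mx (conf_mx a) j y = 0).
  apply: contrapT => none; move: rk2; rewrite -rkSa ltnNge => /negP; apply.
  apply: frank_ker_sub => v hv; apply: contrapT => nv; apply: none; by exists v.
have ker_a v : (forall e, \sum_j v j * bimeas_mx a j e = 0) -> exists r, forall y,
    \sum_j (v j - r * xi j) * sym_prod_mx (conf_mx a) j y = 0.
  move=> hv; apply: (@fker_add1 _ _ _ _ (sym_prod_mx (conf_mx a)) (bimeas_mx a) xi) => //.
    by move=> v'; exact: sym_prod_mx_ker.
  by rewrite rkSa.
exists a, (fun i k => xi (i, k)), D; split=> //.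
- by move=> j; split=> [e i|j']; [exact: Dh|exact: (Dy j (inl j'))].
- by move=> e; rewrite -bimeas_mxE.
- by apply/eqP => s0; apply: xi2; apply/sym_prod_kerP; rewrite -conf_mxK.
- move=> B; have [al hal] := toD B.
  have [|r' /sym_prod_kerP hr] := ker_a (fun u => B u.1 u.2 - Da al u.1 u.2).
    move=> e; rewrite bimeas_mxE.
    have -> : (fun i k => B (i, k).1 (i, k).2 - Da al (i, k).1 (i, k).2) =
        (fun i k => B i k + -1 * Da al i k).
      by apply/funext => i; apply/funext => k; rewrite mulN1r.
    by rewrite bimeas_lin hal mulN1r subrr.
  have [Z [Zt hZ]] := sym_prod_ker_full rka hr.
  exists al, Z, r'; split=> // i k.
  have := congr1 (fun M : 'M_(n, d) => M i k) hZ; rewrite [LHS]mxE /= => <-.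
  by rewrite /Da; ring.
Qed.

End Folding.

(** * Two configurations facing each other across a fold, one of them generic *)

Section MirrorPair.
Variables (R : realType) (n d : nat) (E : finType) (h : E -> 'I_n -> R).
Hypotheses (uncR : ~ countable [set: R]) (d0 : (0 < d)%N) (dn : (d < n)%N).
Local Notation conf := ('I_n -> 'I_d -> R).
Local Notation bm := (bimeas h).
Local Notation a0 := (@base_conf R n d).
Local Notation nd := ('I_n * 'I_d)%type.
Implicit Types (a b zeta xi x : conf) (e : E).

Hypothesis h_span :
  forall v : 'I_n -> R, (forall e, \sum_i h e i * v i = 0) -> forall i, v i = 0.
Hypothesis base_tangent : forall a zeta, exists zeta', forall e, bm a zeta e = bm a0 zeta' e.
Hypothesis base_rigid : forall zeta, (forall e, bm a0 zeta e = 0) ->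
  sym_prod (conf_mx a0) (conf_mx zeta) = 0.

Lemma bimeas_mxmul (A : 'M[R]_(n, d)) (g : 'M[R]_d) e : g *m g^T = 1%:M ->
  bm (fun i k => (A *m g) i k) (fun i k => (A *m g) i k) e =
  bm (fun i k => A i k) (fun i k => A i k) e.
Proof.
move=> gg; pose hv : 'rV[R]_n := \row_i h e i.
have bE (B : 'M[R]_(n, d)) : bm (fun i k => B i k) (fun i k => B i k) e =
    ((hv *m B) *m (hv *m B)^T) 0 0.
  rewrite mxE; apply: eq_bigr => k _; rewrite !mxE /edge_vec.
  by congr (_ * _); apply: eq_bigr => i _; rewrite !mxE.
rewrite !bE mulmxA trmx_mul mulmxA -[_ *m g *m g^T]mulmxA gg.
by rewrite mulmx1.
Qed.

Definition skew_unit_mx (p q : 'I_d) : 'M[R]_d := delta_mx p q - delta_mx q p.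

Lemma skew_decomp (Z : 'M[R]_d) : Z^T = - Z ->
  Z = \sum_(u : 'I_d * 'I_d) (Z u.1 u.2 / 2) *: skew_unit_mx u.1 u.2.
Proof.
move=> sZ; have ZE (i j : 'I_d) : Z i j = - Z j i.
  by have /matrixP/(_ j i) := sZ; rewrite !mxE.
rewrite /skew_unit_mx; under eq_bigr do rewrite scalerBr.
rewrite sumrB.
have e1 : \sum_(u : 'I_d * 'I_d) (Z u.1 u.2 / 2) *: delta_mx u.1 u.2 = 2^-1 *: Z.
  rewrite (sum_pair (fun i j => (Z i j / 2) *: (delta_mx i j : 'M_d))).
  rewrite {2}(matrix_sum_delta Z) scaler_sumr; apply: eq_bigr => i _.
  by rewrite scaler_sumr; apply: eq_bigr => j _; rewrite scalerA mulrC.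
have e2 : \sum_(u : 'I_d * 'I_d) (Z u.1 u.2 / 2) *: delta_mx u.2 u.1 = 2^-1 *: Z^T.
  rewrite (sum_pair (fun i j => (Z i j / 2) *: (delta_mx j i : 'M_d))) exchange_big /=.
  rewrite [in RHS](matrix_sum_delta Z^T) scaler_sumr; apply: eq_bigr => i _.
  by rewrite scaler_sumr; apply: eq_bigr => j _; rewrite scalerA mulrC mxE.
rewrite e1 e2 sZ scalerN opprK -scalerDl.
have -> : 2^-1 + 2^-1 = 1 :> R by field.
by rewrite scale1r.
Qed.

Lemma half_skew (W : 'M[R]_d) : W^T = - W -> 2^-1 *: W - (2^-1 *: W)^T = W.
Proof.
move=> sW; rewrite linearZ /= sW scalerN opprK -scalerDl.
have -> : 2^-1 + 2^-1 = 1 :> R by field.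
by rewrite scale1r.
Qed.

Lemma skew_unit_mx_der (D : R -> R) p q : deriv D -> map_mx D (skew_unit_mx p q) = 0.
Proof.
by move=> dD; apply/matrixP => i j; rewrite !mxE (derB _ _ dD) !(der_nat _ dD) subrr.
Qed.

(** The pair is [(a + s xi) g] and [(a - s xi) g]: the lengths agree because [bimeas a xi] vanishes,
    and the Gram matrices differ because [sym_prod a xi] does not. The new transcendental [s] moves
    along [xi] and the generic rotation [g] along the rotations, the directions that derivatives of
    [a] alone may miss. *)
Lemma generic_mirror_pair (Y : finType) (y : Y -> R) :
  exists P Q : 'M[R]_(n, d), [/\
    forall e, bm (fun i k => P i k) (fun i k => P i k) e =
              bm (fun i k => Q i k) (fun i k => Q i k) e,
    P *m P^T != Q *m Q^T &
    forall B : 'M[R]_(n, d), exists D, [/\ deriv D, forall e i, D (h e i) = 0,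
      forall l, D (y l) = 0 & map_mx D P = B]].
Proof.
have [a [xi [D [dD Dc axi symax span]]]] :=
  generic_fold uncR d0 dn h_span base_tangent base_rigid y.
pose A : 'M[R]_(n, d) := conf_mx a; pose Xi : 'M[R]_(n, d) := conf_mx xi.
(* First derivatives of [a] and [xi] are included so that they count as constants for the scaling in
   [s] used on the matrix of derivatives of [P0]. *)
pose y2 (u : E * 'I_n + Y + nd + nd + nd * nd + nd * nd) := match u with
  | inl (inl (inl (inl (inl (e, i))))) => h e i
  | inl (inl (inl (inl (inr l)))) => y l
  | inl (inl (inl (inr (i, k)))) => a i k
  | inl (inl (inr (i, k))) => xi i k
  | inl (inr (j, (i, k))) => D j (a i k)
  | inr (j, (i, k)) => D j (xi i k) end.
have [c [d2 [hd dy]]] := exists_dual_derivs uncR (option ('I_d * 'I_d)) y2.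
have dd o : deriv (d2 o) by exact: hd.1.
have dh o e i : d2 o (h e i) = 0 by exact: (dy o (inl (inl (inl (inl (inl (e, i))))))).
have dyl o l : d2 o (y l) = 0 by exact: (dy o (inl (inl (inl (inl (inr l)))))).
have da o i k : d2 o (a i k) = 0 by exact: (dy o (inl (inl (inl (inr (i, k)))))).
have dxi o i k : d2 o (xi i k) = 0 by exact: (dy o (inl (inl (inr (i, k))))).
have dDa o j i k : d2 o (D j (a i k)) = 0 by exact: (dy o (inl (inr (j, (i, k))))).
have dDxi o j i k : d2 o (D j (xi i k)) = 0 by exact: (dy o (inr (j, (i, k)))).
pose s := c None; pose ds := d2 None.
have dds : deriv ds by exact: dd.
have dsa i k : ds (a i k) = 0 by exact: da.
have dsxi i k : ds (xi i k) = 0 by exact: dxi.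
have dsDa j i k : ds (D j (a i k)) = 0 by exact: dDa.
have dsDxi j i k : ds (D j (xi i k)) = 0 by exact: dDxi.
have dss : ds s = 1 by rewrite /ds /s hd.2 eqxx.
have s0 : s != 0.
  by apply/eqP => s0; move: dss; rewrite s0 (der0 dds) => /eqP; rewrite eq_sym oner_eq0.
pose T : 'M[R]_d := \matrix_(p, q) c (Some (p, q)).
pose X := T - T^T.
have sX : X^T = - X by rewrite /X raddfB /= trmxK opprB.
pose g := cayley X.
have gg : g *m g^T = 1%:M by exact: cayley_orth.
have gg' : g^T *m g = 1%:M by exact: mulmx1C.
pose P0 := A + s *: Xi; pose Q0 := A - s *: Xi.
pose sk := skew_unit_mx.
(* The rows are the derivatives along the [D j], the rotations and the derivative along [s]. [M0] is
   the part at [s = 0], of full rank by [generic_fold], and [M1] the part linear in [s]. *)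
pose M0 (u : nd + 'I_d * 'I_d + unit) (z : nd) : R := match u with
  | inl (inl j) => D j (a z.1 z.2)
  | inl (inr u) => (A *m sk u.1 u.2) z.1 z.2
  | inr _ => xi z.1 z.2 end.
pose M1 (u : nd + 'I_d * 'I_d + unit) (z : nd) : R := match u with
  | inl (inl j) => s * D j (xi z.1 z.2)
  | inl (inr u) => s * (Xi *m sk u.1 u.2) z.1 z.2
  | inr _ => 0 end.
have full0 : row_full (fmx M0).
  rewrite -sub1mx; apply/row_subP => z0; rewrite -(fantiK (row z0 _)).
  set B := fanti _; have [al [Z [r [sZ hB]]]] := span (fun i k => B (i, k)).
  apply/frow_submx.
  exists (fun u => match u with inl (inl j) => al j | inl (inr u) => Z u.1 u.2 / 2 | inr _ => r end).
  move=> [i k]; rewrite (hB i k) !big_sumType /= (bigD1 tt)//= [X in r * _ + X]big1 ?addr0; last by case.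
  congr (_ + _ + _); rewrite {1}(skew_decomp sZ) mulmx_sumr summxE.
  by apply: eq_bigr => u _; rewrite -scalemxAr mxE.
have dsA : map_mx ds A = 0 by apply/matrixP => i k; rewrite !mxE dsa.
have dsXi : map_mx ds Xi = 0 by apply/matrixP => i k; rewrite !mxE dsxi.
have dsk (Mx : 'M[R]_(n, d)) u : map_mx ds Mx = 0 -> forall i k, ds ((Mx *m sk u.1 u.2) i k) = 0.
  move=> h0 i k; have := der_mulmx Mx (sk u.1 u.2) dds.
  rewrite -/ds h0 mul0mx add0r (skew_unit_mx_der _ _ dds) mulmx0.
  by move/matrixP/(_ i k); rewrite [LHS]mxE [RHS]mxE.
have full : row_full (fmx (fun u z => M0 u z + M1 u z)).
  rewrite /row_full eqn_leq rank_leq_col /=.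
  have := full0; rewrite /row_full => /eqP {1}<-.
  have -> : fmx (fun u z => M0 u z + M1 u z) = fmx M0 + fmx M1.
    by apply/matrixP => i j; rewrite !mxE.
  have dS : deriv (fun x : R => s * ds x) by apply: deriv_scale; exact: dd.
  apply: (mxrank_spec dS) => i j; rewrite [fmx _ _ _]mxE.
    by case: (enum_val i) => [[u|u]|u] /=; rewrite ?dsDa ?dsk ?dsxi ?mulr0.
  case: (enum_val i) => [[u|u]|u] /=; last by rewrite (der0 dds) mulr0.
    by rewrite (derM dds) dss dsDxi mulr0 addr0 mul1r.
  by rewrite (derM dds) dss dsk// mulr0 addr0 mul1r.
exists (P0 *m g), (Q0 *m g); split.
- move=> e; rewrite !bimeas_mxmul//.
  have PE : (fun i k => P0 i k) = (fun i k => a i k + s * xi i k).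
    by apply/funext => i; apply/funext => k; rewrite !mxE.
  have QE : (fun i k => Q0 i k) = (fun i k => a i k + - s * xi i k).
    by apply/funext => i; apply/funext => k; rewrite !mxE mulNr.
  by rewrite PE QE !bimeas_sqr axi sqrrN !mulr0.
- apply: contra symax => /eqP e.
  have e1 : P0 *m P0^T = Q0 *m Q0^T.
    have BB (B : 'M[R]_(n, d)) : (B *m g) *m (B *m g)^T = B *m B^T.
      by rewrite trmx_mul -mulmxA (mulmxA g) gg mul1mx.
    by rewrite -(BB P0) -(BB Q0).
  have : (4 * s) *: sym_prod A Xi = 0.
    have -> : (4 * s) *: sym_prod A Xi = 2 *: (P0 *m P0^T - Q0 *m Q0^T).
      have tP : P0^T = A^T + s *: Xi^T by rewrite /P0 raddfD /= linearZ.
      have tQ : Q0^T = A^T - s *: Xi^T by rewrite /Q0 raddfB /= linearZ.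
      rewrite tP tQ /P0 /Q0 /sym_prod.
      rewrite !mulmxDl !mulmxDr !mulmxN !mulNmx -!scalemxAl -!scalemxAr.
      by apply/matrixP => i j; rewrite !mxE; ring.
    by rewrite e1 subrr scaler0.
  move/eqP; rewrite scaler_eq0 mulf_eq0 pnatr_eq0 (negPf s0) /=.
  by [].
- move=> B.
  pose B' := B *m g^T.
  have /frow_submx[co hco] : (frow (fun z : nd => B' z.1 z.2) <= fmx (fun u z => (M0 u z + M1 u z)%R))%MS.
    by apply: submx_full.
  pose al j := co (inl (inl j)); pose ga := co (inr tt).
  pose Z := \sum_u co (inl (inr u)) *: sk u.1 u.2.
  have sZ : Z^T = - Z.
    rewrite /Z raddf_sum /= -sumrN; apply: eq_bigr => u _.
    rewrite linearZ /= /sk /skew_unit_mx raddfB /= !trmx_delta -scalerN.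
    by rewrite opprB.
  have B'E i k : B' i k = \sum_j al j * (D j (a i k) + s * D j (xi i k)) +
      (P0 *m Z) i k + ga * xi i k.
    have := hco (i, k); rewrite /= => ->; rewrite !big_sumType /=.
    rewrite [X in _ + X](bigD1 tt)//= [X in _ + (_ + X)]big1 ?addr0; last by case.
    congr (_ + _ + _); rewrite /Z mulmx_sumr summxE; apply: eq_bigr => u _.
    rewrite -scalemxAr [RHS]mxE; congr (_ * _).
    by rewrite /P0 mulmxDl -scalemxAl [RHS]mxE [X in _ = _ + X]mxE.
  (* The derivative of [X] for which, by [cayley_der], the rotation [g] moves by [Z *m g]. *)
  pose W : 'M[R]_d := 2^-1 *: ((1%:M - X) *m Z *m (1%:M + X)).
  have sW : W^T = - W.
    have t1 : (1%:M + X)^T = 1%:M - X by rewrite raddfD /= trmx1 sX.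
    have t2 : (1%:M - X)^T = 1%:M + X by rewrite raddfB /= trmx1 sX opprK.
    by rewrite /W linearZ /= !trmx_mul t1 t2 sZ mulNmx mulmxN scalerN mulmxA.
  have dD0 : deriv (fun z => \sum_j al j * D j z) by apply: deriv_lin.
  (* As [X = T - T^T], moving [T] by half of the skew matrix [W] moves [X] by [W]. *)
  have [D' [dD' D'c D'z]] := deriv_adjust
    (fun o => if o is Some u then W u.1 u.2 / 2 else ga) hd dD0.
  have D'A i k : D' (a i k) = \sum_j al j * D j (a i k) by apply: D'z => o; exact: da.
  have D'Xi i k : D' (xi i k) = \sum_j al j * D j (xi i k) by apply: D'z => o; exact: dxi.
  exists D'; split=> //.
  + move=> e i; rewrite D'z; last by move=> o; exact: dh.
    by rewrite big1// => j _; rewrite (Dc j).1 mulr0.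
  + move=> l; rewrite D'z; last by move=> o; exact: dyl.
    by rewrite big1// => j _; rewrite (Dc j).2 mulr0.
  have DX : map_mx D' X = W.
    rewrite /X (der_addmx _ _ dD') (der_oppmx _ dD') -map_trmx.
    have -> : map_mx D' T = 2^-1 *: W.
      by apply/matrixP => p q; rewrite !mxE (D'c (Some (p, q))) /= !mxE mulrC.
    exact: half_skew.
  have Dg : map_mx D' g = Z *m g by exact: cayley_der.
  rewrite (der_mulmx _ _ dD') Dg (mulmxA P0 Z g) -mulmxDl.
  have -> : map_mx D' P0 + P0 *m Z = B'.
    apply/matrixP => i k; rewrite B'E mxE addrAC; congr (_ + _).
    rewrite /P0 !mxE (derD dD') (derM dD') (D'c None) /= D'A D'Xi.
    rewrite addrA addrAC; congr (_ + _).
    by rewrite mulr_sumr -big_split/=; apply: eq_bigr => j _; ring.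
  by rewrite /B' -mulmxA gg' mulmx1.
Qed.

End MirrorPair.

(** * Real global rigidity makes the stress kernel affine *)

Section RealKernel.
Variables (R : realType) (V E : finType) (s t : E -> V) (d : nat).
Hypotheses (uncR : ~ countable [set: R]) (d0 : (0 < d)%N) (dV : (d < #|V|)%N).
Local Notation dG := (dl s t).
Local Notation stress_kernel := (stress_kernel s t).
Implicit Types (p q xi P : V -> 'I_d -> R).

Hypothesis gr : @generic_glob_rigid R V E s t 'I_d.

Lemma generic_coord_inj p u v k : conf_generic p -> p u k = p v k -> u = v.
Proof.
move=> [D [dD hD]] e; apply/eqP; apply: contraT => uv.
have := hD (u, k) (v, k); rewrite /= -e.
rewrite (hD (u, k) (u, k)) eqxx xpair_eqE (negPf uv) /= => /eqP.
by rewrite oner_eq0.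
Qed.

(** A function constant along edges, placed in one coordinate, is an infinitesimal motion. By
    [glob_rigid_flat] it preserves all distances to first order, which is impossible if it separates
    two vertices, whose [k0] coordinates differ. *)
Lemma glob_rigid_connected p (f : V -> R) : conf_generic p ->
  (forall e, dG f e = 0) -> forall u v, f u = f v.
Proof.
move=> gp fe u v; have [->//|uv] := eqVneq u v.
pose k0 := Ordinal d0.
have hm : inf_motion s t p (fun w k => (k == k0)%:R * f w).
  by move=> e; apply: big1 => k _; rewrite dlZ fe !mulr0.
have := glob_rigid_flat uncR gr gp hm u v.
rewrite (bigD1 k0)//= big1 => [|k kk0]; last by rewrite (negPf kk0) !mul0r subrr mulr0.
rewrite ?eqxx !mul1r addr0 => /eqP; rewrite mulf_eq0 !subr_eq0.
have -> : (p u k0 == p v k0) = false.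
  by apply: contraNF uv => /eqP /(generic_coord_inj gp) ->.
by move=> /eqP.
Qed.

Lemma glob_rigid_kernel p z : conf_generic p -> stress_kernel p z -> affine p z.
Proof.
move=> gp Kz; apply: contrapT => nz.
have ip : aff_indep p by apply: generic_aff_indep; rewrite ?card_ord.
have [J [zj [Kj ij sj]]] := basis_extension ip (K := stress_kernel p)
  (fun k => @stress_kernel_self _ _ _ s t _ p k).
pose m := #|J|; pose n := (d + m)%N.
(* [z] is not affine in [p], so the basis has members beyond [p]; this yields the strict inequality
   [d < n] on which folding rests. *)
have m0 : (0 < m)%N.
  rewrite lt0n; apply/eqP => J0; apply: nz; have [a [c hz]] := sj z Kz.
  exists (fun k => a (inl k)), c => v; rewrite hz big_sumType /=.
  rewrite [X in _ + X + _]big1 ?addr0// => j _.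
  by have := fintype0 j; rewrite -/m J0.
have dn : (d < n)%N by rewrite /n -[ltnLHS]addn0 ltn_add2l.
pose Zb v (i : 'I_n) := match split i with inl k => p v k | inr j => zj v (enum_val j) end.
have sumZ (f : 'I_n -> R) v : \sum_i f i * Zb v i =
    \sum_k f (lshift m k) * p v k + \sum_j f (rshift d (enum_rank j)) * zj v j.
  rewrite big_split_ord /=; congr (_ + _).
    by apply: eq_bigr => k _; rewrite /Zb; case: split_ordP => [k' /lshift_inj ->|j /eqP]; rewrite ?eq_lrshift.
  rewrite [RHS]big_enum_val /=; apply: eq_bigr => j _; rewrite enum_valK.
  by rewrite /Zb; case: split_ordP => [k' /eqP|j' /rshift_inj ->]; rewrite ?eq_rlshift.
have iZ : aff_indep Zb.
  move=> a c h i.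
  have := ij (fun x => match x with inl k => a (lshift m k) | inr j => a (rshift d (enum_rank j)) end) c.
  have h' v : \sum_k (match k with inl k => a (lshift m k) | inr j => a (rshift d (enum_rank j)) end) *
      (match k with inl k => p v k | inr j => zj v j end) + c = 0.
    by rewrite big_sumType /= -sumZ h.
  move=> /(_ h') h2; case: (split_ordP i) => [k ->|j ->]; first exact: (h2 (inl k)).
  by have := h2 (inr (enum_val j)); rewrite enum_valK.
have KZ i : stress_kernel p (Zb^~ i).
  rewrite /Zb; case: (split i) => [k|j]; first exact: stress_kernel_self.
  exact: Kj.
have sZ y : stress_kernel p y -> affine Zb y.
  move=> /sj[a [c hy]].
  exists (fun i => match split i with inl k => a (inl k) | inr j => a (inr (enum_val j)) end), c => v.
  rewrite hy sumZ big_sumType /=; congr (_ + _ + _).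
    by apply: eq_bigr => k _; case: split_ordP => [k' /lshift_inj ->//|j /eqP]; rewrite eq_lrshift.
  apply: eq_bigr => j _; case: split_ordP => [k' /eqP|j' /rshift_inj <-]; first by rewrite eq_rlshift.
  by rewrite enum_rankK.
pose h e i := dG (Zb^~ i) e.
pose cf (a : 'I_n -> 'I_d -> R) v k := \sum_i a i k * Zb v i.
have evE a e k : edge_vec h a e k = dG (cf a ^~ k) e.
  by rewrite /cf dl_sum; apply: eq_bigr => i _; rewrite dlZ mulrC.
have cf0 : cf (@base_conf R n d) = p.
  apply/funext => v; apply/funext => k; rewrite /cf sumZ [X in _ + X]big1 ?addr0 => [|j _].
    rewrite -(sum_indic k (p v)); apply: eq_bigr => l _; congr (_ * _).
    by rewrite /base_conf mxE /= ltn_ord andbT eq_sym.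
  by rewrite /base_conf mxE /= ltnNge leq_addr andbF mul0r.
have Kcf a k : stress_kernel p (cf a ^~ k).
  apply: (stress_kernel_lin KZ); by exists (a^~ k), 0 => v; rewrite addr0.
(* A combination of the [Zb] that is constant along edges is constant by connectedness, hence
   trivial by affine independence. *)
have h_span : forall v : 'I_n -> R, (forall e, \sum_i h e i * v i = 0) -> forall i, v i = 0.
  move=> v hv; pose f w := \sum_i v i * Zb w i.
  have fc : forall u w, f u = f w.
    apply: (glob_rigid_connected gp) => e; rewrite /f dl_sum -[RHS](hv e).
    by apply: eq_bigr => i _; rewrite dlZ mulrC.
  have /card_gt0P[u0 _] : (0 < #|V|)%N by apply: leq_ltn_trans dV.
  by apply: (iZ v (- f u0)) => w; rewrite -/(f w) (fc w u0) subrr.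
have base_tangent : forall a zeta : 'I_n -> 'I_d -> R, exists zeta', forall e,
    bimeas h a zeta e = bimeas h (@base_conf R n d) zeta' e.
  move=> a zeta.
  have /choice[xi hxi] : forall k, exists xi : V -> 'I_d -> R, (forall l, stress_kernel p (xi^~ l)) /\
      forall e, dG (cf a ^~ k) e * dG (cf zeta ^~ k) e = \sum_l dG (p^~ l) e * dG (xi^~ l) e.
    by move=> k; apply: kernel_product.
  have /choice[c hc] : forall kl : 'I_d * 'I_d, exists c, exists t0, forall v,
      xi kl.1 v kl.2 = \sum_i c i * Zb v i + t0.
    by move=> kl; have [c [t0 hc]] := sZ _ ((hxi kl.1).1 kl.2); exists c, t0.
  exists (fun i l => \sum_k c (k, l) i) => e.
  rewrite /bimeas; under eq_bigr do rewrite !evE (hxi _).2.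
  rewrite exchange_big /=; apply: eq_bigr => l _.
  rewrite -mulr_sumr !evE cf0; congr (_ * _).
  have -> : dG (cf (fun i l0 => \sum_k c (k, l0) i) ^~ l) e =
      dG (fun v => \sum_k \sum_i c (k, l) i * Zb v i) e.
    apply: eq_dl => v; rewrite /cf exchange_big /=; apply: eq_bigr => i _.
    by rewrite mulr_suml.
  rewrite dl_sum; apply: eq_bigr => k _; have [t0 ht] := hc (k, l).
  rewrite (eq_dl s t e (g := fun v => \sum_i c (k, l) i * Zb v i + t0)) => [|v]; last exact: ht.
  by rewrite dlD dl_cst addr0.
have form u v (a b : 'I_n -> 'I_d -> R) : \sum_k (cf a u k - cf a v k) * (cf b u k - cf b v k) =
    \sum_i \sum_j (\sum_k a i k * b j k) * ((Zb u i - Zb v i) * (Zb u j - Zb v j)).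
  have cfB (c : 'I_n -> 'I_d -> R) k : cf c u k - cf c v k = \sum_i c i k * (Zb u i - Zb v i).
    by rewrite /cf -sumrB; apply: eq_bigr => i _; rewrite mulrBr.
  under eq_bigr do rewrite !cfB mulr_suml.
  rewrite exchange_big /=; apply: eq_bigr => i _.
  under eq_bigr do rewrite mulr_sumr.
  rewrite exchange_big /=; apply: eq_bigr => j _.
  by rewrite mulr_suml; apply: eq_bigr => k _; ring.
have base_rigid : forall zeta, (forall e, bimeas h (@base_conf R n d) zeta e = 0) ->
    sym_prod (conf_mx (@base_conf R n d)) (conf_mx zeta) = 0.
  move=> zeta hz.
  have flat : forall u v, \sum_k (p u k - p v k) * (cf zeta u k - cf zeta v k) = 0.
    apply: (glob_rigid_flat uncR gr gp) => e; rewrite -[RHS](hz e) /bimeas.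
    by apply: eq_bigr => k _; rewrite !evE cf0.
  apply/matrixP => i j; rewrite mxE [RHS]mxE.
  have hf : forall u v, \sum_i \sum_j (\sum_k @base_conf R n d i k * zeta j k) *
      ((Zb u i - Zb v i) * (Zb u j - Zb v j)) = 0.
    by move=> u v; rewrite -form cf0 flat.
  rewrite -[RHS](form_eq0 iZ hf i j); congr (_ + _); rewrite mxE;
    by apply: eq_bigr => k _; rewrite !mxE ?[_ * zeta _ _]mulrC.
pose y (x : V * 'I_d + V * 'I_n) := match x with inl (v, k) => p v k | inr (v, i) => Zb v i end.
have [P [Q [PQlen PQ hitsP]]] := generic_mirror_pair uncR d0 dn h_span base_tangent base_rigid y.
pose y' (x : V * 'I_d + V * 'I_n + 'I_n * 'I_d) := match x with
  | inl x => y x | inr (i, k) => P i k end.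
(* The [Zb] span the kernel only together with the constants; a transcendental translation [tau]
   supplies the constant directions. *)
have [tau [dt [hdt dty]]] := exists_dual_derivs uncR 'I_d y'.
pose PP v k := cf (fun i k => P i k) v k + tau k.
pose QQ v k := cf (fun i k => Q i k) v k + tau k.
have KPP k : stress_kernel p (PP^~ k).
  by apply: (stress_kernel_lin KZ); exists (fun i => P i k), (tau k) => v.
have hits kap : (forall k, stress_kernel p (kap^~ k)) ->
    exists D, [/\ deriv D, forall v k, D (PP v k) = kap v k & forall v k, D (p v k) = 0].
  move=> Kk; have /choice[c hc] : forall k, exists c : ('I_n -> R) * R, forall v,
      kap v k = \sum_i c.1 i * Zb v i + c.2.
    by move=> k; have [a [t0 ha]] := sZ _ (Kk k); exists (a, t0).
  have [D [dD Dh Dy DP]] := hitsP (\matrix_(i, k) (c k).1 i).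
  have [D' [dD' D't D'z]] := deriv_adjust (fun k => (c k).2) hdt dD.
  have D'Z v i : D' (Zb v i) = 0.
    rewrite D'z => [|k]; first exact: (Dy (inr (v, i))).
    exact: (dty k (inl (inr (v, i)))).
  have D'P i k : D' (P i k) = (c k).1 i.
    rewrite D'z => [|k']; last exact: (dty k' (inr (i, k))).
    by have /matrixP/(_ i k) := DP; rewrite !mxE.
  exists D'; split=> // v k.
    rewrite /PP (derD dD') D't hc (der_sum _ _ _ dD'); congr (_ + _).
    by apply: eq_bigr => i _; rewrite (derM dD') D'P D'Z mulr0 addr0.
  rewrite D'z => [|k']; first exact: (Dy (inl (v, k))).
  exact: (dty k' (inl (inl (v, k)))).
have gPP : conf_generic PP.
  apply: (generic_in_kernel gp KPP).
    by move=> kap /hits[D [dD DPP _]]; exists D.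
  (* The direction [PP - p], with [p] fixed, gives the Euler derivation from which [stress_spec]
     concludes that [PP] has no stresses besides those of [p]. *)
  have [k|D [dD DPP Dp]] := hits (fun v k => PP v k - p v k).
    apply: (stress_kernel_lin KZ); have [a [t0 ha]] := sZ _ (@stress_kernel_self _ _ _ s t _ p k).
    exists (fun i => P i k - a i), (tau k - t0) => v; rewrite ha /PP /cf.
    have -> : \sum_i (P i k - a i) * Zb v i = \sum_i P i k * Zb v i - \sum_i a i * Zb v i.
      by rewrite -sumrB; apply: eq_bigr => i _; rewrite mulrBl.
    by ring.
  apply: (stress_spec dD Dp DPP) => w pw k; exact: KPP.
have lenE e : \sum_k dG (PP^~ k) e ^+ 2 = \sum_k dG (QQ^~ k) e ^+ 2.
  have lE (A : 'M[R]_(n, d)) : \sum_k dG (fun v => cf (fun i k => A i k) v k + tau k) e ^+ 2 =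
      bimeas h (fun i k => A i k) (fun i k => A i k) e.
    by apply: eq_bigr => k _; rewrite dlD dl_cst addr0 evE expr2.
  by rewrite /PP /QQ !lE.
have full := gr gPP lenE.
(* Equal distances between all pairs of vertices make the quadratic forms of [P *m P^T] and
   [Q *m Q^T] agree on all differences of [Zb], so the two matrices are equal. *)
move/eqP: PQ; apply.
pose G (i j : 'I_n) := (P *m P^T) i j - (Q *m Q^T) i j.
have GE (A : 'M[R]_(n, d)) i j : (A *m A^T) i j = \sum_k A i k * A j k.
  by rewrite mxE; apply: eq_bigr => k _; rewrite mxE.
have hG : forall u v, \sum_i \sum_j G i j * ((Zb u i - Zb v i) * (Zb u j - Zb v j)) = 0.
  move=> u v; under eq_bigr do under eq_bigr do rewrite /G !GE mulrBl.
  under eq_bigr do rewrite sumrB.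
  rewrite sumrB -!(form u v); apply/eqP; rewrite subr_eq0; apply/eqP.
  have := full u v; have sq (A : 'M[R]_(n, d)) : \sum_k (cf (fun i k => A i k) u k + tau k -
      (cf (fun i k => A i k) v k + tau k)) ^+ 2 =
    \sum_k (cf (fun i k => A i k) u k - cf (fun i k => A i k) v k) *
      (cf (fun i k => A i k) u k - cf (fun i k => A i k) v k).
    by apply: eq_bigr => k _; ring.
  by rewrite /PP /QQ !sq.
apply/matrixP => i j; have := form_eq0 iZ hG i j.
have symG (A : 'M[R]_(n, d)) : (A *m A^T) j i = (A *m A^T) i j.
  by rewrite !GE; apply: eq_bigr => k _; rewrite mulrC.
by rewrite /G !symG; lra.
Qed.

End RealKernel.

(** * From real to complex generic frameworks *)

Section KernelSystem.
Variables (F : numFieldType) (V E : finType) (s t : E -> V) (I : finType).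
Local Notation dG := (dl s t).
Implicit Types (p q xi : V -> I -> F).

(* The linear system [dG z * dG 1_w = \sum_k dG p_k * dG xi^w_k] in the unknowns
   [z] and [xi^w], one equation for each vertex [w] and each edge. *)
Definition sys_mx p (x : V + V * (V * I)) (y : V * E) : F :=
  match x with
  | inl v => dG (fun u => (u == v)%:R) y.2 * dG (fun u => (u == y.1)%:R) y.2
  | inr (w, vk) => - ((y.1 == w)%:R * rigidity_mx s t p y.2 vk)
  end.

(* Its obvious solutions: [z] affine, [xi^w] differing from [1_w] times the linear
   part of [z] by a trivial motion. *)
Definition sol_mx p (l : option I + V * (I * I + I)) (x : V + V * (V * I)) : F :=
  match l, x with
  | inl None, inl v => 1
  | inl (Some k), inl v => p v k
  | inl (Some k), inr (w, (v, k')) => (k' == k)%:R * (v == w)%:R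
  | inr (w, inl (k, j)), inr (w', (v, k')) =>
      (w' == w)%:R * ((k' == k)%:R * p v j - (k' == j)%:R * p v k)
  | inr (w, inr k), inr (w', (v, k')) => (w' == w)%:R * (k' == k)%:R
  | _, _ => 0
  end.

Lemma sys_mxE p c w e : \sum_x c x * sys_mx p x (w, e) =
  dG (fun v => c (inl v)) e * dG (fun u => (u == w)%:R) e -
  \sum_k dG (p^~ k) e * dG (fun v => c (inr (w, (v, k)))) e.
Proof.
rewrite big_sumType /=; congr (_ + _).
  under eq_bigr do rewrite mulrA.
  rewrite -mulr_suml; congr (_ * _); rewrite /dl.
  by under eq_bigr do rewrite mulrBr; rewrite sumrB !sum_indicr.
rewrite -(rigidity_mxE s t p e (fun v k => c (inr (w, (v, k))))) -sumrN.
transitivity (\sum_(y : V * (V * I)) (w == y.1)%:R *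
   (- (c (inr (y.1, y.2)) * rigidity_mx s t p e y.2))).
  by apply: eq_bigr => -[w' y] _ /=; ring.
rewrite (sum_pair (fun w' y => (w == w')%:R *
   (- (c (inr (w', y)) * rigidity_mx s t p e y)))).
under eq_bigr do rewrite -mulr_sumr.
by rewrite sum_indic; apply: eq_bigr => -[v k] _ /=; ring.
Qed.

Lemma sol_mxEl p c v : \sum_l c l * sol_mx p l (inl v) =
  \sum_k c (inl (Some k)) * p v k + c (inl None).
Proof.
rewrite big_sumType /= sum_option /= mulr1 [X in _ + X]big1 => [|[w [[k j]|k]] _];
  by rewrite ?mulr0 ?addr0// addrC.
Qed.

Lemma sol_mxEr p c w v k : \sum_l c l * sol_mx p l (inr (w, (v, k))) =
  c (inl (Some k)) * (v == w)%:R +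
  (\sum_j (c (inr (w, inl (k, j))) - c (inr (w, inl (j, k)))) * p v j +
   c (inr (w, inr k))).
Proof.
rewrite big_sumType /= sum_option /= mulr0 add0r; congr (_ + _).
  rewrite -(sum_indic k (fun k => c (inl (Some k)) * _)).
  by apply: eq_bigr => j _; ring.
pose f w' (y : I * I + I) := (w == w')%:R * (c (inr (w', y)) * match y with
  | inl (k', j) => (k == k')%:R * p v j - (k == j)%:R * p v k'
  | inr k' => (k == k')%:R end).
transitivity (\sum_x f x.1 x.2).
  by apply: eq_bigr => -[w' [[k' j]|k']] _; rewrite /f /=; ring.
rewrite sum_pair /f; under [LHS]eq_bigr do rewrite -mulr_sumr.
rewrite sum_indic big_sumType /=; congr (_ + _); last first.
  by rewrite sum_indicr.
pose g k' j := (k == k')%:R * (c (inr (w, inl (k', j))) * p v j) -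
   (k == j)%:R * (c (inr (w, inl (k', j))) * p v k').
transitivity (\sum_x g x.1 x.2).
  by apply: eq_bigr => -[k' j] _; rewrite /g /=; ring.
rewrite sum_pair /g; under [LHS]eq_bigr do rewrite sumrB sum_indic -mulr_sumr.
rewrite sumrB sum_indic -sumrB; apply: eq_bigr => j _; ring.
Qed.

Lemma sol_sys_mx p l y : \sum_x sol_mx p l x * sys_mx p x y = 0.
Proof.
case: y => w e; rewrite sys_mxE; case: l => [[k|]|[w' [[k j]|k]]] /=.
- rewrite [X in _ - X](_ : _ = dG (p^~ k) e * dG (fun u => (u == w)%:R) e) ?subrr//.
  rewrite -[RHS](sum_indic k (fun k => dG (p^~ k) e * _)); apply: eq_bigr => k' _.
  by rewrite dlZ [k' == k]eq_sym; ring.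
- by rewrite dl_cst mul0r sub0r big1 ?oppr0// => k _; rewrite dl_cst mulr0.
- rewrite dl_cst mul0r sub0r; under eq_bigr do rewrite dlZ dlB !dlZ.
  transitivity (- ((w == w')%:R * (\sum_k' (k == k')%:R * (dG (p^~ k') e * dG (p^~ j) e) -
     \sum_k' (j == k')%:R * (dG (p^~ k') e * dG (p^~ k) e)))).
    congr (- _); rewrite -sumrB mulr_sumr; apply: eq_bigr => k' _.
    by rewrite [k' == k]eq_sym [k' == j]eq_sym; ring.
  by rewrite !sum_indic; ring.
- by rewrite dl_cst mul0r sub0r big1 ?oppr0// => k' _; rewrite dl_cst mulr0.
Qed.

(** By [stress_dual], the unknowns [xi^w] exist for [z] exactly when every stress balances [z]
    against each indicator [1_w], that is for [z] in the stress kernel; for [z = 0] each [xi^w] is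
    an infinitesimal motion. Exactness thus combines both properties in one rank condition. *)
Lemma sys_exactP p : (0 < #|V|)%N -> aff_indep p ->
  fexact (sol_mx p) (sys_mx p) <->
  inf_rigid s t p /\ forall z, stress_kernel s t p z -> affine p z.
Proof.
move=> /card_gt0P[v0 _] ip; split=> [ex|[rig ker] c hc].
  split=> [xi pxi|z Kz].
    have [[w e]|c hc] := ex (fun x => if x is inr (w, (v, k)) then xi v k else 0).
      by rewrite sys_mxE /= dl_cst mul0r sub0r -[RHS]oppr0 -[in RHS](pxi e).
    have c0 : forall k, c (inl (Some k)) = 0.
      apply: (ip _ (c (inl None))) => v; rewrite -sol_mxEl.
      by rewrite -[LHS](hc (inl v)).
    exists (fun k j => c (inr (v0, inl (k, j))) - c (inr (v0, inl (j, k)))).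
    exists (fun k => c (inr (v0, inr k))); split=> [k j|v k]; first by rewrite opprB.
    by have := hc (inr (v0, (v, k))); rewrite sol_mxEr c0 mul0r add0r.
  have /choice[xi hxi] w : exists xi : V -> I -> F, forall e,
      dG z e * dG (fun u => (u == w)%:R) e = \sum_k dG (p^~ k) e * dG (xi^~ k) e.
    apply: stress_dual => om pom; rewrite -[RHS](Kz om pom (fun u => (u == w)%:R)).
    by apply: eq_bigr => e _; rewrite mulrA.
  have [[w e]|c hc] := ex (fun x => match x with
      | inl v => z v | inr (w, (v, k)) => xi w v k end).
    by rewrite sys_mxE /= hxi subrr.
  exists (fun k => c (inl (Some k))), (c (inl None)) => v.
  by rewrite -sol_mxEl -(hc (inl v)).
have hc' w e : dG (fun v => c (inl v)) e * dG (fun u => (u == w)%:R) e =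
    \sum_k dG (p^~ k) e * dG (fun v => c (inr (w, (v, k)))) e.
  by have /eqP := hc (w, e); rewrite sys_mxE subr_eq0 => /eqP.
have [|a [t0 hz]] := ker (fun v => c (inl v)).
  move=> om pom eta.
  transitivity (\sum_w eta w * \sum_e om e *
      (dG (fun v => c (inl v)) e * dG (fun u => (u == w)%:R) e)).
    under [RHS]eq_bigr do rewrite mulr_sumr.
    rewrite exchange_big /=; apply: eq_bigr => e _.
    rewrite {2}/dl -(sum_indic (s e) eta) -(sum_indic (t e) eta) -sumrB mulr_sumr.
    by apply: eq_bigr => w _; rewrite {3}/dl; ring.
  rewrite big1// => w _; under eq_bigr do rewrite hc' mulr_sumr.
  rewrite exchange_big big1 ?mulr0//= => k _.
  rewrite -[RHS](pom k (fun v => c (inr (w, (v, k))))).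
  by apply: eq_bigr => e _; rewrite mulrA.
have /choice[X hX] w : exists X : (I -> I -> F) * (I -> F),
    (forall k l, X.1 k l = - X.1 l k) /\ forall v k,
    c (inr (w, (v, k))) - a k * (v == w)%:R = \sum_l X.1 k l * p v l + X.2 k.
  have [e|X [tau [sX hX]]] := rig (fun v k => c (inr (w, (v, k))) - a k * (v == w)%:R).
    under eq_bigr do rewrite dlB dlZ mulrBr.
    rewrite sumrB -hc' (eq_dl _ _ _ hz) dl_lin mulr_suml; apply/eqP.
    by rewrite subr_eq0; apply/eqP/eq_bigr => k _; ring.
  by exists (X, tau).
(* [sol_mx] antisymmetrises its coefficients, hence the half of the skew matrix. *)
exists (fun l => match l with
  | inl (Some k) => a k
  | inl None => t0
  | inr (w, inl (k, j)) => (X w).1 k j / 2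
  | inr (w, inr k) => (X w).2 k end) => -[v|[w [v k]]].
  by rewrite sol_mxEl hz.
rewrite sol_mxEr /=; have [sX hX'] := hX w.
rewrite (_ : \sum_j _ = \sum_j (X w).1 k j * p v j); last first.
  apply: eq_bigr => j _; by rewrite (sX j k); congr (_ * _); field.
by have := hX' v k; move=> <-; rewrite addrC subrK.
Qed.

Lemma sys_mx_rank p0 p1 (D : F -> F) : deriv D ->
  (forall v k, D (p0 v k) = 0) -> (forall v k, D (p1 v k) = p1 v k - p0 v k) ->
  (\rank (fmx (sys_mx p0)) <= \rank (fmx (sys_mx p1)))%N.
Proof.
move=> dD D0 D1.
have Dn (n : nat) : D n%:R = 0 by exact: der_nat.
pose M1 x y := sys_mx p1 x y - sys_mx p0 x y.
have -> : fmx (sys_mx p1) = fmx (sys_mx p0) + fmx M1.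
  by apply/matrixP => i j; rewrite !mxE /M1 addrC subrK.
apply: (mxrank_spec dD) => i j; rewrite !mxE /M1; case: (enum_val i) => [v|[w [v k]]];
  case: (enum_val j) => w' e; rewrite /= /dl /rigidity_mx /dl /=;
  rewrite ?(derB _ _ dD) ?(derN _ dD) ?(derM dD) ?(derB _ _ dD) ?(derM dD) ?(derB _ _ dD) ?Dn ?D0 ?D1; ring.
Qed.

Lemma sol_mx_rank p0 p1 (D : F -> F) : deriv D ->
  (forall v k, D (p0 v k) = 0) -> (forall v k, D (p1 v k) = p1 v k - p0 v k) ->
  (\rank (fmx (sol_mx p0)) <= \rank (fmx (sol_mx p1)))%N.
Proof.
move=> dD D0 D1.
have Dn (n : nat) : D n%:R = 0 by exact: der_nat.
pose M1 x y := sol_mx p1 x y - sol_mx p0 x y.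
have -> : fmx (sol_mx p1) = fmx (sol_mx p0) + fmx M1.
  by apply/matrixP => i j; rewrite !mxE /M1 addrC subrK.
apply: (mxrank_spec dD) => i j; rewrite !mxE /M1;
  case: (enum_val i) => [[k|]|[w [[k l]|k]]]; case: (enum_val j) => [v'|[w' [v' k']]] /=;
  rewrite ?(derB _ _ dD) ?(derM dD) ?(derB _ _ dD) ?(derM dD) ?(derB _ _ dD)
    ?Dn ?D0 ?D1 ?(der0 dD) ?(der1 dD); ring.
Qed.

(* Between any configuration and a generic one lies a third configuration, generic
   over both. *)
Lemma sys_exact_generic p0 p : ~ countable [set: F] -> conf_generic p ->
  fexact (sol_mx p0) (sys_mx p0) -> fexact (sol_mx p) (sys_mx p).
Proof.
move=> uncF [Dp hDp]; rewrite !(fexactP (sol_sys_mx _)) => ex.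
pose T : finType := (V * I)%type.
pose y (x : T + T) := match x with inl (v, k) => p v k | inr (v, k) => p0 v k end.
have [c [dc [hdc dcy]]] := exists_dual_derivs uncF T y.
pose p1 v k := c (v, k).
have [D1 [dD1 D1c D1z]] := dual_derivs_dir (fun x => c x - p0 x.1 x.2) hdc.
have D1p0 v k : D1 (p0 v k) = 0.
  by apply: D1z => x; exact: (dcy x (inr (v, k))).
have D1p1 v k : D1 (p1 v k) = p1 v k - p0 v k by exact: D1c.
have [D2 [dD2 D2p _]] := dual_derivs_dir (fun x => p x.1 x.2 - p1 x.1 x.2) hDp.
(* [D3] keeps the effect of [D2] on [p] and makes [p1] constant: an Euler derivation about [p1]. *)
have [D3 [dD3 D3c D3z]] := deriv_adjust (fun=> 0) hdc dD2.
have D3p1 v k : D3 (p1 v k) = 0 by exact: D3c.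
have D3p v k : D3 (p v k) = p v k - p1 v k.
  rewrite D3z => [|x]; first exact: (D2p (v, k)).
  exact: (dcy x (inl (v, k))).
apply: (leq_trans ex); apply: leq_add.
  apply: leq_trans (sys_mx_rank dD1 D1p0 D1p1) _; exact: sys_mx_rank dD3 D3p1 D3p.
apply: leq_trans (sol_mx_rank dD1 D1p0 D1p1) _; exact: sol_mx_rank dD3 D3p1 D3p.
Qed.

End KernelSystem.

Section Transfer.
Variables (K F : numFieldType) (iota : {rmorphism K -> F}).
Variables (V E : finType) (s t : E -> V) (I : finType).

Lemma sys_exact_map (p : V -> I -> K) :
  fexact (sol_mx p) (sys_mx s t p) ->
  fexact (sol_mx (fun v k => iota (p v k))) (sys_mx s t (fun v k => iota (p v k))).
Proof.
rewrite !(fexactP (sol_sys_mx _ _ _)).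
have -> : fmx (sys_mx s t (fun v k => iota (p v k))) = map_mx iota (fmx (sys_mx s t p)).
  apply/matrixP => i j; rewrite !mxE; case: (enum_val i) => [v|[w [v k]]];
  case: (enum_val j) => w' e;
    by rewrite /= /rigidity_mx /dl /= ?rmorphN ?rmorphM ?rmorphB /= ?rmorph_nat ?rmorphM ?rmorphB ?rmorph_nat.
have -> : fmx (sol_mx (fun v k => iota (p v k))) = map_mx iota (fmx (sol_mx p)).
  apply/matrixP => i j; rewrite !mxE; case: (enum_val i) => [[k|]|[w [[k l]|k]]];
  case: (enum_val j) => [v'|[w' [v' k']]] /=;
    by rewrite ?rmorphM ?rmorphB ?rmorphM ?rmorph_nat ?rmorph0 ?rmorph1.
by rewrite !mxrank_map.
Qed.

Lemma rigid_kernel_transfer (p0 : V -> I -> K) (p : V -> I -> F) :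
  ~ countable [set: F] -> (#|I| < #|V|)%N -> conf_generic p0 -> conf_generic p ->
  inf_rigid s t p0 -> (forall z, stress_kernel s t p0 z -> affine p0 z) ->
  inf_rigid s t p /\ forall z, stress_kernel s t p z -> affine p z.
Proof.
move=> uncF IV gp0 gp rig ker.
have V0 : (0 < #|V|)%N by exact: leq_ltn_trans IV.
apply/sys_exactP => //; first exact: generic_aff_indep.
apply: (sys_exact_generic (p0 := fun v k => iota (p0 v k)) uncF gp).
apply: sys_exact_map; apply/sys_exactP => //; exact: generic_aff_indep.
Qed.

End Transfer.

(** * Length-equivalent generic complex frameworks *)

Lemma sum_scale0 (F : pzRingType) (J : finType) (c : F) (f g : J -> F) :
  \sum_k g k = 0 -> (forall k, f k = c * g k) -> \sum_k f k = 0.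
Proof. by move=> g0 fg; under eq_bigr do rewrite fg; rewrite -mulr_sumr g0 mulr0. Qed.

Section GenericFramework.
Variables (F : numFieldType) (V E I : finType) (s t : E -> V).
Local Notation dG := (dl s t).
Implicit Types (p : V -> I -> F).

Lemma generic_dir p (kap : V -> I -> F) : conf_generic p ->
  exists D, deriv D /\ forall v k, D (p v k) = kap v k.
Proof.
move=> [D hD]; have [D' [dD' D'p _]] := dual_derivs_dir (fun x => kap x.1 x.2) hD.
by exists D'; split=> // v k; exact: (D'p (v, k)).
Qed.

Lemma der_sqr_length (D : F -> F) p e : deriv D ->
  D (\sum_k dG (p^~ k) e ^+ 2) =
  2 * \sum_k dG (p^~ k) e * dG (fun v => D (p v k)) e.
Proof.
move=> dD; rewrite (der_sum _ _ _ dD) mulr_sumr; apply: eq_bigr => k _.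
by rewrite (der_sqr _ dD) (dl_der _ _ _ _ dD) mulrA.
Qed.

Lemma der_dl_sum (D : F -> F) p (a : I -> F) e : deriv D ->
  D (\sum_k a k * dG (p^~ k) e) =
  \sum_k D (a k) * dG (p^~ k) e + \sum_k a k * dG (fun v => D (p v k)) e.
Proof.
move=> dD; rewrite (der_sum _ _ _ dD) -big_split; apply: eq_bigr => k _ /=.
by rewrite (derM dD) (dl_der _ _ _ _ dD).
Qed.

Lemma dl_generic_neq0 p k e : s e != t e -> conf_generic p -> dG (p^~ k) e != 0.
Proof.
move=> st gp; apply/eqP => p0.
have [D [dD Dp]] := generic_dir (fun v _ => (v == s e)%:R) gp.
have := dl_der s t (p^~ k) e dD; rewrite p0 (der0 dD) /dl !Dp eqxx.
by rewrite eq_sym (negPf st) subr0 => /esym/eqP; rewrite oner_eq0.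
Qed.

(** The symmetric part of [Q], applied to [p], is an infinitesimal motion. By rigidity and
    independence its matrix is also skew, hence zero. *)
Lemma rigid_form_eq0 p (Q : I -> I -> F) : aff_indep p -> inf_rigid s t p ->
  (forall e, \sum_k \sum_l Q k l * (dG (p^~ k) e * dG (p^~ l) e) = 0) ->
  forall k l, Q k l + Q l k = 0.
Proof.
move=> ip rig hQ.
have [e|X [tau [sX hX]]] := rig (fun v k => \sum_l (Q k l + Q l k) * p v l).
  transitivity (2 * \sum_k \sum_l Q k l * (dG (p^~ k) e * dG (p^~ l) e)); last by rewrite hQ mulr0.
  rewrite mulr2n mulrDl mul1r [X in _ = _ + X]exchange_big -big_split.
  apply: eq_bigr => k _ /=; rewrite dl_sum mulr_sumr -big_split; apply: eq_bigr => l _ /=.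
  by rewrite dlZ; ring.
have QX k l : Q k l + Q l k = X k l.
  apply/eqP; rewrite -subr_eq0; apply/eqP; move: l; apply: (ip _ (- tau k)) => v.
  under eq_bigr do rewrite mulrBl.
  by rewrite sumrB hX; ring.
move=> k l; have := sX k l; rewrite -!QX => h.
have : 2 * (Q k l + Q l k) = 0 by rewrite mulr2n mulrDl mul1r {1}h; ring.
by move/eqP; rewrite mulf_eq0 pnatr_eq0 => /eqP.
Qed.

Lemma all_affine_card p : (forall z, affine p z) -> (#|V| <= #|I|.+1)%N.
Proof.
move=> h; pose M (o : option I) v := if o is Some k then p v k else 1.
rewrite -card_option; apply: leq_trans (rank_leq_row (fmx M)).
suff : (1%:M <= fmx M)%MS by move/mxrankS; rewrite mxrank1.
apply/row_subP => i; rewrite -(fantiK (row i _)).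
have [a [c hz]] := h (fanti (row i 1%:M)).
apply/frow_submx; exists (fun o => if o is Some k then a k else c) => v.
by rewrite hz sum_option /= mulr1 addrC.
Qed.

End GenericFramework.

Section LengthEquivalence.
Variables (F : numFieldType) (V W E I : finType).
Variables (s t : E -> V) (s' t' : E -> W).
Local Notation dG := (dl s t).
Local Notation dH := (dl s' t').
Variables (p : V -> I -> F) (q : W -> I -> F).
Hypothesis len : forall e, \sum_k dG (p^~ k) e ^+ 2 = \sum_k dH (q^~ k) e ^+ 2.

Lemma length_der (D : F -> F) e : deriv D ->
  \sum_k dG (p^~ k) e * dG (fun v => D (p v k)) e =
  \sum_k dH (q^~ k) e * dH (fun v => D (q v k)) e.
Proof.
move=> dD; have two0 : (2 : F) != 0 by rewrite pnatr_eq0.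
by apply: (mulfI two0); rewrite -!der_sqr_length// len.
Qed.

(** The equilibrium sum of [w] on [q], in the coordinate [k] against [eta], pairs [w] with half the
    derivative of the squared lengths as that coordinate moves by [eta]. Computed on [p], this
    pairing vanishes. *)
Lemma stress_length w : conf_generic q -> stress s t p w -> stress s' t' q w.
Proof.
move=> gq pw k eta.
have [D [dD Dq]] := generic_dir (fun x l => (k == l)%:R * eta x) gq.
transitivity (\sum_e w e * \sum_l dG (p^~ l) e * dG (fun v => D (p v l)) e).
  apply: eq_bigr => e _; rewrite -mulrA (length_der e dD); congr (_ * _).
  rewrite -[LHS](sum_indic k (fun l => dH (q^~ l) e * dH eta e)); apply: eq_bigr => l _.
  rewrite (eq_dl s' t' e (f := fun x => D (q x l)) (g := fun x => (k == l)%:R * eta x)) => [|x]; last exact: Dq.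
  by rewrite dlZ; ring.
under eq_bigr do rewrite mulr_sumr.
rewrite exchange_big big1//= => l _; rewrite -[RHS](pw l (fun v => D (p v l))).
by apply: eq_bigr => e _; rewrite mulrA.
Qed.

End LengthEquivalence.

(** * Edge vectors of [q] as signed orthogonal images of those of [p] *)

Section SignedFrame.
Variables (F : numClosedFieldType) (V W E I : finType).
Variables (s t : E -> V) (s' t' : E -> W).
Local Notation dG := (dl s t).
Local Notation dH := (dl s' t').
Variables (p : V -> I -> F) (q : W -> I -> F).
Hypothesis len : forall e, \sum_k dG (p^~ k) e ^+ 2 = \sum_k dH (q^~ k) e ^+ 2.
Hypotheses (gp : conf_generic p) (gq : conf_generic q).
Hypothesis IV : (#|I|.+1 < #|V|)%N.
Hypothesis rig : inf_rigid s t p.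
Hypothesis ker : forall z, stress_kernel s t p z -> affine p z.
Hypothesis loopH : forall e, s' e != t' e.
Hypothesis simpleH : forall e e',
  (s' e = s' e' /\ t' e = t' e') \/ (s' e = t' e' /\ t' e = s' e') -> e = e'.

Let ip : aff_indep p.
Proof. by apply: generic_aff_indep => //; exact: ltnW IV. Qed.

Let stress_pq w : stress s t p w <-> stress s' t' q w.
Proof.
split=> h; first exact: (stress_length len gq h).
by apply: (stress_length _ gp h) => e; rewrite len.
Qed.

Let form_eq0_sym (Q : I -> I -> F) : (forall k l, Q k l = Q l k) ->
  (forall e, \sum_k \sum_l Q k l * (dG (p^~ k) e * dG (p^~ l) e) = 0) ->
  forall k l, Q k l = 0.
Proof.
move=> sQ /(rigid_form_eq0 ip rig) h k l; have := h k l.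
by rewrite (sQ l k) -mulr2n => /eqP; rewrite mulrn_eq0 => /eqP.
Qed.

Lemma der_affine (D : F -> F) : deriv D ->
  (forall w, stress s' t' q w -> forall k, balanced s' t' w (fun x => D (q x k))) ->
  forall k, affine p (fun v => D (p v k)).
Proof.
move=> dD Dq k; apply: ker => w pw; apply: (kernel_der dD pw).
apply/stress_pq; apply: (stress_der dD); first exact/stress_pq.
by apply: Dq; apply/stress_pq.
Qed.

Lemma der_balanced (D : F -> F) : deriv D ->
  (forall k, affine p (fun v => D (p v k))) ->
  forall w, stress s' t' q w -> forall k, balanced s' t' w (fun x => D (q x k)).
Proof.
move=> dD Dp w qw; apply: (kernel_der dD qw).
apply/stress_pq; apply: (stress_der dD); first exact/stress_pq.
move=> k; have [a [c h]] := Dp k; apply: balanced_lin h.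
by apply/stress_pq.
Qed.

Definition coord_form (A : I -> I -> F) (j : I) : Prop :=
  (forall k l, A k l = A l k) /\
  forall e, dH (q^~ j) e ^+ 2 = \sum_k \sum_l A k l * (dG (p^~ k) e * dG (p^~ l) e).

(** A derivation scaling the coordinate [j] of [q] and fixing the others acts on [p] by affine maps.
    Half the derivative of a squared length is then the square of the coordinate [j] for [q], and a
    quadratic form in the edge vector for [p]. *)
Lemma coord_form_exists j : exists A, coord_form A j.
Proof.
have [D [dD Dq]] := generic_dir (fun x k => (j == k)%:R * q x j) gq.
have /choice[B hB] k : exists B : I -> F, exists c, forall v, D (p v k) = \sum_l B l * p v l + c.
  apply: (der_affine dD) => w qw k' eta.
  transitivity ((j == k')%:R * \sum_e w e * dH (q^~ j) e * dH eta e); last by rewrite qw mulr0.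
  rewrite mulr_sumr; apply: eq_bigr => e _.
  rewrite (eq_dl s' t' e (f := fun x => D (q x k')) (g := fun x => (j == k')%:R * q x j)) ?dlZ => [|x]; last exact: Dq.
  ring.
exists (fun k l => (B k l + B l k) / 2); split=> [k l|e]; first by rewrite addrC.
transitivity (\sum_k dH (q^~ k) e * dH (fun x => D (q x k)) e).
  rewrite -[LHS](sum_indic j (fun k => dH (q^~ k) e * dH (q^~ j) e)).
  apply: eq_bigr => k _.
  rewrite (eq_dl s' t' e (f := fun x => D (q x k)) (g := fun x => (j == k)%:R * q x j)) ?dlZ => [|x]; last exact: Dq.
  ring.
rewrite -(length_der len e dD).
have -> : \sum_k dG (p^~ k) e * dG (fun v => D (p v k)) e =
    \sum_k \sum_l B k l * (dG (p^~ k) e * dG (p^~ l) e).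
  apply: eq_bigr => k _; have [c hc] := hB k.
  by rewrite (eq_dl _ _ _ hc) dl_lin mulr_sumr; apply: eq_bigr => l _; ring.
have two0 : (2 : F) != 0 by rewrite pnatr_eq0.
apply: (mulfI two0); rewrite {1}mulr2n mulrDl mul1r [X in _ + X = _]exchange_big -big_split mulr_sumr.
apply: eq_bigr => k _ /=; rewrite -big_split mulr_sumr; apply: eq_bigr => l _ /=.
by field.
Qed.

Lemma coord_form_sum A : (forall j, coord_form (A j) j) ->
  forall k l, \sum_j A j k l = (k == l)%:R.
Proof.
move=> hA k l; apply/eqP; rewrite -subr_eq0; apply/eqP; move: k l.
apply: form_eq0_sym => [k l|e].
  by rewrite [k == l]eq_sym; congr (_ - _); apply: eq_bigr => j _; exact: (hA j).1.
under eq_bigr do under eq_bigr do rewrite mulrBl mulr_suml.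
under eq_bigr do rewrite sumrB exchange_big sum_indic /= -expr2.
rewrite sumrB exchange_big len -sumrB big1 // => j _; rewrite (hA j).2.
by rewrite subrr.
Qed.

(** As [D] kills the coordinate [j] of [q], deriving the equation of [A] shows that
    [2 A (D p) + (D A) p] is an infinitesimal motion, hence affine in [p]. A functional [phi] that
    vanishes on affine functions leaves only the first term. *)
Lemma coord_form_der A j (D : F -> F) phi : coord_form A j -> deriv D ->
  (forall x, D (q x j) = 0) -> \sum_v phi v = 0 ->
  (forall k, \sum_v phi v * p v k = 0) ->
  forall k, \sum_l A k l * \sum_v phi v * D (p v l) = 0.
Proof.
move=> [sA hA] dD Dq phi0 phip.
have [e|X [tau [sX hX]]] := @rig (fun v k =>
    \sum_l 2 * A k l * D (p v l) + \sum_l D (A k l) * p v l).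
  transitivity (D (dH (q^~ j) e ^+ 2)); last first.
    rewrite (der_sqr _ dD) (dl_der _ _ _ _ dD).
    by rewrite (eq_dl s' t' e (f := fun x => D (q x j)) (g := fun=> 0)) ?dl_cst ?mulr0.
  rewrite hA (der_sum _ _ _ dD); under [RHS]eq_bigr do rewrite (der_sum _ _ _ dD).
  pose T k l := A k l * (dG (p^~ k) e * dG (fun v => D (p v l)) e).
  have -> : \sum_k \sum_l D (A k l * (dG (p^~ k) e * dG (p^~ l) e)) =
      \sum_k \sum_l D (A k l) * (dG (p^~ k) e * dG (p^~ l) e) +
      \sum_k \sum_l T k l + \sum_k \sum_l T k l.
    rewrite [X in _ + _ + X]exchange_big -!big_split; apply: eq_bigr => k _ /=.
    rewrite -!big_split; apply: eq_bigr => l _ /=.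
    by rewrite /T !(derM dD) !(dl_der _ _ _ _ dD) (sA l k); ring.
  rewrite -!big_split; apply: eq_bigr => k _ /=.
  rewrite dlD !dl_sum mulrDr !mulr_sumr -!big_split; apply: eq_bigr => l _ /=.
  by rewrite !dlZ /T; ring.
move=> k; have two0 : (2 : F) != 0 by rewrite pnatr_eq0.
have flat (a : I -> F) : \sum_v phi v * \sum_l a l * p v l = 0.
  under eq_bigr do rewrite mulr_sumr.
  rewrite exchange_big big1//= => l _.
  by apply: (sum_scale0 (c := a l) (phip l)) => v; ring.
apply: (mulfI two0); rewrite mulr0 mulr_sumr.
transitivity (\sum_v phi v * (\sum_l 2 * A k l * D (p v l))).
  under [RHS]eq_bigr do rewrite mulr_sumr.
  rewrite [RHS]exchange_big; apply: eq_bigr => l _ /=; rewrite !mulr_sumr.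
  by apply: eq_bigr => v _; ring.
transitivity (\sum_v phi v * (\sum_l X k l * p v l + tau k - \sum_l D (A k l) * p v l)).
  by apply: eq_bigr => v _; rewrite -hX addrK.
under eq_bigr do rewrite mulrBr mulrDr.
by rewrite sumrB big_split /= !flat -mulr_suml phi0 mul0r addr0 subrr.
Qed.

Lemma nonzero_stress : exists w e, stress s' t' q w /\ w e != 0.
Proof.
apply: contrapT => no.
suff : (#|V| <= #|I|.+1)%N by rewrite leqNgt IV.
apply: (@all_affine_card F V I p) => z; apply: ker => w /stress_pq qw eta.
apply: big1 => e _; rewrite (_ : w e = 0) ?mul0r//.
by apply: contrapT => /eqP we; apply: no; exists w, e.
Qed.

(** Moving one vertex of [q] in the coordinate [i] alone moves [p] in a non-affine way, because a
    stress does not balance the indicator of an end of an edge where it is nonzero. Pairing this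
    motion with a functional that kills affine functions gives [n], and [coord_form_der] applies for
    every [j != i]. *)
Lemma coord_normal i : exists n : I -> F, (exists l, n l != 0) /\
  forall A j, j != i -> coord_form A j -> forall k, \sum_l A k l * n l = 0.
Proof.
have [w [e0 [qw we0]]] := nonzero_stress.
have [D [dD Dq]] := generic_dir (fun x k => (k == i)%:R * (x == s' e0)%:R) gq.
have [l nl] : exists l, ~ affine p (fun v => D (p v l)).
  apply/existsNP => Dp.
  have := der_balanced dD Dp qw i (fun x => (x == t' e0)%:R).
  (* No other edge joins the ends of [e0], so testing against the indicator of [t' e0] isolates the
     term [- w e0]. *)
  rewrite (bigD1 e0)//= big1 => [|e ee0]; last first.
    rewrite /dl !Dq eqxx !mul1r.
    have h1 : ~ (s' e = s' e0 /\ t' e = t' e0).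
      by move=> h; move/eqP: ee0; apply; apply: simpleH; left.
    have h2 : ~ (s' e = t' e0 /\ t' e = s' e0).
      by move=> h; move/eqP: ee0; apply; apply: simpleH; right.
    have := loopH e; have := loopH e0.
    have [se|_] := eqVneq (s' e) (s' e0); have [te|_] := eqVneq (t' e) (s' e0);
    have [se'|_] := eqVneq (s' e) (t' e0); have [te'|_] := eqVneq (t' e) (t' e0) => //= /eqP n0 /eqP n1;
      rewrite ?subrr ?mulr0 ?mul0r//; exfalso; try (by apply: h1); try (by apply: h2); congruence.
  rewrite addr0 /dl !Dq !eqxx !mul1r (negPf (loopH e0)) eq_sym (negPf (loopH e0)).
  by rewrite subr0 sub0r mulr1 mulrN1 => /eqP; rewrite oppr_eq0 (negPf we0).
have [phi [phi0 phip phiD]] : exists phi, [/\ \sum_v phi v = 0,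
    forall k, \sum_v phi v * p v k = 0 & \sum_v phi v * D (p v l) != 0].
  apply: contrapT => no; apply: nl; apply: affineP => phi phi0 phip.
  by apply: contrapT => /eqP h; apply: no; exists phi.
exists (fun k => \sum_v phi v * D (p v k)); split; first by exists l.
move=> A j ji hA; apply: (coord_form_der hA dD) => // x.
by rewrite Dq (negPf ji) mul0r.
Qed.

(** [A j] kills [n i] for [i != j] and the forms sum to the identity, so [A j] is the orthogonal
    projection on the line of [n j]. Dividing [n j] by a square root of its square length, nonzero
    because the [n i] span, turns each form into the square of a linear form. *)
Lemma orthonormal_frame : exists g : I -> I -> F,
  (forall i j, \sum_k g i k * g j k = (i == j)%:R) /\
  forall j e, dH (q^~ j) e ^+ 2 = (\sum_k g j k * dG (p^~ k) e) ^+ 2.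
Proof.
have /choice[A hA] := coord_form_exists.
have /choice[n hn] := coord_normal.
have An0 i j : j != i -> forall k, \sum_l A j k l * n i l = 0.
  by move=> ji; exact: (hn i).2 _ _ ji (hA j).
have An i k : \sum_l A i k l * n i l = n i k.
  rewrite -[RHS](sum_indic k (n i)).
  under [RHS]eq_bigr do rewrite -(coord_form_sum hA) mulr_suml.
  rewrite exchange_big [RHS](bigD1 i)//= [X in _ + X]big1 ?addr0// => j ji.
  exact: An0.
have ortho i j : i != j -> \sum_k n i k * n j k = 0.
  move=> ij; under eq_bigr do rewrite -(An i) mulr_suml.
  rewrite exchange_big big1//= => l _; apply: (sum_scale0 (c := n i l) (An0 j i ij l)) => k.
  by rewrite ((hA i).1 k l); ring.
have free c : (forall k, \sum_i c i * n i k = 0) -> forall i, c i = 0.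
  move=> hc j; have [l nl] := (hn j).1.
  have : \sum_k A j l k * \sum_i c i * n i k = 0.
    by apply: big1 => k _; rewrite hc mulr0.
  under eq_bigr do rewrite mulr_sumr.
  rewrite exchange_big (bigD1 j)//= [X in _ + X]big1 => [|i ij]; last first.
    have ji : j != i by rewrite eq_sym.
    by apply: (sum_scale0 (c := c i) (An0 i j ji l)) => k; ring.
  rewrite addr0 (_ : \sum_k _ = c j * n j l).
    by move/eqP; rewrite mulf_eq0 (negPf nl) orbF => /eqP.
  by rewrite -(An j l) mulr_sumr; apply: eq_bigr => k _; ring.
have span x : exists c, forall k, x k = \sum_i c i * n i k.
  apply/frow_submx; apply: submx_full; rewrite row_full_unit -row_free_unit.
  apply/inj_row_free => v; rewrite -(fantiK v) => /fmul_eq0 h.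
  by apply/frow_eq0/free.
pose nn j := \sum_k n j k * n j k.
have dotE c j : \sum_k n j k * (\sum_i c i * n i k) = c j * nn j.
  under eq_bigr do rewrite mulr_sumr.
  rewrite exchange_big (bigD1 j)//= [X in _ + X]big1 => [|i ij].
    by rewrite addr0 /nn mulr_sumr; apply: eq_bigr => k _; ring.
  by apply: (sum_scale0 (c := c i) (ortho i j ij)) => k; ring.
have nn0 j : nn j != 0.
  apply/eqP => nj; have [l /eqP] := (hn j).1; apply.
  have [c hc] := span (fun k => (l == k)%:R).
  rewrite -(sum_indic l (n j)).
  transitivity (\sum_k n j k * (\sum_i c i * n i k)); last by rewrite dotE nj mulr0.
  by apply: eq_bigr => k _; rewrite -hc mulrC.
have formE j x : (\sum_k \sum_l A j k l * (x k * x l)) * nn j = (\sum_k n j k * x k) ^+ 2.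
  have [c hc] := span x; rewrite [in RHS](eq_bigr _ (fun k _ => congr1 (fun y => n j k * y) (hc k))).
  have Ax k : \sum_l A j k l * x l = c j * n j k.
    under eq_bigr do rewrite hc mulr_sumr.
    rewrite exchange_big (bigD1 j)//= [X in _ + X]big1 => [|i ij].
      by rewrite addr0 -An mulr_sumr; apply: eq_bigr => l _; ring.
    have ji : j != i by rewrite eq_sym.
    by apply: (sum_scale0 (c := c i) (An0 i j ji k)) => l; ring.
  rewrite (_ : \sum_k \sum_l _ = c j * (c j * nn j)).
    by rewrite dotE; ring.
  rewrite -dotE mulr_sumr; apply: eq_bigr => k _; rewrite -hc.
  transitivity (x k * \sum_l A j k l * x l); last by rewrite Ax; ring.
  by rewrite mulr_sumr; apply: eq_bigr => l _; ring.
have sq0 j : sqrtC (nn j) != 0 by rewrite sqrtC_eq0.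
exists (fun j k => n j k / sqrtC (nn j)); split=> [i j|j e].
  transitivity ((\sum_k n i k * n j k) / (sqrtC (nn i) * sqrtC (nn j))).
    by rewrite mulr_suml; apply: eq_bigr => k _; rewrite invfM; ring.
  have [<-|ij] := eqVneq i j; last by rewrite ortho// mul0r.
  by rewrite -[sqrtC _ * _]expr2 sqrtCK -/(nn i) divff.
have -> : \sum_k n j k / sqrtC (nn j) * dG (p^~ k) e =
    (\sum_k n j k * dG (p^~ k) e) / sqrtC (nn j).
  by rewrite mulr_suml; apply: eq_bigr => k _; rewrite mulrAC.
by rewrite expr_div_n sqrtCK -formE mulfK// (hA j).2.
Qed.

(** Squares leave one sign per edge and per coordinate; the signs are matched across coordinates by
    comparison with the reference coordinate [i1]. *)
Lemma signed_frame (i1 : I) : exists sg (g : I -> I -> F),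
  [/\ forall e, sg e ^+ 2 = 1, forall i j, \sum_k g i k * g j k = (i == j)%:R &
    forall j e, dH (q^~ j) e = sg e * \sum_k g j k * dG (p^~ k) e].
Proof.
have [g [og hg]] := orthonormal_frame.
pose P j e := \sum_k g j k * dG (p^~ k) e.
have P0 e : P i1 e != 0.
  by rewrite -sqrf_eq0 -hg sqrf_eq0; exact: dl_generic_neq0.
pose sg e := dH (q^~ i1) e / P i1 e.
have sgE e : dH (q^~ i1) e = sg e * P i1 e by rewrite divfK.
have sg2 e : sg e ^+ 2 = 1 by rewrite expr_div_n hg -/(P i1 e) divff// sqrf_eq0 P0.
have /choice[rho hrho] j : exists rho, rho ^+ 2 = 1 /\
    forall e, dH (q^~ j) e = sg e * (rho * P j e).
  have [->|ji] := eqVneq j i1; first by exists 1; rewrite expr1n; split=> // e; rewrite mul1r.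
  (* Infinitesimal rotation of [q] in the plane of [i1] and [j]. It preserves lengths, so [p] moves
     trivially, and deriving the square relation for [i1] makes the coordinate [j] of an edge [sg e]
     times a linear form [L]. *)
  have [D [dD Dq]] := generic_dir
    (fun x k => (i1 == k)%:R * q x j - (j == k)%:R * q x i1) gq.
  have DqE k e : dH (fun x => D (q x k)) e =
      (i1 == k)%:R * dH (q^~ j) e - (j == k)%:R * dH (q^~ i1) e.
    by rewrite -!dlZ -dlB; apply: eq_dl => x; exact: Dq.
  have [e|X [tau [_ hX]]] := @rig (fun v k => D (p v k)).
    rewrite (length_der len e dD).
    transitivity (\sum_k (i1 == k)%:R * (dH (q^~ k) e * dH (q^~ j) e) -
       \sum_k (j == k)%:R * (dH (q^~ k) e * dH (q^~ i1) e)).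
      by rewrite -sumrB; apply: eq_bigr => k _; rewrite DqE; ring.
    by rewrite !sum_indic; ring.
  pose L l := D (g i1 l) + \sum_k g i1 k * X k l.
  have LE e : dH (q^~ j) e = sg e * \sum_l L l * dG (p^~ l) e.
    have e1 : 2 * (dH (q^~ i1) e * dH (q^~ j) e) =
        2 * (P i1 e * \sum_l L l * dG (p^~ l) e).
      transitivity (D (dH (q^~ i1) e ^+ 2)).
        by rewrite (der_sqr _ dD) (dl_der _ _ _ _ dD) DqE eqxx (negPf ji) mul1r mul0r subr0 mulrA.
      rewrite hg (der_sqr _ dD) (der_dl_sum _ _ _ _ _ dD) -mulrA; congr (_ * (_ * _)).
      transitivity (\sum_l (D (g i1 l) * dG (p^~ l) e +
          (\sum_k g i1 k * X k l) * dG (p^~ l) e)); last first.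
        by apply: eq_bigr => l _; rewrite mulrDl.
      rewrite big_split; congr (_ + _).
      under [RHS]eq_bigr do rewrite mulr_suml.
      rewrite [RHS]exchange_big; apply: eq_bigr => k _ /=.
      rewrite (eq_dl s t e (f := fun v => D (p v k)) (hX^~ k)) dl_lin mulr_sumr.
      by apply: eq_bigr => l _; rewrite mulrA.
    have two0 : (2 : F) != 0 by rewrite pnatr_eq0.
    apply: (mulfI (P0 e)); rewrite mulrCA -(mulfI two0 e1) sgE.
    by rewrite -[in LHS](mul1r (dH (q^~ j) e)) -(sg2 e); ring.
  (* [L] and [g j] have the same square on all edges, so by rigidity they agree up to a sign [rho]
     that does not depend on the edge. *)
  have LL k l : L k * L l = g j k * g j l.
    have := @rigid_form_eq0 F V E I s t p (fun k l => L k * L l - g j k * g j l) ip rig _ k l.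
    move=> h; have {}h : L k * L l - g j k * g j l + (L l * L k - g j l * g j k) = 0.
      apply: h => e.
      transitivity ((\sum_l L l * dG (p^~ l) e) ^+ 2 - P j e ^+ 2); last first.
        by rewrite -hg LE exprMn sg2 mul1r subrr.
      rewrite !expr2 /P !mulr_suml -sumrB; apply: eq_bigr => k' _.
      by rewrite !mulr_sumr -sumrB; apply: eq_bigr => l' _; ring.
    apply/eqP; rewrite -subr_eq0; have : 2 * (L k * L l - g j k * g j l) = 0.
      by rewrite -[RHS]h; ring.
    by move/eqP; rewrite mulf_eq0 pnatr_eq0.
  have [l0 gl0] : exists l, g j l != 0.
    apply: contrapT => no; have := og j j; rewrite eqxx big1 => [/eqP|k _].
      by rewrite eq_sym oner_eq0.
    by rewrite (_ : g j k = 0) ?mul0r//; apply: contrapT => /eqP h; apply: no; exists k.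
  exists (L l0 / g j l0); split=> [|e].
    by rewrite expr_div_n !expr2 LL divff// mulf_neq0.
  rewrite LE; congr (_ * _); rewrite /P mulr_sumr; apply: eq_bigr => k _.
  rewrite mulrA; congr (_ * _).
  have L0 : L l0 != 0.
    by apply: contraNneq gl0 => h; have := LL l0 l0; rewrite h mul0r => /esym/eqP; rewrite mulf_eq0 orbb.
  apply: (mulfI L0); rewrite (LL l0 k).
  transitivity ((L l0 * L l0) / g j l0 * g j k); last by ring.
  by rewrite LL mulfK.
exists sg, (fun j k => rho j * g j k); split=> // [i j|j e].
  transitivity (rho i * rho j * \sum_k g i k * g j k).
    by rewrite mulr_sumr; apply: eq_bigr => k _; ring.
  have [<-|ij] := eqVneq i j; last by rewrite og (negPf ij) mulr0.
  by rewrite og eqxx mulr1 -expr2 (hrho i).1.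
rewrite (hrho j).2; congr (_ * _); rewrite /P mulr_sumr.
by apply: eq_bigr => k _; rewrite mulrA.
Qed.

(** Derive the relation of [signed_frame] for [i1]; the signs are constants because their squares
    are 1. Prescribing the derivative of [q] gives one inclusion, prescribing that of [p] the
    other. *)
Lemma cut_spaces (i1 : I) : exists sg : E -> F, [/\ forall e, sg e != 0,
  forall h : W -> F, exists f, forall e, dH h e = sg e * dG f e &
  forall f : V -> F, exists h, forall e, dH h e = sg e * dG f e].
Proof.
have [sg [g [sg2 og hg]]] := signed_frame i1.
have sg0 e : sg e != 0 by rewrite -sqrf_eq0 sg2 oner_eq0.
have Dsg D e : deriv D -> D (sg e) = 0.
  move=> dD; have := der_sqr (sg e) dD; rewrite sg2 (der1 dD) => /esym/eqP.
  by rewrite !mulf_eq0 pnatr_eq0 (negPf (sg0 e)) => /eqP.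
have key D e : deriv D -> dH (fun x => D (q x i1)) e = sg e *
    (\sum_k D (g i1 k) * dG (p^~ k) e + \sum_k g i1 k * dG (fun v => D (p v k)) e).
  move=> dD; rewrite -(dl_der _ _ _ _ dD) hg (derM dD) (Dsg _ _ dD) mul0r add0r.
  by rewrite (der_dl_sum _ _ _ _ _ dD).
have og' k l : \sum_j g j k * g j l = (k == l)%:R.
  have : (fmx g) *m (fmx g)^T = 1%:M.
    apply/matrixP => i j; rewrite !mxE -(inj_eq enum_val_inj) -og -[RHS]big_ord_enum_val.
    by apply: eq_bigr => k' _; rewrite !mxE.
  move=> /mulmx1C/matrixP/(_ (enum_rank k) (enum_rank l)).
  rewrite !mxE (inj_eq enum_rank_inj) => <-; rewrite -[LHS]big_ord_enum_val.
  by apply: eq_bigr => j _; rewrite !mxE !enum_rankK.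
exists sg; split=> // [h|f].
  have [D [dD Dq]] := generic_dir (fun x k => h x) gq.
  exists (fun v => \sum_k D (g i1 k) * p v k + \sum_k g i1 k * D (p v k)) => e.
  rewrite dlD !dl_sum; under eq_bigr do rewrite dlZ.
  under [X in _ * (_ + X)]eq_bigr do rewrite dlZ.
  by rewrite -(key D e dD); apply: eq_dl => x; rewrite Dq.
have [D [dD Dp]] := generic_dir (fun v k => g i1 k * f v) gp.
(* The terms with derivatives of [g] are removed by writing the edge vectors of [p] through those of
   [q], the transpose of [g] being its inverse. *)
exists (fun x => D (q x i1) - \sum_k D (g i1 k) * \sum_j g j k * q x j) => e.
have qE k : dH (fun x => \sum_j g j k * q x j) e = sg e * dG (p^~ k) e.
  rewrite dl_sum; under eq_bigr do rewrite dlZ hg mulrCA.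
  rewrite -mulr_sumr; congr (_ * _).
  under eq_bigr do rewrite mulr_sumr.
  rewrite exchange_big -[RHS](sum_indic k (fun l => dG (p^~ l) e)).
  apply: eq_bigr => l _ /=; rewrite -og' mulr_suml.
  by apply: eq_bigr => j _; rewrite mulrA.
have pE : \sum_k g i1 k * dG (fun v => D (p v k)) e = dG f e.
  transitivity (\sum_k (g i1 k * g i1 k) * dG f e).
    apply: eq_bigr => k _; rewrite -mulrA; congr (_ * _); rewrite -dlZ.
    by apply: eq_dl => v; exact: Dp.
  by rewrite -mulr_suml og eqxx mul1r.
rewrite dlB (key D e dD) pE dl_sum.
under [X in _ - X]eq_bigr do rewrite dlZ qE mulrCA.
by rewrite -mulr_sumr; ring.
Qed.

End SignedFrame.

(** * Recovering a graph from its signed cut space *)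

Section Whitney.
Variables (F : numFieldType) (V W E : finType) (s t : E -> V) (s' t' : E -> W).
Variable sg : E -> F.
Local Notation dG := (dl s t).
Local Notation dH := (dl s' t').
Local Notation ind v := (fun u => (u == v)%:R : F).

Hypothesis V4 : (4 <= #|V|)%N.
(** Connectedness of [G] minus two vertices, phrased with functions so that it applies directly to
    elements of the cut space. *)
Hypothesis conn2 : forall (u v : V) (f : V -> F), u != v ->
  (forall e, s e != u -> s e != v -> t e != u -> t e != v -> dG f e = 0) ->
  forall a b, a != u -> a != v -> b != u -> b != v -> f a = f b.
Hypothesis loopG : forall e, s e != t e.
Hypothesis isoH : forall x, exists e, x = s' e \/ x = t' e.
Hypothesis sg0 : forall e, sg e != 0.
Hypothesis HG : forall h : W -> F, exists f, forall e, dH h e = sg e * dG f e.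
Hypothesis GH : forall f : V -> F, exists h, forall e, dH h e = sg e * dG f e.

Lemma vertex_avoiding (s0 : seq V) : (size s0 < 4)%N -> exists v, v \notin s0.
Proof.
move=> s4; apply: contrapT => h; have : (#|V| <= size s0)%N.
  apply: leq_trans (card_size s0); apply/subset_leq_card/fintype.subsetP => v _.
  by apply: contrapT => /negP vs; apply: h; exists v.
by move=> Vs; have := leq_trans V4 Vs; rewrite leqNgt s4.
Qed.

Lemma conn1 (v : V) (f : V -> F) :
  (forall e, s e != v -> t e != v -> dG f e = 0) ->
  forall a b, a != v -> b != v -> f a = f b.
Proof.
move=> hf a b av bv; have [//|u] := @vertex_avoiding [:: a; b; v].
rewrite !inE !negb_or => /and3P[ua ub uv].
apply: (conn2 (u := u) (v := v)) => //; try by rewrite eq_sym.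
by move=> e su sv tu tv; exact: hf.
Qed.

Lemma conn0 (f : V -> F) : (forall e, dG f e = 0) -> forall a b, f a = f b.
Proof.
move=> hf a b; have [//|u] := @vertex_avoiding [:: a; b].
rewrite !inE !negb_or => /andP[ua ub].
by apply: (conn1 (v := u)) => //; rewrite eq_sym.
Qed.

Lemma star0 (v : V) e : dG (ind v) e = 0 <-> (s e != v /\ t e != v).
Proof.
rewrite /dl; split=> [|[/negPf-> /negPf->]]; last by rewrite subrr.
have [sv|_] := eqVneq (s e) v; have [tv|_] := eqVneq (t e) v => //.
- by have := loopG e; rewrite sv tv eqxx.
- by rewrite subr0 => /eqP; rewrite oner_eq0.
- by rewrite sub0r => /eqP; rewrite oppr_eq0 oner_eq0.
Qed.

Lemma conn1_dl (v : V) (f : V -> F) :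
  (forall e, s e != v -> t e != v -> dG f e = 0) ->
  exists a, forall e, dG f e = a * dG (ind v) e.
Proof.
move=> hf; have [//|w] := @vertex_avoiding [:: v]; rewrite inE => wv.
exists (f v - f w) => e; rewrite -dlZ.
rewrite (eq_dl s t e (g := fun u => (f v - f w) * (u == v)%:R + f w)) ?dlD ?dl_cst ?addr0//.
move=> u; have [->|uv] := eqVneq u v; first by rewrite mulr1 subrK.
by rewrite mulr0 add0r; exact: (conn1 hf).
Qed.

Lemma conn2_dl (u v : V) (f : V -> F) : u != v ->
  (forall e, s e != u -> s e != v -> t e != u -> t e != v -> dG f e = 0) ->
  exists a b, forall e, dG f e = a * dG (ind u) e + b * dG (ind v) e.
Proof.
move=> uv hf; have [//|w] := @vertex_avoiding [:: u; v]; rewrite !inE negb_or => /andP[wu wv].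
exists (f u - f w), (f v - f w) => e; rewrite -!dlZ -dlD.
rewrite (eq_dl s t e (g := fun x => (f u - f w) * (x == u)%:R + (f v - f w) * (x == v)%:R + f w)).
  by rewrite [LHS]dlD dl_cst addr0.
move=> x; have [->|xu] := eqVneq x u.
  by rewrite (negPf uv) mulr0 addr0 mulr1 subrK.
have [->|xv] := eqVneq x v; first by rewrite mulr0 add0r mulr1 subrK.
by rewrite !mulr0 !add0r; exact: (conn2 uv hf).
Qed.

(** [chi] indicates a union of components of [H]. Multiplying a potential of the star of [v] by
    [chi] restricts the star to these components, and by [conn1_dl] the result is a multiple of the
    star; so each star lies inside or outside. Connectedness of [G] puts all edges on one side, and
    [H] has no isolated vertices. *)
Lemma H_connected (h : W -> F) : (forall e, dH h e = 0) -> forall x y, h x = h y.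
Proof.
move=> hh x0 y0; apply: contrapT => xy.
pose chi x : F := (h x == h x0)%:R.
have he e : h (s' e) = h (t' e) by apply/eqP; rewrite -subr_eq0; apply/eqP/hh.
have mulchi k e : dH (fun x => chi x * k x) e = chi (s' e) * dH k e.
  by rewrite /dl /chi -he mulrBr.
pose P v := forall e, s e = v \/ t e = v -> chi (s' e) = 1.
pose N v := forall e, s e = v \/ t e = v -> chi (s' e) = 0.
have chi01 e : chi (s' e) = 1 \/ chi (s' e) = 0.
  by rewrite /chi; case: (_ == _); [left|right].
have PN v : P v \/ N v.
  have [k hk] := GH (ind v); have [f hf] := HG (fun x => chi x * k x).
  have hf' e : sg e * dG f e = sg e * (chi (s' e) * dG (ind v) e).
    by rewrite -hf mulchi hk; ring.
  have {}hf e : dG f e = chi (s' e) * dG (ind v) e by apply: (mulfI (sg0 e)).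
  have [|a ha] := @conn1_dl v f.
    by move=> e sv tv; rewrite hf (star0 v e).2 ?mulr0.
  have ca e : s e = v \/ t e = v -> chi (s' e) = a.
    move=> sv; have n0 : dG (ind v) e != 0.
      by apply/eqP => /star0[]; case: sv => -> ; rewrite eqxx.
    by apply: (mulIf n0); rewrite -hf ha.
  have [a1|a1] := eqVneq a 1; first by left=> e /ca; rewrite a1.
  right=> e ve; have := ca e ve; case: (chi01 e) => // -> e1.
  by rewrite e1 eqxx in a1.
have PorN : (forall v, P v) \/ (forall v, N v).
  have [Pall|/existsNP[v nPv]] := pselect (forall v, P v); [by left|right => w].
  pose f u : F := `[< N u >]%:R.
  have Nv : N v by case: (PN v).
  have fe e : dG f e = 0.
    rewrite /dl /f; apply/eqP; rewrite subr_eq0; apply/eqP; congr (_%:R : F); congr nat_of_bool.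
    have hst : N (s e) <-> N (t e).
      split=> h1.
        case: (PN (t e)) => // h3; have := h3 e (or_intror erefl).
        by rewrite (h1 e (or_introl erefl)) => /eqP; rewrite eq_sym oner_eq0.
      case: (PN (s e)) => // h3; have := h3 e (or_introl erefl).
      by rewrite (h1 e (or_intror erefl)) => /eqP; rewrite eq_sym oner_eq0.
    by apply/asboolP/asboolP => /hst.
  have := conn0 fe v w; rewrite /f (asboolT Nv).
  by case: asboolP => // _ /eqP; rewrite oner_eq0.
have chiE e : chi (s' e) = 1 <-> h (s' e) = h x0.
  rewrite /chi; case: eqP => //; split=> //.
  by move=> /eqP; rewrite eq_sym oner_eq0.
case: PorN => [Pall|Nall].
  have [e he0] := isoH y0.
  have : chi (s' e) = 1 by exact: (Pall (s e) e (or_introl erefl)).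
  by rewrite chiE => hx; apply: xy; rewrite -hx; case: he0 => ->.
have [e he0] := isoH x0.
have := Nall (s e) e (or_introl erefl).
suff -> : chi (s' e) = 1 by move=> /eqP; rewrite oner_eq0.
by apply/chiE; case: he0 => ->.
Qed.

Lemma H_connectedB (h k : W -> F) : (forall e, dH h e = dH k e) ->
  exists c, forall x, h x = k x + c.
Proof.
move=> hk; have c0 : forall e, dH (fun x => h x - k x) e = 0.
  by move=> e; rewrite dlB hk subrr.
have [[x0 _]|noW] := pselect (exists x : W, True); last first.
  by exists 0 => x; case: noW; exists x.
exists (h x0 - k x0) => x.
by rewrite -(H_connected c0 x x0) addrC subrK.
Qed.

(** Let [h v] be a potential on [H] of the star of [v]. The product [h u * h v] is again a function
    on [H], with differential zero off the two stars, so by [conn2] it is a combination of [h u],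
    [h v] and 1. Hence [h v] takes two values, and on one of its level sets all other [h u] are
    constant; as the [h u] and 1 span all functions, that level set is a single vertex. *)
Lemma star_star v : exists x, exists2 c, c != 0 &
  forall e, c * dH (fun y => (y == x)%:R) e = sg e * dG (ind v) e.
Proof.
have /choice[h hh] u : exists h : W -> F, forall e, dH h e = sg e * dG (ind u) e.
  exact: GH.
have hall (k : W -> F) : exists f c, forall x, k x = \sum_u f u * h u x + c.
  have [f hf] := HG k; exists f; apply: H_connectedB => e.
  rewrite hf dl_sum; under [RHS]eq_bigr do rewrite dlZ hh.
  rewrite -(eq_dl s t e (f := fun w => \sum_u f u * (w == u)%:R)) => [|w]; last exact: sum_indicr.
  rewrite dl_sum mulr_sumr; apply: eq_bigr => u _; rewrite dlZ; ring.
have [e1 he1] : exists e, s e = v \/ t e = v.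
  apply: contrapT => /forallNP nv.
  have [//|w] := @vertex_avoiding [:: v]; rewrite inE => wv.
  have := @conn0 (ind v) _ v w; rewrite eqxx (negPf wv) => h1.
  suff /h1/eqP : forall e, dG (ind v) e = 0 by rewrite oner_eq0.
  move=> e; apply/star0; split; apply/eqP => se; apply: (nv e); [by left|by right].
have dstar0 u e : dH (h u) e = 0 <-> (s e != u /\ t e != u).
  rewrite hh -star0; split=> [/eqP|->]; last by rewrite mulr0.
  by rewrite mulf_eq0 (negPf (sg0 e)) => /eqP.
have dprod (f g : W -> F) e : dH f e = 0 -> dH g e = 0 -> dH (fun x => f x * g x) e = 0.
  rewrite /dl => /eqP; rewrite subr_eq0 => /eqP-> /eqP; rewrite subr_eq0 => /eqP->.
  by rewrite subrr.
have prod u : u != v -> exists a b k, forall x, (h u x - b) * (h v x - a) = k.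
  move=> uv; have [f hf] := HG (fun x => h u x * h v x).
  have [|a [b hab]] := @conn2_dl u v f uv.
    move=> e su sv tu tv; apply: (mulfI (sg0 e)); rewrite -hf mulr0.
    by apply: dprod; apply/dstar0.
  have [|k hk] := @H_connectedB (fun x => h u x * h v x) (fun x => a * h u x + b * h v x).
    by move=> e; rewrite hf hab dlD !dlZ !hh; ring.
  exists a, b, (k + a * b) => x.
  have -> : (h u x - b) * (h v x - a) = h u x * h v x - (a * h u x + b * h v x) + a * b by ring.
  by rewrite hk; ring.
have [a2 [k2 hv2]] : exists a k, forall x, h v x * h v x = a * h v x + k.
  have [f hf] := HG (fun x => h v x * h v x).
  have [|a ha] := @conn1_dl v f.
    move=> e sv tv; apply: (mulfI (sg0 e)); rewrite -hf mulr0.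
    by apply: dprod; apply/dstar0.
  have [|k hk] := @H_connectedB (fun x => h v x * h v x) (fun x => a * h v x).
    by move=> e; rewrite hf ha dlZ hh; ring.
  by exists a, k.
pose al := h v (s' e1); pose be := h v (t' e1).
have ab : al != be.
  rewrite -subr_eq0; apply/eqP => /dstar0[].
  by case: he1 => ->; rewrite eqxx.
have two x : h v x = al \/ h v x = be.
  have : (h v x - al) * (h v x - be) = 0.
    have e0 : a2 = al + be.
      apply/eqP; rewrite -subr_eq0; have : (al - be) * (a2 - (al + be)) = 0.
        have := hv2 (s' e1); have := hv2 (t' e1); rewrite -/al -/be => q1 q2.
        have -> : (al - be) * (a2 - (al + be)) = (a2 * al + k2 - al * al) - (a2 * be + k2 - be * be) by ring.
        by rewrite -q1 -q2 !subrr.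
      by move/eqP; rewrite mulf_eq0 !subr_eq0 (negPf ab).
    have q1 := hv2 x; have q2 := hv2 (s' e1); rewrite -/al e0 in q2.
    have -> : (h v x - al) * (h v x - be) = h v x * h v x - ((al + be) * h v x - al * be) by ring.
    rewrite q1 e0; have -> : k2 = - (al * be) by apply: (addrI ((al + be) * al)); rewrite -q2; ring.
    by ring.
  move/eqP; rewrite mulf_eq0 !subr_eq0 => /orP[]/eqP; [by left|by right].
pose cst r u := forall x y, h v x = r -> h v y = r -> h u x = h u y.
(* Where [h v] has a value other than [a], [prod] determines [h u]; at least one of [al] and [be]
   differs from [a]. *)
have side u : u != v -> cst al u \/ cst be u.
  move=> /prod[a [b [k hk]]]; have key r : r != a -> cst r u.
    move=> ra x y hx hy; apply: (addIr (- b)); have ra' : r - a != 0 by rewrite subr_eq0.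
    by apply: (mulIf ra'); rewrite -{1}hx -hy !hk.
  have [aa|aa] := eqVneq al a; last by left; exact: key.
  by right; apply: key; rewrite -aa eq_sym.
(* The choice of side is constant along edges that avoid [v]: [h v] agrees at both ends in [H] of
   such an edge, so if its ends in [G] chose different sides, one of their potentials would be
   constant on that edge. *)
have all_side r r' : (forall x, h v x = r \/ h v x = r') ->
    (forall u, u != v -> cst r u \/ cst r' u) ->
    forall u0, u0 != v -> cst r u0 -> forall u, u != v -> cst r u.
  move=> tw sd u0 u0v cu0 u uv; pose f w : F := `[< cst r w >]%:R.
  have fe e : s e != v -> t e != v -> dG f e = 0.
    move=> sv tv; rewrite /dl /f; apply/eqP; rewrite subr_eq0; apply/eqP.
    congr (_%:R : F); congr nat_of_bool.
    have sym a b : (s e = a /\ t e = b) \/ (s e = b /\ t e = a) -> cst r a -> cst r b.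
      move=> sab ca.
      have bv : b != v by case: sab => -[sa sb]; rewrite -?sa -?sb.
      have sa : dH (h a) e != 0.
        by apply/eqP => /dstar0[]; case: sab => -[-> ->]; rewrite eqxx.
      have sb : dH (h b) e != 0.
        by apply/eqP => /dstar0[]; case: sab => -[-> ->]; rewrite eqxx.
      have hv0 : h v (s' e) = h v (t' e).
        by apply/eqP; rewrite -subr_eq0; apply/eqP/dstar0.
      case: (sd b bv) => // cb.
      case: (tw (s' e)) => hr.
        by move: sa; rewrite /dl (ca (s' e) (t' e)) ?subrr ?eqxx// -hv0.
      by move: sb; rewrite /dl (cb (s' e) (t' e)) ?subrr ?eqxx// -hv0.
    by apply/asboolP/asboolP; apply: sym; [left|right].
  have := conn1 fe u0v uv; rewrite /f (asboolT cu0).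
  by case: asboolP => // _ /eqP; rewrite oner_eq0.
(* [x1] is alone on its side: its indicator is a combination of the potentials and 1, all constant
   there. *)
have fin r r' x1 : h v x1 = r -> r != r' -> (forall x, h v x = r \/ h v x = r') ->
    (forall u, u != v -> cst r u) -> exists x, exists2 c, c != 0 &
    forall e, c * dH (fun y => (y == x)%:R) e = sg e * dG (ind v) e.
  move=> hx1 rr' tw ca.
  have single x : h v x = r -> x = x1.
    move=> hx; have [f [c hc]] := hall (fun y => (y == x1)%:R).
    have : (x == x1)%:R = (x1 == x1)%:R :> F.
      rewrite !hc; congr (_ + _); apply: eq_bigr => u _; congr (_ * _).
      have [->|uv] := eqVneq u v; first by rewrite hx hx1.
      exact: ca.
    by rewrite eqxx; case: eqP => // _ /eqP; rewrite eq_sym oner_eq0.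
  exists x1, (r - r'); first by rewrite subr_eq0.
  move=> e; rewrite -hh -dlZ.
  rewrite [RHS](eq_dl s' t' e (g := fun y => (r - r') * (y == x1)%:R + r')).
    by rewrite dlD dl_cst addr0.
  move=> y; have [->|yx] := eqVneq y x1; first by rewrite mulr1 subrK.
  rewrite mulr0 add0r; case: (tw y) => // /single yx1.
  by rewrite yx1 eqxx in yx.
have [//|u0] := @vertex_avoiding [:: v]; rewrite inE => u0v.
have two' x : h v x = be \/ h v x = al by case: (two x); [right|left].
have side' u : u != v -> cst be u \/ cst al u by move=> /side[]; [right|left].
case: (side u0 u0v) => cu.
  exact: (fin al be (s' e1)) (all_side al be two side u0 u0v cu).
by apply: (fin be al (t' e1)) (all_side be al two' side' u0 u0v cu); rewrite // eq_sym.
Qed.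

(** An edge at [v] lies in the star of [phi v], so incidences carry over. Injectivity holds because
    stars of distinct vertices of [G] are not proportional, surjectivity because [H] has no isolated
    vertices. *)
Lemma whitney_map : exists phi : V -> W, bijective phi /\
  forall e, (s' e = phi (s e) /\ t' e = phi (t e)) \/ (s' e = phi (t e) /\ t' e = phi (s e)).
Proof.
have /choice[phi hphi] := star_star.
have inc v e : (s e = v \/ t e = v) -> (s' e = phi v \/ t' e = phi v).
  have [c c0 hc] := hphi v; move=> ve; apply: contrapT => /not_orP[sv tv].
  have := hc e; rewrite /dl; move/eqP/negPf: sv => ->; move/eqP/negPf: tv => ->.
  rewrite subrr mulr0 => /esym/eqP; rewrite mulf_eq0 (negPf (sg0 e)) /= => /eqP/star0[].
  by case: ve => ->; rewrite eqxx.
have inj : injective phi.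
  move=> u v uv; apply: contrapT => /eqP nuv.
  have [c c0 hc] := hphi u; have [c' c'0 hc'] := hphi v.
  have he e : dG (fun w => c' * (w == u)%:R - c * (w == v)%:R) e = 0.
    by apply: (mulfI (sg0 e)); rewrite dlB !dlZ mulr0 mulrBr !(mulrCA (sg e)) -hc -hc' uv; ring.
  have [//|w] := @vertex_avoiding [:: u; v]; rewrite !inE negb_or => /andP[wu wv].
  have := conn0 he u w; rewrite eqxx (negPf wu) (negPf wv) (negPf nuv) !mulr0 mulr1 !subr0.
  by move/eqP; rewrite (negPf c'0).
have edge e : (s' e = phi (s e) /\ t' e = phi (t e)) \/
    (s' e = phi (t e) /\ t' e = phi (s e)).
  have st : phi (s e) <> phi (t e) by move/inj => se; have := loopG e; rewrite se eqxx.
  case: (inc (s e) e (or_introl erefl)) (inc (t e) e (or_intror erefl)) => -> [] h; [by []|by left|by right|].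
  by rewrite h in st.
exists phi; split=> //; apply: inj_card_bij => //.
rewrite -(card_codom inj); apply/subset_leq_card/fintype.subsetP => x _.
have [e [->|->]] := isoH x; case: (edge e) => -[h1 h2]; rewrite ?h1 ?h2; exact: codom_f.
Qed.

End Whitney.

(* Otherwise one side of the separation can be reflected in a hyperplane through
   [p u] and [p v]. *)
Lemma glob_rigid_separation (R : realFieldType) (V E I : finType) (s t : E -> V)
    (p : V -> I -> R) (k0 k1 : I) (T : eqType) (u v : V) (f : V -> T) :
  @generic_glob_rigid R V E s t I -> conf_generic p -> k0 != k1 -> u != v ->
  (forall e, s e != u -> s e != v -> t e != u -> t e != v -> f (s e) = f (t e)) ->
  forall a b, a != u -> a != v -> b != u -> b != v -> f a = f b.
Proof.
move=> gr gp k01 uv hf a b au av bu bv; apply/eqP; apply: contraT => fab.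
pose dv k := p u k - p v k.
(* A vector in the plane of the coordinates [k0] and [k1] orthogonal to [p u - p v]: normal to a
   hyperplane through [p u] and [p v]. *)
pose nu k : R := (k == k0)%:R * dv k1 - (k == k1)%:R * dv k0.
have sum_ind2 (i : I) (g : I -> R) : \sum_k (k == i)%:R * g k = g i.
  by under eq_bigr do rewrite eq_sym; exact: sum_indic.
have nuE (g : I -> R) : \sum_k nu k * g k = dv k1 * g k0 - dv k0 * g k1.
  transitivity (\sum_k ((k == k0)%:R * (dv k1 * g k) - (k == k1)%:R * (dv k0 * g k))).
    by apply: eq_bigr => k _; rewrite /nu; ring.
  by rewrite sumrB !sum_ind2.
have dv0 k : dv k != 0.
  apply/eqP => h; have [D [dD Dp]] := generic_dir (fun x _ => (x == u)%:R) gp.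
  have := congr1 D h; rewrite (derB _ _ dD) !Dp eqxx (der0 dD) eq_sym (negPf uv) subr0.
  by move/eqP; rewrite oner_eq0.
pose N := \sum_k nu k * nu k.
have N0 : N != 0.
  rewrite /N nuE /nu !eqxx [k1 == k0]eq_sym (negPf k01) !mul1r !mul0r subr0 sub0r.
  rewrite mulrN opprK gt_eqF// -!expr2; apply: ltr_pwDl; last exact: sqr_ge0.
  by rewrite exprn_even_gt0 //= dv0.
have nuu : \sum_k nu k * dv k = 0 by rewrite nuE; ring.
pose ht w := \sum_k nu k * (p w k - p u k).
have htu : ht u = 0 by apply: big1 => k _; rewrite subrr mulr0.
have htv : ht v = 0.
  apply/eqP; rewrite -oppr_eq0 /ht -sumrN; apply/eqP; rewrite -[RHS]nuu.
  by apply: eq_bigr => k _; rewrite /dv; ring.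
have ht0 w : w != u -> w != v -> ht w != 0.
  move=> wu wv; apply/eqP => h.
  have [D [dD Dp]] := generic_dir (fun x k => (x == w)%:R * (k == k0)%:R) gp.
  have := congr1 D h; rewrite /ht nuE (der0 dD) !(derB _ _ dD) !(derM dD) !(derB _ _ dD) !Dp.
  rewrite !eqxx ![_ == w]eq_sym (negPf wu) (negPf wv) [k1 == k0]eq_sym (negPf k01).
  rewrite !mul0r !mulr0 !subr0 !mul0r !mul1r !mulr1 !mulr0 !add0r subr0 => /eqP.
  by rewrite (negPf (dv0 k1)).
(* The side of [a], to be reflected with coefficient [c]; this coefficient is 0 at [u] and [v],
   which therefore count on either side. *)
pose S w := [&& w != u, w != v & f w == f a].
pose c w := 2 * (ht w / N).
pose q w k := if S w then p w k - c w * nu k else p w k.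
have htB w w' : \sum_k nu k * (p w k - p w' k) = ht w - ht w'.
  by rewrite /ht -sumrB; apply: eq_bigr => k _; ring.
have refl_len w w' cw cw' : \sum_k (p w k - cw * nu k - (p w' k - cw' * nu k)) ^+ 2 =
    \sum_k (p w k - p w' k) ^+ 2 -
    2 * (cw - cw') * (ht w - ht w') + (cw - cw') ^+ 2 * N.
  rewrite -htB /N !mulr_sumr -sumrB -big_split; apply: eq_bigr => k _ /=; ring.
pose cc w := if S w then c w else 0.
have qE w k : q w k = p w k - cc w * nu k.
  by rewrite /q /cc; case: (S w); rewrite ?mul0r ?subr0.
have qlen w w' : \sum_k (q w k - q w' k) ^+ 2 = \sum_k (p w k - p w' k) ^+ 2 -
    2 * (cc w - cc w') * (ht w - ht w') + (cc w - cc w') ^+ 2 * N.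
  by rewrite -refl_len; apply: eq_bigr => k _; rewrite !qE.
have same w w' : (w = u \/ w = v \/ S w) -> (w' = u \/ w' = v \/ S w') ->
    \sum_k (p w k - p w' k) ^+ 2 = \sum_k (q w k - q w' k) ^+ 2.
  have cE x : (x = u \/ x = v \/ S x) -> cc x = c x.
    rewrite /cc /c; case: (boolP (S x)) => // nS [->|[->|]]; rewrite ?htu ?htv ?mul0r ?mulr0 //.
  by move=> /cE h1 /cE h2; rewrite qlen h1 h2 /c; field.
have other w w' : ~~ S w -> ~~ S w' ->
    \sum_k (p w k - p w' k) ^+ 2 = \sum_k (q w k - q w' k) ^+ 2.
  by move=> /negPf h1 /negPf h2; apply: eq_bigr => k _; rewrite /q h1 h2.
have eqv e : \sum_k dl s t (p^~ k) e ^+ 2 = \sum_k dl s t (q^~ k) e ^+ 2.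
  rewrite /dl; case: (boolP (S (s e))) => Ss; case: (boolP (S (t e))) => St.
  - by apply: same; right; right.
  - apply: same; first by right; right.
    have [->|tu] := eqVneq (t e) u; first by left.
    have [->|tv] := eqVneq (t e) v; first by right; left.
    move: St Ss => /negP St /and3P[su sv /eqP fs]; case: St.
    by rewrite /S tu tv -fs (hf e) ?eqxx.
  - apply: same; last by right; right.
    have [->|su] := eqVneq (s e) u; first by left.
    have [->|sv] := eqVneq (s e) v; first by right; left.
    move: Ss St => /negP Ss /and3P[tu tv /eqP ft]; case: Ss.
    by rewrite /S su sv -ft (hf e) ?eqxx.
  - exact: other.
have Sa : S a by rewrite /S au av eqxx.
have Sb : S b = false by rewrite /S [f b == _]eq_sym (negPf fab) !andbF.
have := gr p q gp eqv a b; rewrite qlen /cc Sa Sb subr0 => h.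
(* Reflecting [a] but not [b] changes their squared distance by this amount, which genericity makes
   nonzero. *)
have : 4 * ht a * ht b / N = 0.
  have -> : 4 * ht a * ht b / N = - 2 * c a * (ht a - ht b) + c a ^+ 2 * N.
    by rewrite /c; field.
  have -> : - 2 * c a * (ht a - ht b) + c a ^+ 2 * N =
    \sum_k (p a k - p b k) ^+ 2 - 2 * c a * (ht a - ht b) + c a ^+ 2 * N -
      \sum_k (p a k - p b k) ^+ 2 by ring.
  by rewrite -h subrr.
by move/eqP; rewrite !mulf_eq0 pnatr_eq0 invr_eq0 (negPf N0) (negPf (ht0 a au av)) (negPf (ht0 b bu bv)).
Qed.

(** * The graph of a length-equivalent framework *)

(** A countable set has Lebesgue measure 0, the unit interval measure 1. *)
Lemma real_uncountable (R : realType) : ~ countable [set: R].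
Proof.
move=> cR; have c01 : countable (`[0%R, 1%R]%classic : set R).
  by apply: sub_countable cR; apply: subset_card_le.
have := countable_lebesgue_measure0 c01.
rewrite lebesgue_measure_itv /= lte01 oppr0 adde0 => /eqP.
by rewrite eqe oner_eq0.
Qed.

Lemma complex_uncountable (R : realType) : ~ countable [set: complex R].
Proof.
move=> /countable_injP[f finj]; apply: (@real_uncountable R); apply/countable_injP.
exists (fun x => f (real_complex R x)) => x y _ _ /finj h.
by apply: complexI; apply: h; rewrite inE.
Qed.

Lemma set2_eq (T : finType) (x y a b : T) : [set x; y] = [set a; b] ->
  (x = a /\ y = b) \/ (x = b /\ y = a).
Proof.
move=> /setP h; have := h x; have := h y; have := h a; have := h b.
rewrite !inE !eqxx ?orbT => /orP hb /orP ha /esym/orP hy /esym/orP hx.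
by case: ha => /eqP ?; case: hb => /eqP ?; case: hx => /eqP ?; case: hy => /eqP ?; subst; auto.
Qed.

Section OrientedEdges.
Variables (V : finType) (e : rel V).
Hypothesis simple_e : simple_graph e.

(** One orientation per edge, chosen by [enum_rank], so that edges form a finite type with two end
    maps. *)
Definition oriented (x : V * V) : bool :=
  e x.1 x.2 && (enum_rank x.1 < enum_rank x.2)%N.
Definition oedge : Type := {x : V * V | oriented x}.
HB.instance Definition _ := Finite.on oedge.
Definition osrc (x : oedge) : V := (val x).1.
Definition otgt (x : oedge) : V := (val x).2.

Lemma oedge_rel x : e (osrc x) (otgt x).
Proof. by have /andP[] := valP x. Qed.

Lemma oedge_loop x : osrc x != otgt x.
Proof.
by apply: contraTneq (oedge_rel x) => ->; rewrite simple_e.2.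
Qed.

Lemma oedgeP u v : e u v -> exists x, (osrc x = u /\ otgt x = v) \/ (osrc x = v /\ otgt x = u).
Proof.
move=> euv; have uv : enum_rank u != enum_rank v :> nat.
  by apply: contraTneq euv => /ord_inj/enum_rank_inj ->; rewrite simple_e.2.
have [lt|lt|/eqP] := ltngtP (enum_rank u) (enum_rank v); last by rewrite (negPf uv).
  have h : oriented (u, v) by rewrite /oriented /= euv.
  by exists (exist (fun x => is_true (oriented x)) _ h); left.
have h : oriented (v, u) by rewrite /oriented /= simple_e.1 euv.
by exists (exist (fun x => is_true (oriented x)) _ h); right.
Qed.

Lemma oedge_set_inj x y : [set osrc x; otgt x] = [set osrc y; otgt y] -> x = y.
Proof.
move=> /set2_eq[[h1 h2]|[h1 h2]].
  by apply: val_inj; apply: injective_projections.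
have /andP[_ ltx] := valP x; have /andP[_] := valP y.
by rewrite -/(osrc y) -/(otgt y) -h1 -h2 ltnNge ltnW.
Qed.

Lemma oedge_edges x : [set osrc x; otgt x] \in edges e.
Proof.
apply/imsetP; exists (osrc x, otgt x) => //; by rewrite inE oedge_rel.
Qed.

Lemma edges_oedge S : S \in edges e -> exists x, S = [set osrc x; otgt x].
Proof.
move=> /imsetP[[u v]]; rewrite inE /= => /oedgeP[x hx] ->; exists x.
by case: hx => -[-> ->] //; rewrite finset.setUC.
Qed.

End OrientedEdges.

(** The carrier of [RR] with the structure required by compactness and measure. *)
Definition realR : realType := Rdefinitions.R.

Lemma sqlen_sym (F : fieldType) (V : finType) d (p : V -> 'I_d -> F) u v :
  sqlen p u v = sqlen p v u.
Proof. by apply: eq_bigr => k _; rewrite -sqrrN opprB. Qed.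

Lemma dist_eq (V : finType) d (p q : V -> 'I_d -> RR) u v :
  dist p u v = dist q u v <-> sqlen p u v = sqlen q u v.
Proof.
split=> [h|h]; last by rewrite /dist h.
have sq (r : V -> 'I_d -> RR) : sqlen r u v = dist r u v ^+ 2.
  by rewrite sqr_sqrtr//; apply: sumr_ge0 => k _; exact: sqr_ge0.
by rewrite !sq h.
Qed.

Lemma globally_rigid_generic (V : finType) (e : rel V) d : simple_graph e ->
  globally_rigid e d -> @generic_glob_rigid realR V (oedge e) (@osrc V e) (@otgt V e) 'I_d.
Proof.
move=> simple gr p q [D hD] len u v.
have gp : generic (p : V -> 'I_d -> RR) by apply: (dual_derivs_alg_indep hD).
suff h : @dist V d q u v = @dist V d p u v by symmetry; exact: ((dist_eq q p u v).1 h).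
apply: (gr p gp) => {}u {}v /(oedgeP simple)[x hx]; apply/dist_eq.
have : @sqlen RR V d p (osrc x) (otgt x) = @sqlen RR V d q (osrc x) (otgt x) := len x.
by case: hx => -[-> ->] h; rewrite // sqlen_sym [RHS]sqlen_sym.
Qed.

Lemma exists_generic (F : numFieldType) (V I : finType) : ~ countable [set: F] ->
  exists p : V -> I -> F, conf_generic p.
Proof.
move=> uncF; have [c [D [hD _]]] := exists_dual_derivs uncF (V * I)%type (@of_void F).
by exists (fun v k => c (v, k)), D; split=> [|i [v k]]; [exact: hD.1|exact: hD.2].
Qed.

Theorem theorem3p6 (d : nat) (V : finType) (e : rel V) :
  (2 <= d)%N -> simple_graph e -> (d + 2 <= #|V|)%N ->
  globally_rigid e d -> fully_reconstructible e d.
Proof.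
move=> d2 simple dV gr p genp W eH simpleH isoH q genq psi [psi_inj psi_im psi_len].
have d0 : (0 < d)%N by exact: ltnW.
have dV0 : (d < #|V|)%N by apply: leq_trans dV; rewrite addn2 ltnS leqnSn.
have V4 : (4 <= #|V|)%N by apply: leq_trans dV; rewrite -[4%N]/(2 + 2)%N leq_add2r.
pose k0 := Ordinal d0; pose k1 := Ordinal d2.
pose C : numClosedFieldType := complex RR.
have uncR := @real_uncountable realR.
have uncC : ~ countable [set: C] := @complex_uncountable realR.
pose s := @osrc V e; pose t := @otgt V e.
have ggr := globally_rigid_generic simple gr.
(* Global rigidity concerns real frameworks, so rigidity and the kernel are first settled for a real
   generic [p0], unrelated to [p], and then transferred. *)
have [p0 gp0] := exists_generic V 'I_d uncR.
have gp : @conf_generic C V 'I_d p by exact: alg_indep_dual_derivs genp.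
have gq : @conf_generic C W 'I_d q by exact: alg_indep_dual_derivs genq.
have IV : (#|'I_d| < #|V|)%N by rewrite card_ord.
have [rig ker] := @rigid_kernel_transfer realR C (real_complex RR) V (oedge e) s t 'I_d p0 p
  uncC IV gp0 gp (glob_rigid_inf_rigid uncR IV ggr gp0)
  (fun z => glob_rigid_kernel uncR d0 dV0 ggr gp0).
(* Each edge of [G] is matched with an ordered pair of ends of its image; [psi_len] may list the
   ends in the other order, which leaves the squared length unchanged. *)
have /choice[f hf] (x : oedge e) : exists y : W * W, [/\ eH y.1 y.2,
    psi [set s x; t x] = [set y.1; y.2] & sqlen q y.1 y.2 = sqlen p (s x) (t x)].
  have : psi [set s x; t x] \in edges eH by rewrite -psi_im imset_f// oedge_edges.
  move=> /imsetP[[a b]]; rewrite inE /= => eab psi_ab.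
  have [a' [b' [h len]]] := psi_len _ _ (oedge_rel x).
  exists (a, b); split=> //=; rewrite -len.
  by move: h; rewrite psi_ab => /set2_eq[] [-> ->] //; rewrite sqlen_sym.
pose s' x := (f x).1; pose t' x := (f x).2.
have psiE x : psi [set s x; t x] = [set s' x; t' x] by have [] := hf x.
have loopH x : s' x != t' x.
  by have [+ _ _] := hf x; apply: contraTneq; rewrite /s' /t' => ->; rewrite simpleH.2.
have simple_f x y : (s' x = s' y /\ t' x = t' y) \/ (s' x = t' y /\ t' x = s' y) -> x = y.
  move=> h; apply: (@oedge_set_inj V e); apply: psi_inj; rewrite ?oedge_edges//.
  by rewrite -/(s x) -/(t x) -/(s y) -/(t y) !psiE; case: h => -[-> ->] //; rewrite finset.setUC.
have coverH a b : eH a b -> exists x, [set a; b] = [set s' x; t' x].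
  move=> eab; have : [set a; b] \in edges eH by apply/imsetP; exists (a, b); rewrite ?inE.
  rewrite -psi_im => /imsetP[S /edges_oedge[//|x ->] h]; exists x.
  by rewrite h -psiE.
have isoE x : exists y, x = s' y \/ x = t' y.
  have [b /coverH[y /set2_eq[[-> _]|[-> _]]]] := isoH x; exists y; [by left|by right].
have len x : \sum_k dl s t (p^~ k) x ^+ 2 = \sum_k dl s' t' (q^~ k) x ^+ 2 :> C.
  by have [_ _ h] := hf x; symmetry; exact: h.
have IV1 : (#|'I_d|.+1 < #|V|)%N by rewrite card_ord; apply: leq_trans dV; rewrite addn2.
have [sg [sg0 HG GH]] := @cut_spaces C V W (oedge e) 'I_d s t s' t' p q len gp gq IV1 rig ker
  loopH simple_f k0.
(* The function is complex-valued while the rigid frameworks are real; [glob_rigid_separation]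
   accepts values in any [eqType]. *)
have conn2 (u v : V) (g : V -> C) : u != v ->
    (forall x, s x != u -> s x != v -> t x != u -> t x != v -> dl s t g x = 0) ->
    forall a b, a != u -> a != v -> b != u -> b != v -> g a = g b.
  move=> uv hg; apply: (glob_rigid_separation (k0 := k0) (k1 := k1) ggr gp0) => //.
  by move=> x su sv tu tv; apply/eqP; rewrite -subr_eq0; apply/eqP; exact: hg.
have [phi [phi_bij hphi]] := @whitney_map C V W (oedge e) s t s' t' sg V4 conn2
  (oedge_loop simple) isoE sg0 HG GH.
have hset x : [set s' x; t' x] = [set phi (s x); phi (t x)].
  by case: (hphi x) => -[-> ->] //; rewrite finset.setUC.
exists phi; split=> // [u v|u v euv].
  apply/idP/idP => [euv|/coverH[x]].
    have [x hx] := oedgeP simple euv; have [eHx _ _] := hf x.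
    have symH := simpleH.1; move: eHx; rewrite -/(s' x) -/(t' x).
    by case: (hphi x) => -[-> ->]; rewrite /s /t; case: hx => -[-> ->] //; rewrite symH.
  rewrite hset => /set2_eq[] [] /(bij_inj phi_bij) -> /(bij_inj phi_bij) ->.
    exact: oedge_rel.
  by rewrite simple.1 oedge_rel.
have [x hx] := oedgeP simple euv; have := psiE x; rewrite hset /s /t.
by case: hx => -[-> ->] //; rewrite finset.setUC [RHS]finset.setUC.
Qed.
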